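(* Let $\mathbb B=\{q\in\mathbb H:|q|<1\}$ be the open quaternionic unit ball. Suppose $f:\mathbb B\to\mathbb B$ is a slice regular function which is not bijective. Let $p,s\in\mathbb B$. Then for all $q\in\mathbb B$ $$\left|(\mathcal M_{f^\star_p(s)}\bullet f^\star_p)(q)\right|\le\left|\mathcal M_s(q)\right|,$$ where $f^\star_p$ is the hyperbolic difference quotient of $f$ at $p$ and $\mathcal M_{f^\star_p(s)}\bullet f^\star_p=(1-f^\star_p\ast\overline{f^\star_p(s)})^{-\ast}\ast(f^\star_p-f^\star_p(s))$. Equality holds for some $q\in\mathbb B\setminus\{s\}$ (and hence for any $q\in\mathbb B$) if and only if $f$ is a slice regular Blaschke product of degree two.
   Context: $\mathbb H$ is the skew-field of quaternions, $\mathbb S=\{I\in\mathbb H:I^2=-1\}$, and $\mathbb C_I=\mathbb R+\mathbb RI$ for $I\in\mathbb S$. A function $f:\mathbb B\to\mathbb H$ is slice regular if it has continuous partial derivatives and $\frac12(\partial_x+I\partial_y)f(x+yI)=0$ on $\mathbb B\cap\mathbb C_I$ for every $I\in\mathbb S$; equivalently $f(q)=\sum_{m\ge0}q^ma_m$ with $a_m\in\mathbb H$, the series converging on $\mathbb B$. For $f=\sum q^ma_m$ and $g=\sum q^mb_m$: $f\ast g=\sum_m q^m\sum_{\ell=0}^m a_{m-\ell}b_\ell$ (constants are regarded as constant functions), $f^c=\sum q^m\overline{a_m}$, $f^s=f\ast f^c$, and $f^{-\ast}(q)=f^s(q)^{-1}f^c(q)$, which is slice regular off the zero set of $f^s$.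 For $p\in\mathbb B$, $\mathcal M_p(q)=(1-q\overline p)^{-\ast}\ast(q-p)$ ($\ast$-operations with respect to the variable $q$). The regular Möbius transformations of $\mathbb B$ are the functions $\mathcal M_pu$ with $p\in\mathbb B$, $|u|=1$. For $c\in\mathbb B$ and a slice regular $g:\mathbb B\to\mathbb B$, $\mathcal M_c\bullet g:=(1-g\,\overline c)^{-\ast}\ast(g-c)$. Hyperbolic difference quotient: for slice regular $f:\mathbb B\to\mathbb B$ and $p\in\mathbb B$, let $\mathcal R_{f,p}$ be the unique slice regular function on $\mathbb B$ with $f(q)=f(p)+(q-p)\ast\mathcal R_{f,p}(q)$. Then $f^\star_p(q):=(1-q\overline p)\ast\mathcal R_{f,p}(q)\ast(1-\overline{f(p)}\ast f(q))^{-\ast}$, a slice regular function on $\mathbb B$ (equivalently $f^\star_p=\mathcal M_p^{-\ast}\ast(\mathcal M_{f(p)}\bullet f)$, extended over removable singularities). A slice regular (finite) Blaschke product is a function $\mathcal M_{s_1}\ast\cdots\ast\mathcal M_{s_\kappa}u$ with $\kappa\ge1$, $s_1,\dots,s_\kappa\in\mathbb B$, $|u|=1$; the number $\kappa$ is uniquely determined by the function and is called its degree. *)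

(* Defs.v *)
From Stdlib Require Import Reals List ClassicalEpsilon.
From Coquelicot Require Export Coquelicot.

Open Scope R_scope.

(** * Quaternions

    [((a, b), (c, d))] is [a + b i + c j + d k].  As an iterated product of copies
    of [R], the type inherits from Coquelicot the structure of a real normed module
    whose norm is Euclidean ([quat_norm] below), which is what [is_series],
    [is_derive] and [continuous] refer to. *)

Definition quat : Type := ((R * R) * (R * R))%type.

Definition re (q : quat) : R := fst (fst q).
Definition im_i (q : quat) : R := snd (fst q).
Definition im_j (q : quat) : R := fst (snd q).
Definition im_k (q : quat) : R := snd (snd q).

Definition mkq (a b c d : R) : quat := ((a, b), (c, d)).

Definition qreal (x : R) : quat := mkq x 0 0 0.
Definition q0 : quat := qreal 0.
Definition q1 : quat := qreal 1.

Definition qadd (p q : quat) : quat :=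
  mkq (re p + re q) (im_i p + im_i q) (im_j p + im_j q) (im_k p + im_k q).

Definition qopp (q : quat) : quat :=
  mkq (- re q) (- im_i q) (- im_j q) (- im_k q).

Definition qsub (p q : quat) : quat := qadd p (qopp q).

Definition qmul (p q : quat) : quat :=
  mkq (re p * re q - im_i p * im_i q - im_j p * im_j q - im_k p * im_k q)
      (re p * im_i q + im_i p * re q + im_j p * im_k q - im_k p * im_j q)
      (re p * im_j q - im_i p * im_k q + im_j p * re q + im_k p * im_i q)
      (re p * im_k q + im_i p * im_j q - im_j p * im_i q + im_k p * re q).

Definition qconj (q : quat) : quat :=
  mkq (re q) (- im_i q) (- im_j q) (- im_k q).

Definition qmod (q : quat) : R :=
  sqrt (re q ^ 2 + im_i q ^ 2 + im_j q ^ 2 + im_k q ^ 2).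

Definition qinv (q : quat) : quat := qmul (qreal (/ (qmod q ^ 2))) (qconj q).

Fixpoint qpow (q : quat) (n : nat) : quat :=
  match n with
  | O => q1
  | S m => qmul q (qpow q m)
  end.

Declare Scope quat_scope.
Delimit Scope quat_scope with quat.
Bind Scope quat_scope with quat.
Infix "+" := qadd : quat_scope.
Infix "-" := qsub : quat_scope.
Infix "*" := qmul : quat_scope.
Infix "^" := qpow : quat_scope.

Lemma quat_norm (q : quat) : norm (q : (R * R) * (R * R)) = qmod q.
Proof.
destruct q as [[a b] [c d]].
unfold norm, qmod, re, im_i, im_j, im_k; simpl; unfold prod_norm; simpl.
unfold norm; simpl; unfold prod_norm; simpl; unfold norm; simpl; unfold abs; simpl.
f_equal.
rewrite !Rmult_1_r, !sqrt_sqrt, <- !Rabs_mult, !Rabs_pos_eq;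
  try ring; try apply Rle_0_sqr; apply Rplus_le_le_0_compat; apply Rle_0_sqr || apply Rabs_pos.
Qed.

(** * The unit ball and slice regular functions

    Functions on the unit ball are represented by total functions [quat -> quat];
    their values outside the ball are irrelevant. *)

Definition ball1 (q : quat) : Prop := qmod q < 1.

Definition bijective_on_ball1 (f : quat -> quat) : Prop :=
  (forall q, ball1 q -> ball1 (f q)) /\
  (forall q r, ball1 q -> ball1 r -> f q = f r -> q = r) /\
  (forall w, ball1 w -> exists q, ball1 q /\ f q = w).

Definition imag_unit (I : quat) : Prop := (I * I)%quat = qreal (-1).

Definition slice_pt (I : quat) (x y : R) : quat := (qreal x + qreal y * I)%quat.

Definition slice_regular (f : quat -> quat) : Prop :=
  forall I : quat, imag_unit I ->
  exists fx fy : R * R -> quat,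
  forall x y : R, ball1 (slice_pt I x y) ->
    is_derive (fun t : R => f (slice_pt I t y)) x (fx (x, y)) /\
    is_derive (fun t : R => f (slice_pt I x t)) y (fy (x, y)) /\
    continuous fx (x, y) /\
    continuous fy (x, y) /\
    (qreal (1 / 2) * (fx (x, y) + I * fy (x, y)))%quat = q0.

(** * Power series and the operations on slice regular functions *)

Definition has_expansion (f : quat -> quat) (a : nat -> quat) : Prop :=
  forall q, ball1 q -> is_series (fun m => (q ^ m * a m)%quat) (f q).

(** The expansion of a slice regular function exists and is unique, so that the
    choice below is immaterial for such functions. *)
Definition coef (f : quat -> quat) : nat -> quat :=
  epsilon (inhabits (fun _ => q0)) (has_expansion f).

Definition qseries (u : nat -> quat) : quat :=
  mkq (Series (fun m => re (u m))) (Series (fun m => im_i (u m)))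
      (Series (fun m => im_j (u m))) (Series (fun m => im_k (u m))).

Definition power_series (a : nat -> quat) (q : quat) : quat :=
  qseries (fun m => (q ^ m * a m)%quat).

Definition cst (c : quat) : quat -> quat := fun _ => c.

Definition star (f g : quat -> quat) : quat -> quat :=
  power_series (fun m =>
    sum_n (fun l => (coef f (m - l)%nat * coef g l)%quat) m).

Definition regular_conj (f : quat -> quat) : quat -> quat :=
  power_series (fun m => qconj (coef f m)).

Definition symmetrization (f : quat -> quat) : quat -> quat :=
  star f (regular_conj f).

Definition star_inv (f : quat -> quat) : quat -> quat :=
  fun q => (qinv (symmetrization f q) * regular_conj f q)%quat.

(** * Moebius transformations and Blaschke products *)

Definition mobius (p : quat) : quat -> quat :=
  star (star_inv (fun q => q1 - q * qconj p)%quat) (fun q => q - p)%quat.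

Definition mobius_act (c : quat) (g : quat -> quat) : quat -> quat :=
  star (star_inv (fun q => q1 - g q * qconj c)%quat) (fun q => g q - c)%quat.

(** [s] is the first zero and [l] lists the remaining ones, so that the product
    has at least one factor. *)
Definition mobius_star_prod (s : quat) (l : list quat) : quat -> quat :=
  fold_left star (map mobius l) (mobius s).

Definition blaschke_of_degree (k : nat) (f : quat -> quat) : Prop :=
  exists (s : quat) (l : list quat) (u : quat),
    S (length l) = k /\
    List.Forall ball1 (s :: l) /\
    qmod u = 1 /\
    forall q, ball1 q -> f q = (mobius_star_prod s l q * u)%quat.

(** * The hyperbolic difference quotient *)

Definition is_diff_quotient (f : quat -> quat) (p : quat) (r : quat -> quat) : Prop :=
  slice_regular r /\
  forall q, ball1 q -> f q = (f p + star (fun z => z - p)%quat r q)%quat.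

(** For [f] slice regular and [p] in the ball there is exactly one such function
    on the ball. *)
Definition diff_quotient (f : quat -> quat) (p : quat) : quat -> quat :=
  epsilon (inhabits (cst q0)) (is_diff_quotient f p).

Definition hyp_diff_quotient (f : quat -> quat) (p : quat) : quat -> quat :=
  star (star (fun q => q1 - q * qconj p)%quat (diff_quotient f p))
       (star_inv (fun q => q1 - star (cst (qconj (f p))) f q)%quat).

(* Main.v *)
Require Import Defs.
From Stdlib Require Import Reals Arith Lra Lia FunctionalExtensionality ClassicalEpsilon Ncring Ncring_tac List.
From Coquelicot Require Import Coquelicot.
Open Scope R_scope.

(** A slice regular function is identified with the sequence of its coefficients.  Such sequences
    form a ring in which the variable is central and the product is the star product, and most
    of the proof is algebra in this ring.  Write [a] for the series of [f], [M_p] for the series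
    of the Moebius transformation with zero [p], and [M_c . a] for the Moebius image of [a].

    The inequality is the Schwarz lemma, used twice.  A slice regular function with values in
    the closed ball acts by left star multiplication as a contraction of l^2
    ([contractive_of_bounded]).  Conversely, a contractive series has modulus at most one on the
    ball and is constant if the modulus one occurs inside ([contractive_bound],
    [contractive_maximum]).  The Moebius images of a contractive series are contractive
    ([contractive_mobius]).  If it vanishes at [p], then it can be divided by [M_p] without losing
    contractivity ([schur_division]), because [M_p] acts isometrically.  Therefore
    [M_{f(p)} . a = M_p * g], where the contractive series [g] is that of the hyperbolic difference
    quotient ([has_expansion_hyp_diff_quotient]), and likewise [M_{g(s)} . g = M_s * h] with [h]
    contractive.  The value of [M_s * h] at [q] is [M_s(q) h(r)] for a conjugate [r] of [q]
    ([power_series_mul_conjugate]).  This gives the inequality; equality at a single [q] other than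
    [s] forces [|h(r)| = 1], so that [h] is a unimodular constant and equality holds everywhere.

    It remains to decide when [h] is constant.  The tool is the rank of the defect kernel
    [(1 - a(q) conj(a(r))) / (1 - q conj(r))].  The rank is zero for unimodular constants, one for
    Moebius series and two for products of two Moebius series.  It does not change under the
    Moebius action ([defect2_mobius]), goes up by one in a multiplication by [M_p]
    ([defect2_mob_mul]) and down by one in the division by [M_p] at a zero [p]
    ([defect2_division]).  So [h] is constant if and only if [g] has rank one
    ([defect1_iff_unimodular_quotient]), and then [a] has rank two.  A series of rank one is a
    Moebius series, up to a unimodular constant ([defect1_mobius_series]).  To treat rank two in
    the same way, a zero [z] of [a] in the ball is needed, so that [M_z] can be divided out.  It is
    provided by a right eigenvector of the backward shift on the two-dimensional defect space
    ([mobius_image_of_product_has_zero]), which exists because quadratic equations over the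
    quaternions are solvable.  The smaller ranks are excluded as [f] would then be a constant of
    modulus one or a Moebius transformation, which is bijective ([bijective_of_mobius_series]).

    Functions and series are linked by Cauchy's formula on the slices
    ([slice_regular_has_expansion]) and, for the existence of the difference quotient as a slice
    regular function, by the differentiability of power series ([slice_regular_of_expansion]). *)

(** * Algebra of quaternions *)

Definition sqnorm (q : quat) : R :=
  re q * re q + im_i q * im_i q + im_j q * im_j q + im_k q * im_k q.

Ltac quat_unfold :=
  cbv [qadd qsub qopp qmul qconj qreal q0 q1 mkq re im_i im_j im_k sqnorm fst snd] in *.

Ltac quat_ring :=
  intros;
  repeat match goal with q : quat |- _ => destruct q as [[? ?] [? ?]] end;
  quat_unfold; repeat (apply (f_equal2 (@pair _ _))); ring.

Global Instance quat_ring_ops : @Ring_ops quat q0 q1 qadd qmul qsub qopp eq := {}.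

Global Instance quat_is_ring : @Ncring.Ring quat q0 q1 qadd qmul qsub qopp eq quat_ring_ops.
Proof.
constructor; try exact eq_equivalence;
  try solve [intros ? ? -> ? ? ->; reflexivity | intros ? ? ->; reflexivity];
  unfold addition, multiplication, subtraction, opposite, equality, Algebra_syntax.zero, Algebra_syntax.one,
    add_notation, mul_notation, sub_notation, opp_notation, eq_notation,
    zero_notation, one_notation; quat_ring.
Qed.

Lemma qmul_assoc p q r : (p * (q * r) = p * q * r)%quat.
Proof. quat_ring. Qed.

Lemma qadd_comm p q : (p + q = q + p)%quat.
Proof. quat_ring. Qed.

Lemma qadd_assoc p q r : (p + (q + r) = p + q + r)%quat.
Proof. quat_ring. Qed.

Lemma qmul_add_l p q r : ((p + q) * r = p * r + q * r)%quat.
Proof. quat_ring. Qed.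

Lemma qmul_add_r p q r : (p * (q + r) = p * q + p * r)%quat.
Proof. quat_ring. Qed.

Lemma qmul_1_l q : (q1 * q = q)%quat.
Proof. quat_ring. Qed.

Lemma qmul_1_r q : (q * q1 = q)%quat.
Proof. quat_ring. Qed.

Lemma qmul_0_l q : (q0 * q = q0)%quat.
Proof. quat_ring. Qed.

Lemma qmul_0_r q : (q * q0 = q0)%quat.
Proof. quat_ring. Qed.

Lemma qadd_0_r q : (q + q0 = q)%quat.
Proof. quat_ring. Qed.

Lemma qadd_0_l q : (q0 + q = q)%quat.
Proof. quat_ring. Qed.

Lemma qconj_mul p q : qconj (p * q) = (qconj q * qconj p)%quat.
Proof. quat_ring. Qed.

Lemma qconj_add p q : qconj (p + q) = (qconj p + qconj q)%quat.
Proof. quat_ring. Qed.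

Lemma qconj_conj q : qconj (qconj q) = q.
Proof. quat_ring. Qed.

Lemma qconj_0 : qconj q0 = q0.
Proof. quat_ring. Qed.

Lemma qconj_1 : qconj q1 = q1.
Proof. quat_ring. Qed.

Lemma qconj_real x : qconj (qreal x) = qreal x.
Proof. quat_ring. Qed.

Lemma qreal_mul x y : qreal (x * y) = (qreal x * qreal y)%quat.
Proof. quat_ring. Qed.

Lemma qreal_add x y : qreal (x + y) = (qreal x + qreal y)%quat.
Proof. quat_ring. Qed.

Lemma qreal_comm x q : (qreal x * q = q * qreal x)%quat.
Proof. quat_ring. Qed.

Lemma qmul_conj_r q : (q * qconj q = qreal (sqnorm q))%quat.
Proof. quat_ring. Qed.

Lemma qmul_conj_l q : (qconj q * q = qreal (sqnorm q))%quat.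
Proof. quat_ring. Qed.

Lemma qsub_eq0 p q : (p - q = q0)%quat -> p = q.
Proof.
intros H. replace p with (p - q + q)%quat by non_commutative_ring.
rewrite H. non_commutative_ring.
Qed.

Lemma qsub_diag p : (p - p = q0)%quat.
Proof. non_commutative_ring. Qed.

Lemma sqnorm_mul p q : sqnorm (p * q) = sqnorm p * sqnorm q.
Proof. quat_ring. Qed.

Lemma sqnorm_conj q : sqnorm (qconj q) = sqnorm q.
Proof. quat_ring. Qed.

Lemma sqnorm_real x : sqnorm (qreal x) = x * x.
Proof. quat_ring. Qed.

Lemma sqnorm_pos q : 0 <= sqnorm q.
Proof.
unfold sqnorm; pose proof (Rle_0_sqr (re q)); pose proof (Rle_0_sqr (im_i q));
pose proof (Rle_0_sqr (im_j q)); pose proof (Rle_0_sqr (im_k q)).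
unfold Rsqr in *; lra.
Qed.

Lemma qmod_sqrt q : qmod q = sqrt (sqnorm q).
Proof. unfold qmod, sqnorm; f_equal; ring. Qed.

Lemma qmod_sqr q : qmod q * qmod q = sqnorm q.
Proof. rewrite qmod_sqrt; apply sqrt_sqrt, sqnorm_pos. Qed.

Lemma qmod_pow2 q : qmod q ^ 2 = sqnorm q.
Proof. rewrite <- qmod_sqr; ring. Qed.

Lemma qmod_pos q : 0 <= qmod q.
Proof. rewrite qmod_sqrt; apply sqrt_pos. Qed.

Lemma qmod_mul p q : qmod (p * q) = qmod p * qmod q.
Proof. now rewrite !qmod_sqrt, sqnorm_mul, sqrt_mult by apply sqnorm_pos. Qed.

Lemma qmod_conj q : qmod (qconj q) = qmod q.
Proof. now rewrite !qmod_sqrt, sqnorm_conj. Qed.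

Lemma qmod_real x : qmod (qreal x) = Rabs x.
Proof. rewrite qmod_sqrt, sqnorm_real. apply sqrt_Rsqr_abs. Qed.

Lemma qmod_0 : qmod q0 = 0.
Proof. unfold q0; rewrite qmod_real; apply Rabs_R0. Qed.

Lemma qmod_1 : qmod q1 = 1.
Proof. unfold q1; rewrite qmod_real; apply Rabs_R1. Qed.

Lemma qmod_opp q : qmod (qopp q) = qmod q.
Proof. rewrite !qmod_sqrt; f_equal; quat_ring. Qed.

Lemma qmod_triangle p q : qmod (p + q) <= qmod p + qmod q.
Proof. rewrite <- !quat_norm. apply (norm_triangle (p : (R * R) * (R * R)) q). Qed.

Lemma qmod_triangle_sub p q : qmod (p - q) <= qmod p + qmod q.
Proof. unfold qsub; eapply Rle_trans; [apply qmod_triangle | rewrite qmod_opp; lra]. Qed.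

Lemma sqnorm_eq0 q : sqnorm q = 0 -> q = q0.
Proof.
destruct q as [[a b] [c d]]; quat_unfold; intros H.
assert (a = 0 /\ b = 0 /\ c = 0 /\ d = 0) as (-> & -> & -> & ->) by (repeat split; nra).
reflexivity.
Qed.

Lemma qmod_eq0 q : qmod q = 0 -> q = q0.
Proof. intros H; apply sqnorm_eq0; rewrite <- qmod_sqr, H; ring. Qed.

Lemma sqnorm_gt0 q : q <> q0 -> 0 < sqnorm q.
Proof.
intros H; destruct (sqnorm_pos q) as [|E]; trivial.
now elim H; apply sqnorm_eq0.
Qed.

Lemma qmod_gt0 q : q <> q0 -> 0 < qmod q.
Proof.
intros H; destruct (qmod_pos q) as [|E]; trivial.
now elim H; apply qmod_eq0.
Qed.

Lemma qmod_pow q n : qmod (q ^ n) = qmod q ^ n.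
Proof.
induction n as [|n IH]; simpl; [apply qmod_1 | now rewrite qmod_mul, IH].
Qed.

Lemma qmul_inv_r q : q <> q0 -> (q * qinv q = q1)%quat.
Proof.
intros H; unfold qinv; rewrite qmod_pow2.
rewrite qmul_assoc, <- qreal_comm, <- qmul_assoc, qmul_conj_r, <- qreal_mul.
unfold q1; f_equal; field. now apply Rgt_not_eq, sqnorm_gt0.
Qed.

Lemma qmul_inv_l q : q <> q0 -> (qinv q * q = q1)%quat.
Proof.
intros H; unfold qinv; rewrite qmod_pow2.
rewrite <- qmul_assoc, qmul_conj_l, <- qreal_mul.
unfold q1; f_equal; field. now apply Rgt_not_eq, sqnorm_gt0.
Qed.

Lemma qmod_inv q : q <> q0 -> qmod (qinv q) = / qmod q.
Proof.
intros H. pose proof (qmod_gt0 q H).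
apply Rmult_eq_reg_l with (qmod q); [|lra].
rewrite <- qmod_mul, qmul_inv_r, qmod_1 by trivial. field; lra.
Qed.

Lemma qmul_cancel_l w p q : w <> q0 -> (w * p = w * q -> p = q)%quat.
Proof.
intros Hw H. rewrite <- (qmul_1_l p), <- (qmul_1_l q), <- (qmul_inv_l w Hw).
rewrite <- !qmul_assoc. now f_equal.
Qed.

Lemma qmul_cancel_r w p q : w <> q0 -> (p * w = q * w -> p = q)%quat.
Proof.
intros Hw H. rewrite <- (qmul_1_r p), <- (qmul_1_r q), <- (qmul_inv_r w Hw).
rewrite !qmul_assoc. now f_equal.
Qed.

Lemma qmul_integral p q : (p * q = q0)%quat -> p = q0 \/ q = q0.
Proof.
intros H; destruct (excluded_middle_informative (p = q0)) as [|Hp]; [now left|right].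
apply (qmul_cancel_l p); trivial. rewrite H; quat_ring.
Qed.

Lemma qpow_comm q n : (q * q ^ n = q ^ n * q)%quat.
Proof.
induction n as [|n IH]; simpl; [quat_ring|].
now rewrite <- qmul_assoc, <- IH.
Qed.

Lemma qpow_conj_by w q p n : (q * w = w * p -> q ^ n * w = w * p ^ n)%quat.
Proof.
intros H; induction n as [|n IH]; simpl; [now rewrite qmul_1_l, qmul_1_r|].
now rewrite <- qmul_assoc, IH, qmul_assoc, H, qmul_assoc.
Qed.

Lemma qpow_real x n : (qreal x ^ n)%quat = qreal (x ^ n).
Proof. induction n as [|n IH]; simpl; trivial. now rewrite IH, qreal_mul. Qed.

Lemma qmul_sub_l p q r : ((p - q) * r = p * r - q * r)%quat.
Proof. quat_ring. Qed.

Lemma qmul_sub_r p q r : (p * (q - r) = p * q - p * r)%quat.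
Proof. quat_ring. Qed.

Lemma qmul_opp_l p q : (qopp p * q = qopp (p * q))%quat.
Proof. quat_ring. Qed.

Lemma qmul_opp_r p q : (p * qopp q = qopp (p * q))%quat.
Proof. quat_ring. Qed.

(** Expansion into words leaves a linear identity between them, which is checked by components. *)
Ltac quat_expand :=
  repeat first [rewrite qmul_add_l | rewrite qmul_add_r | rewrite qmul_sub_l | rewrite qmul_sub_r
    | rewrite qmul_opp_l | rewrite qmul_opp_r];
  rewrite ?qmul_assoc;
  repeat match goal with |- context [qmul ?x ?y] => generalize (qmul x y); intro end;
  clear; quat_ring.

(** The sums taken in the normed module of quaternions are sums of quaternions. *)
Lemma plus_qadd (p q : quat) : plus p q = (p + q)%quat.
Proof. reflexivity. Qed.

(** * The ring of power series with quaternionic coefficients *)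

(** The variable commutes with the coefficients, so that the Cauchy product of the coefficient
    sequences makes a ring of them, and the star product of functions becomes this product. *)
Definition ser : Type := nat -> quat.

Definition sc (c : quat) : ser := fun n => match n with O => c | S _ => q0 end.
Definition sadd (a b : ser) : ser := fun n => (a n + b n)%quat.
Definition sopp (a : ser) : ser := fun n => qopp (a n).
Definition ssub (a b : ser) : ser := fun n => (a n - b n)%quat.
Definition smul (a b : ser) : ser := fun m => sum_n (fun l => (a (m - l)%nat * b l)%quat) m.
Definition sX : ser := fun n => match n with 1%nat => q1 | _ => q0 end.
(** The backward shift. *)
Definition stl (a : ser) : ser := fun n => a (S n).
Definition sconj (a : ser) : ser := fun n => qconj (a n).

Declare Scope ser_scope.
Delimit Scope ser_scope with ser.
Bind Scope ser_scope with ser.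
Infix "+" := sadd : ser_scope.
Infix "-" := ssub : ser_scope.
Infix "*" := smul : ser_scope.

Lemma smul_0 a b : (a * b)%ser O = (a O * b O)%quat.
Proof. unfold smul; now rewrite sum_O. Qed.

Lemma smul_S_l a b n : (a * b)%ser (S n) = ((stl a * b)%ser n + a O * b (S n))%quat.
Proof.
unfold smul; rewrite sum_Sn, plus_qadd, Nat.sub_diag; f_equal.
apply sum_n_ext_loc; intros l Hl; unfold stl.
now replace (S n - l)%nat with (S (n - l)) by lia.
Qed.

Lemma smul_S_r a b n : (a * b)%ser (S n) = (a (S n) * b O + (a * stl b)%ser n)%quat.
Proof.
unfold smul, sum_n; rewrite sum_Sn_m, <- sum_n_m_S by lia.
reflexivity.
Qed.

Lemma smul_add_l a b c : ((a + b) * c = a * c + b * c)%ser.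
Proof.
apply functional_extensionality; intros n; unfold smul, sadd.
rewrite <- plus_qadd, <- sum_n_plus. apply sum_n_ext; intros l. apply qmul_add_l.
Qed.

Lemma smul_add_r a b c : (a * (b + c) = a * b + a * c)%ser.
Proof.
apply functional_extensionality; intros n; unfold smul, sadd.
rewrite <- plus_qadd, <- sum_n_plus. apply sum_n_ext; intros l. apply qmul_add_r.
Qed.

Lemma smul_sc_l c a n : (sc c * a)%ser n = (c * a n)%quat.
Proof.
revert a; induction n as [|n IH]; intros a; [now rewrite smul_0|].
rewrite smul_S_r, IH; simpl sc. unfold stl. non_commutative_ring.
Qed.

Lemma smul_sc_r c a n : (a * sc c)%ser n = (a n * c)%quat.
Proof.
revert a; induction n as [|n IH]; intros a; [now rewrite smul_0|].
rewrite smul_S_l, IH; simpl sc. unfold stl. non_commutative_ring.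
Qed.

Lemma stl_mul_l a b : stl (a * b)%ser = (stl a * b + sc (a O) * stl b)%ser.
Proof.
apply functional_extensionality; intros n; unfold sadd.
now rewrite smul_sc_l, <- smul_S_l.
Qed.

Lemma smul_assoc a b c : (a * (b * c) = a * b * c)%ser.
Proof.
apply functional_extensionality; intros n. revert a b c.
induction n as [|n IH]; intros a b c; [rewrite !smul_0; non_commutative_ring|].
rewrite smul_S_l, (smul_S_l (a * b)%ser), stl_mul_l, smul_add_l; unfold sadd.
rewrite IH, <- (IH (sc (a O))), smul_sc_l, smul_S_l, smul_0.
non_commutative_ring.
Qed.

Lemma sc_1_l a : (sc q1 * a = a)%ser.
Proof. apply functional_extensionality; intros n; rewrite smul_sc_l; non_commutative_ring. Qed.

Lemma sc_1_r a : (a * sc q1 = a)%ser.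
Proof. apply functional_extensionality; intros n; rewrite smul_sc_r; non_commutative_ring. Qed.

Global Instance ser_ring_ops : @Ring_ops ser (sc q0) (sc q1) sadd smul ssub sopp eq := {}.

Lemma sc_q0 n : sc q0 n = q0.
Proof. now destruct n. Qed.

Global Instance ser_is_ring : @Ncring.Ring ser (sc q0) (sc q1) sadd smul ssub sopp eq ser_ring_ops.
Proof.
constructor; try exact eq_equivalence;
  try solve [intros ? ? -> ? ? ->; reflexivity | intros ? ? ->; reflexivity];
  unfold addition, multiplication, subtraction, opposite, equality, Algebra_syntax.zero, Algebra_syntax.one,
    add_notation, mul_notation, sub_notation, opp_notation, eq_notation,
    zero_notation, one_notation;
  auto using sc_1_l, sc_1_r, smul_assoc, smul_add_l, smul_add_r;
  intros; apply functional_extensionality; intros n;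
  unfold sadd, ssub, sopp; rewrite ?sc_q0; generalize (x n); try generalize (y n);
  try generalize (z n); non_commutative_ring.
Qed.

Lemma sX_mul_0 a : (sX * a)%ser O = q0.
Proof. rewrite smul_0; simpl; non_commutative_ring. Qed.

Lemma stl_sX : stl sX = sc q1.
Proof. apply functional_extensionality; intros [|n]; reflexivity. Qed.

Lemma sX_mul_S a n : (sX * a)%ser (S n) = a n.
Proof. rewrite smul_S_l, stl_sX, sc_1_l. simpl; non_commutative_ring. Qed.

Lemma sX_comm a : (sX * a = a * sX)%ser.
Proof.
apply functional_extensionality; intros [|n]; [rewrite !smul_0; simpl; non_commutative_ring|].
rewrite sX_mul_S, smul_S_r, stl_sX, sc_1_r. simpl; non_commutative_ring.
Qed.

Lemma sc_real_comm x a : (sc (qreal x) * a = a * sc (qreal x))%ser.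
Proof.
apply functional_extensionality; intros n; rewrite smul_sc_l, smul_sc_r; apply qreal_comm.
Qed.

Lemma sc_mul c d : sc (c * d)%quat = (sc c * sc d)%ser.
Proof.
apply functional_extensionality; intros n; rewrite smul_sc_l; destruct n; simpl; trivial.
now rewrite qmul_0_r.
Qed.

Lemma ser_head_tail a : a = (sc (a O) + sX * stl a)%ser.
Proof.
apply functional_extensionality; intros [|n]; unfold sadd.
- rewrite sX_mul_0; simpl; non_commutative_ring.
- rewrite sX_mul_S; simpl; unfold stl; non_commutative_ring.
Qed.

Lemma ser_sub_eq0 (a b : ser) : (a - b = sc q0)%ser -> a = b.
Proof.
intros H. replace a with (a - b + b)%ser by non_commutative_ring.
rewrite H. non_commutative_ring.
Qed.

Lemma sconj_mul a b : sconj (a * b)%ser = (sconj b * sconj a)%ser.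
Proof.
apply functional_extensionality; intros n; unfold sconj at 1. revert a b.
induction n as [|n IH]; intros a b; [rewrite !smul_0; unfold sconj; apply qconj_mul|].
rewrite smul_S_l, smul_S_r, qconj_add, qconj_mul, IH. unfold sconj.
apply qadd_comm.
Qed.

(** The product of the lowest nonzero coefficients does not vanish. *)
Lemma smul_integral a b : (a * b = sc q0)%ser -> a = sc q0 \/ b = sc q0.
Proof.
intros H.
destruct (excluded_middle_informative (a = sc q0)) as [|Ha]; [now left|right].
assert (HN : exists k, a k <> q0 /\ forall i, (i < k)%nat -> a i = q0).
{ destruct (excluded_middle_informative (exists k, a k <> q0)) as [[k Hk]|Hk].
  - revert Hk; induction k as [k IH] using (well_founded_induction lt_wf); intros Hk.
    destruct (excluded_middle_informative (exists i, (i < k)%nat /\ a i <> q0))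
      as [(i & Hi & Hai)|Hi]; [now apply (IH i)|].
    exists k; split; trivial; intros i Hik.
    apply NNPP; intros Hai; apply Hi; now exists i.
  - elim Ha; apply functional_extensionality; intros n; rewrite sc_q0.
    apply NNPP; intros Hn; apply Hk; now exists n. }
destruct HN as (k & Hk & Hlt); clear Ha.
assert (Hz : forall d : ser, (sc q0 * d = sc q0)%ser).
{ intros d; apply functional_extensionality; intros n; rewrite smul_sc_l, sc_q0.
  apply qmul_0_l. }
revert a H Hk Hlt; induction k as [|k IH]; intros a H Hk Hlt.
- apply functional_extensionality; intros n; rewrite sc_q0.
  induction n as [n IHn] using (well_founded_induction lt_wf).
  assert (Hn := f_equal (fun s => s n) H); simpl in Hn; rewrite sc_q0 in Hn.
  unfold smul in Hn; destruct n as [|n].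
  + rewrite sum_O in Hn; apply qmul_integral in Hn; tauto.
  + rewrite sum_Sn, Nat.sub_diag, plus_qadd in Hn.
    rewrite (sum_n_ext_loc _ (fun _ => q0)) in Hn.
    * assert (Hs : forall m, sum_n (fun _ => q0) m = q0).
      { induction m as [|m IHm]; [now rewrite sum_O|].
        now rewrite sum_Sn, IHm, plus_qadd, qadd_0_l. }
      rewrite Hs, qadd_0_l in Hn. apply qmul_integral in Hn; tauto.
    * intros l Hl; rewrite IHn by lia; apply qmul_0_r.
- apply (IH (stl a)); [|exact Hk|intros i Hi; apply Hlt; lia].
  rewrite (ser_head_tail a), (Hlt O) in H by lia.
  apply functional_extensionality; intros n.
  assert (Hn := f_equal (fun s => s (S n)) H); simpl in Hn.
  rewrite smul_add_l, <- smul_assoc in Hn; unfold sadd in Hn.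
  rewrite sX_mul_S, Hz in Hn. simpl in Hn. now rewrite qadd_0_l in Hn; rewrite sc_q0.
Qed.

(** * Convergence and evaluation of power series on the ball *)

Lemma is_series_quat (u : nat -> quat) (l : quat) :
  is_series u l <->
  is_series (fun n => re (u n)) (re l) /\ is_series (fun n => im_i (u n)) (im_i l) /\
  is_series (fun n => im_j (u n)) (im_j l) /\ is_series (fun n => im_k (u n)) (im_k l).
Proof.
assert (Hs : forall n, sum_n u n =
  mkq (sum_n (fun n => re (u n)) n) (sum_n (fun n => im_i (u n)) n)
      (sum_n (fun n => im_j (u n)) n) (sum_n (fun n => im_k (u n)) n)).
{ induction n as [|n IH].
  - rewrite !sum_O; now destruct (u O) as [[? ?] [? ?]].
  - rewrite !sum_Sn, IH; reflexivity. }
assert (Hb : forall (x y : quat) e, ball (x : (R * R) * (R * R)) e y <->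
  ball (re x) e (re y) /\ ball (im_i x) e (im_i y) /\
  ball (im_j x) e (im_j y) /\ ball (im_k x) e (im_k y)).
{ intros [[? ?] [? ?]] [[? ?] [? ?]] e; unfold ball; simpl; unfold prod_ball; simpl.
  unfold ball; simpl; unfold prod_ball; simpl. tauto. }
unfold is_series; split.
- intros H; pose proof (proj1 (filterlim_locally _ _) H) as H'; clear H.
  repeat split; apply filterlim_locally; intros e; specialize (H' e);
  revert H'; apply filter_imp; intros n Hn; apply Hb in Hn; rewrite Hs in Hn;
  unfold re, im_i, im_j, im_k in *; simpl in Hn; tauto.
- intros (H1 & H2 & H3 & H4).
  apply (proj2 (filterlim_locally (U:=prod_UniformSpace (prod_UniformSpace R_UniformSpace R_UniformSpace) (prod_UniformSpace R_UniformSpace R_UniformSpace)) _ _)).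
  intros e.
  pose proof (proj1 (filterlim_locally _ _) H1 e) as K1.
  pose proof (proj1 (filterlim_locally _ _) H2 e) as K2.
  pose proof (proj1 (filterlim_locally _ _) H3 e) as K3.
  pose proof (proj1 (filterlim_locally _ _) H4 e) as K4.
  pose proof (filter_and _ _ (filter_and _ _ K1 K2) (filter_and _ _ K3 K4)) as K.
  revert K; apply filter_imp; intros n Hn. apply Hb. rewrite Hs. tauto.
Qed.

Lemma is_series_quat_unique (u : nat -> quat) (l : quat) : is_series u l -> qseries u = l.
Proof.
intros H; apply is_series_quat in H; destruct H as (H1 & H2 & H3 & H4).
unfold qseries; rewrite (is_series_unique _ _ H1), (is_series_unique _ _ H2),
  (is_series_unique _ _ H3), (is_series_unique _ _ H4).
now destruct l as [[? ?] [? ?]].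
Qed.

Lemma component_le (q : quat) :
  Rabs (re q) <= qmod q /\ Rabs (im_i q) <= qmod q /\
  Rabs (im_j q) <= qmod q /\ Rabs (im_k q) <= qmod q.
Proof.
assert (H : forall x, x * x <= sqnorm q -> Rabs x <= qmod q).
{ intros x Hx; apply Rsqr_incr_0; [|apply Rabs_pos|apply qmod_pos].
  unfold Rsqr; rewrite qmod_sqr; unfold Rabs; destruct Rcase_abs; lra. }
destruct q as [[a b] [c d]].
repeat split; apply H; unfold sqnorm, re, im_i, im_j, im_k; simpl; nra.
Qed.

Lemma qmod_le_components (q : quat) :
  qmod q <= Rabs (re q) + Rabs (im_i q) + Rabs (im_j q) + Rabs (im_k q).
Proof.
rewrite qmod_sqrt.
pose proof (Rabs_pos (re q)); pose proof (Rabs_pos (im_i q));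
pose proof (Rabs_pos (im_j q)); pose proof (Rabs_pos (im_k q)).
rewrite <- (sqrt_Rsqr (Rabs (re q) + Rabs (im_i q) + Rabs (im_j q) + Rabs (im_k q))) by lra.
apply sqrt_le_1_alt. unfold sqnorm.
assert (E : forall x, x * x = Rabs x * Rabs x) by (intros x; unfold Rabs; destruct Rcase_abs; ring).
rewrite (E (re q)), (E (im_i q)), (E (im_j q)), (E (im_k q)). unfold Rsqr. nra.
Qed.

Lemma is_series_abs (u : nat -> quat) :
  ex_series (fun n => qmod (u n)) -> is_series u (qseries u).
Proof.
intros H; apply is_series_quat; unfold qseries, re, im_i, im_j, im_k; simpl.
repeat split; apply Series_correct;
  apply (ex_series_le (V:=R_CompleteNormedModule)) with (2 := H);
  intros n; apply component_le.
Qed.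

Lemma qmod_series_le (u : nat -> quat) (l : quat) (v : nat -> R) (m : R) :
  is_series u l -> is_series v m -> (forall n, qmod (u n) <= v n) -> qmod l <= m.
Proof.
intros Hu Hv Huv.
assert (Hn : is_lim_seq (fun n => qmod (sum_n u n)) (qmod l)).
{ rewrite <- quat_norm.
  apply (filterlim_ext (fun n => norm (sum_n u n : (R * R) * (R * R)))).
  { intros n; apply quat_norm. }
  apply (filterlim_comp _ _ _ (sum_n u) _ _ _ _ Hu).
  apply (filterlim_norm (V := prod_NormedModule R_AbsRing
           (prod_NormedModule R_AbsRing R_NormedModule R_NormedModule)
           (prod_NormedModule R_AbsRing R_NormedModule R_NormedModule))). }
apply (is_lim_seq_le _ _ (qmod l) m) with (2 := Hn) (3 := Hv).
induction n as [|n IH]; [rewrite !sum_O; apply Huv|].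
rewrite !sum_Sn, plus_qadd. eapply Rle_trans; [apply qmod_triangle|].
apply Rplus_le_compat; [apply IH | apply Huv].
Qed.

Lemma qmod_sum_le (u : nat -> quat) n : qmod (sum_n u n) <= sum_n (fun k => qmod (u k)) n.
Proof.
induction n as [|n IH]; [rewrite !sum_O; lra|].
rewrite !sum_Sn, plus_qadd; eapply Rle_trans; [apply qmod_triangle|].
now apply Rplus_le_compat_r.
Qed.

(** By Abel's lemma these are exactly the series that converge on the whole ball. *)
Definition ball_series (a : ser) : Prop :=
  forall rho, 0 < rho < 1 -> exists C, forall n, qmod (a n) * rho ^ n <= C.

Lemma growth_nonneg (a : ser) rho C :
  0 < rho -> (forall n, qmod (a n) * rho ^ n <= C) -> 0 <= C.
Proof.
intros Hr H; apply Rle_trans with (2 := H O); simpl; pose proof (qmod_pos (a O)); lra.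
Qed.

Lemma growth_term (a : ser) rho C q n : 0 < rho ->
  (forall n, qmod (a n) * rho ^ n <= C) -> qmod (q ^ n * a n) <= C * (qmod q / rho) ^ n.
Proof.
intros Hr H. rewrite qmod_mul, qmod_pow.
replace (C * (qmod q / rho) ^ n) with (qmod q ^ n * (C * / rho ^ n)).
2:{ unfold Rdiv; rewrite Rpow_mult_distr, pow_inv; ring. }
apply Rmult_le_compat_l; [apply pow_le, qmod_pos|].
pose proof (pow_lt _ n Hr).
apply Rmult_le_reg_r with (rho ^ n); trivial.
rewrite Rmult_assoc, Rinv_l by lra. rewrite Rmult_1_r; apply H.
Qed.

Lemma ratio_bound x rho : 0 <= x -> 0 < rho -> x < rho -> 0 <= x / rho < 1.
Proof.
intros Hx Hr Hl; split; [now apply Rdiv_le_0_compat|].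
apply Rmult_lt_reg_r with rho; trivial. unfold Rdiv; rewrite Rmult_assoc, Rinv_l; lra.
Qed.

(** Comparison with a geometric series.  Remainders are estimated with the bound on the sum. *)
Lemma power_series_bound_aux (a : ser) rho C q : 0 < rho -> qmod q < rho ->
  (forall n, qmod (a n) * rho ^ n <= C) ->
  is_series (fun m => (q ^ m * a m)%quat) (power_series a q) /\
  qmod (power_series a q) <= C * / (1 - qmod q / rho).
Proof.
intros Hr Hq H.
destruct (ratio_bound _ _ (qmod_pos q) Hr Hq) as [H0 H1].
assert (Hg : is_series (fun n => C * (qmod q / rho) ^ n) (C * / (1 - qmod q / rho))).
{ apply (is_series_scal_l (K:=R_AbsRing) (V:=R_NormedModule)), is_series_geom. rewrite Rabs_pos_eq; lra. }
assert (Hs : is_series (fun m => (q ^ m * a m)%quat) (power_series a q)).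
{ apply is_series_abs.
  apply (ex_series_le (V:=R_CompleteNormedModule) _ (fun n => C * (qmod q / rho) ^ n)).
  - intros n; unfold norm; simpl; unfold abs; simpl.
    rewrite Rabs_pos_eq by apply qmod_pos. now apply growth_term.
  - eexists; exact Hg. }
split; trivial.
apply (qmod_series_le _ _ _ _ Hs Hg). intros n; now apply growth_term.
Qed.

Lemma radius_between q : ball1 q -> exists rho, 0 < rho < 1 /\ qmod q < rho.
Proof.
unfold ball1; intros H; exists ((1 + qmod q) / 2); pose proof (qmod_pos q); lra.
Qed.

Lemma is_series_power_series (a : ser) q : ball_series a -> ball1 q ->
  is_series (fun m => (q ^ m * a m)%quat) (power_series a q).
Proof.
intros Ha Hq; destruct (radius_between q Hq) as (rho & Hr & Hqr).
destruct (Ha rho Hr) as [C HC].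
now apply (power_series_bound_aux a rho C).
Qed.

Lemma has_expansion_power_series (a : ser) : ball_series a -> has_expansion (power_series a) a.
Proof. intros Ha q Hq; now apply is_series_power_series. Qed.

Lemma has_expansion_eq f (a : ser) q : has_expansion f a -> ball1 q -> f q = power_series a q.
Proof. intros H Hq; symmetry; now apply is_series_quat_unique, H. Qed.

Lemma ball1_real x : ball1 (qreal x) <-> Rabs x < 1.
Proof. unfold ball1; now rewrite qmod_real. Qed.

(** Convergence at the real point [rho] bounds the terms there. *)
Lemma has_expansion_ball_series f (a : ser) : has_expansion f a -> ball_series a.
Proof.
intros H rho Hr.
assert (Hb : ball1 (qreal rho)) by (apply ball1_real; rewrite Rabs_pos_eq; lra).
apply H, is_series_quat in Hb; destruct Hb as (H1 & H2 & H3 & H4).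
assert (B : forall u l, is_series u l -> exists M, forall n : nat, Rabs (u n) <= M).
{ intros u l Hu.
  assert (L : is_lim_seq u 0) by (apply ex_series_lim_0; now exists l).
  destruct (filterlim_bounded (V:=R_NormedModule) u) as [M HM]; [now exists 0|].
  exists M; exact HM. }
destruct (B _ _ H1) as [M1 K1], (B _ _ H2) as [M2 K2], (B _ _ H3) as [M3 K3],
  (B _ _ H4) as [M4 K4].
exists (M1 + M2 + M3 + M4); intros n.
replace (qmod (a n) * rho ^ n) with (qmod (qreal rho ^ n * a n)).
2:{ rewrite qmod_mul, qmod_pow, qmod_real, Rabs_pos_eq by lra; ring. }
eapply Rle_trans; [apply qmod_le_components|].
specialize (K1 n); specialize (K2 n); specialize (K3 n); specialize (K4 n); lra.
Qed.

Lemma ball_series_of_le (a b : ser) :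
  ball_series a -> (forall n, qmod (b n) <= qmod (a n)) -> ball_series b.
Proof.
intros Ha H rho Hr; destruct (Ha rho Hr) as [C HC]; exists C; intros n.
eapply Rle_trans; [|apply (HC n)]. apply Rmult_le_compat_r; [apply pow_le; lra | apply H].
Qed.

Lemma ball_series_bounded (a : ser) C : (forall n, qmod (a n) <= C) -> ball_series a.
Proof.
intros H rho Hr; exists C; intros n.
assert (rho ^ n <= 1) by (rewrite <- (pow1 n); apply pow_incr; lra).
assert (0 < rho ^ n) by (apply pow_lt; lra).
pose proof (H n); pose proof (qmod_pos (a n)); nra.
Qed.

Lemma ball_series_sc c : ball_series (sc c).
Proof.
apply ball_series_bounded with (qmod c); intros [|n]; simpl; [lra|].
rewrite qmod_0; apply qmod_pos.
Qed.

Lemma ball_series_sX : ball_series sX.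
Proof.
apply ball_series_bounded with 1; intros [|[|n]]; simpl; rewrite ?qmod_0, ?qmod_1; lra.
Qed.

Lemma ball_series_sconj a : ball_series a -> ball_series (sconj a).
Proof.
intros Ha; apply (ball_series_of_le a); trivial; intros n; unfold sconj.
rewrite qmod_conj; lra.
Qed.

Lemma ball_series_add a b : ball_series a -> ball_series b -> ball_series (a + b)%ser.
Proof.
intros Ha Hb rho Hr; destruct (Ha rho Hr) as [A HA], (Hb rho Hr) as [B HB].
exists (A + B); intros n. unfold sadd.
specialize (HA n); specialize (HB n).
assert (0 < rho ^ n) by (apply pow_lt; lra).
pose proof (qmod_triangle (a n) (b n)). nra.
Qed.

Lemma ball_series_sub a b : ball_series a -> ball_series b -> ball_series (a - b)%ser.
Proof.
intros Ha Hb rho Hr; destruct (Ha rho Hr) as [A HA], (Hb rho Hr) as [B HB].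
exists (A + B); intros n. unfold ssub.
specialize (HA n); specialize (HB n).
assert (0 < rho ^ n) by (apply pow_lt; lra).
pose proof (qmod_triangle_sub (a n) (b n)). nra.
Qed.

Lemma ball_series_stl a : ball_series a -> ball_series (stl a).
Proof.
intros Ha rho Hr; destruct (Ha rho Hr) as [A HA]; exists (A / rho); intros n.
specialize (HA (S n)); simpl in HA; unfold stl.
apply Rmult_le_reg_l with rho; [lra|].
replace (rho * (A / rho)) with A by (field; lra). lra.
Qed.

Lemma geom_sum_le x n : 0 <= x < 1 -> sum_n (fun k => x ^ k) n <= / (1 - x).
Proof.
intros Hx.
assert (E : sum_n (fun k => x ^ k) n * (1 - x) = 1 - x ^ (S n)).
{ induction n as [|n IH]; [rewrite sum_O; simpl; ring|].
  rewrite sum_Sn. unfold plus; simpl in *.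
  rewrite Rmult_plus_distr_r, IH; ring. }
apply Rmult_le_reg_r with (1 - x); [lra|]. rewrite E, Rinv_l by lra.
pose proof (pow_le x (S n)); lra.
Qed.

Lemma sum_n_le_loc (u v : nat -> R) n :
  (forall k, (k <= n)%nat -> u k <= v k) -> sum_n u n <= sum_n v n.
Proof.
induction n as [|n IH]; intros H; [rewrite !sum_O; now apply H|].
rewrite !sum_Sn; unfold plus; simpl; apply Rplus_le_compat; [apply IH; intros; apply H; lia|].
now apply H.
Qed.

Lemma sum_n_scal_R c (u : nat -> R) n : sum_n (fun k => c * u k) n = c * sum_n u n.
Proof. apply (sum_n_mult_l (K:=R_Ring)). Qed.

Lemma ball_series_sum_bound a rho : ball_series a -> 0 < rho < 1 ->
  exists A, 0 <= A /\ forall n, sum_n (fun k => qmod (a k) * rho ^ k) n <= A.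
Proof.
intros Ha Hr. set (r' := (1 + rho) / 2). assert (Hr' : 0 < r' < 1) by (unfold r'; lra).
destruct (Ha r' Hr') as [C HC].
assert (0 <= C) by (apply (growth_nonneg a r'); trivial; lra).
assert (Hx : 0 <= rho / r' < 1) by (apply ratio_bound; unfold r'; lra).
exists (C * / (1 - rho / r')); split.
{ apply Rmult_le_pos; trivial. apply Rlt_le, Rinv_0_lt_compat; lra. }
intros n. apply Rle_trans with (sum_n (fun k => C * (rho / r') ^ k) n).
- apply sum_n_le_loc; intros k _.
  pose proof (growth_term a r' C (qreal rho) k (proj1 Hr') HC) as G.
  rewrite qmod_mul, qmod_pow, qmod_real, Rabs_pos_eq in G by lra. lra.
- rewrite sum_n_scal_R. apply Rmult_le_compat_l; trivial. now apply geom_sum_le.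
Qed.

Lemma sum_n_head (u : nat -> R) n : sum_n u (S n) = u O + sum_n (fun k => u (S k)) n.
Proof. unfold sum_n; rewrite sum_Sn_m, <- sum_n_m_S by lia; reflexivity. Qed.

(** The weighted supremum norm of a product, by induction on the index: split off the constant
    term of the left factor. *)
Lemma growth_mul a b rho A C : 0 < rho ->
  (forall n, sum_n (fun k => qmod (a k) * rho ^ k) n <= A) ->
  (forall n, qmod (b n) * rho ^ n <= C) ->
  forall n, qmod ((a * b)%ser n) * rho ^ n <= A * C.
Proof.
intros Hr HA HC n.
assert (C0 : 0 <= C) by now apply (growth_nonneg b rho).
apply Rle_trans with (C * sum_n (fun k => qmod (a k) * rho ^ k) n).
2:{ rewrite (Rmult_comm C); now apply Rmult_le_compat_r. }
clear HA; revert a; induction n as [|n IH]; intros a.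
- rewrite sum_O, smul_0, qmod_mul. specialize (HC O); simpl in *.
  pose proof (qmod_pos (a O)); nra.
- rewrite smul_S_l, sum_n_head; simpl (_ ^ O).
  rewrite (sum_n_ext _ (fun k => rho * (qmod (stl a k) * rho ^ k)))
    by (intros k; unfold stl; simpl; ring).
  rewrite sum_n_scal_R.
  specialize (IH (stl a)); specialize (HC (S n)); simpl in *.
  assert (0 < rho ^ n) by now apply pow_lt.
  pose proof (qmod_triangle ((stl a * b)%ser n) (a O * b (S n))%quat) as T.
  rewrite qmod_mul in T. pose proof (qmod_pos (a O)).
  apply Rle_trans with ((qmod ((stl a * b)%ser n) + qmod (a O) * qmod (b (S n))) * (rho * rho ^ n)).
  { apply Rmult_le_compat_r; trivial. apply Rmult_le_pos; lra. }
  assert (rho * (qmod ((stl a * b)%ser n) * rho ^ n)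
    <= rho * (C * sum_n (fun k : nat => qmod (stl a k) * rho ^ k) n))
    by (apply Rmult_le_compat_l; lra).
  assert (qmod (a O) * (qmod (b (S n)) * (rho * rho ^ n)) <= qmod (a O) * C)
    by now apply Rmult_le_compat_l.
  lra.
Qed.

Lemma ball_series_mul a b : ball_series a -> ball_series b -> ball_series (a * b)%ser.
Proof.
intros Ha Hb rho Hr.
destruct (ball_series_sum_bound a rho Ha Hr) as (A & HA0 & HA), (Hb rho Hr) as [B HB].
exists (A * B); apply growth_mul; trivial; lra.
Qed.

Lemma power_series_add a b q : ball_series a -> ball_series b -> ball1 q ->
  power_series (a + b)%ser q = (power_series a q + power_series b q)%quat.
Proof.
intros Ha Hb Hq; apply is_series_quat_unique.
eapply is_series_ext;
  [|exact (is_series_plus (V := prod_NormedModule R_AbsRing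
           (prod_NormedModule R_AbsRing R_NormedModule R_NormedModule)
           (prod_NormedModule R_AbsRing R_NormedModule R_NormedModule)) _ _ _ _
      (is_series_power_series a q Ha Hq) (is_series_power_series b q Hb Hq))].
intros n; exact (eq_sym (qmul_add_r _ _ _)).
Qed.

Lemma is_series_components_combination (u : nat -> quat) l x y z t (w : nat -> R) m :
  is_series u l ->
  (forall n, w n = x * re (u n) + y * im_i (u n) + z * im_j (u n) + t * im_k (u n)) ->
  m = x * re l + y * im_i l + z * im_j l + t * im_k l -> is_series w m.
Proof.
intros H Hw ->; apply is_series_quat in H; destruct H as (H1 & H2 & H3 & H4).
eapply is_series_ext; [intros n; symmetry; apply Hw|].
apply (is_series_plus (V:=R_NormedModule)); [apply (is_series_plus (V:=R_NormedModule));
  [apply (is_series_plus (V:=R_NormedModule))|]|];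
now apply (is_series_scal_l (K:=R_AbsRing) (V:=R_NormedModule)).
Qed.

Lemma is_series_qmul_l (u : nat -> quat) l p :
  is_series u l -> is_series (fun n => (p * u n)%quat) (p * l)%quat.
Proof.
intros H; destruct p as [[p1 p2] [p3 p4]].
apply is_series_quat; repeat split.
- apply (is_series_components_combination u l p1 (-p2) (-p3) (-p4) _ _ H);
    intros; quat_unfold; ring.
- apply (is_series_components_combination u l p2 p1 (-p4) p3 _ _ H);
    intros; quat_unfold; ring.
- apply (is_series_components_combination u l p3 p4 p1 (-p2) _ _ H);
    intros; quat_unfold; ring.
- apply (is_series_components_combination u l p4 (-p3) p2 p1 _ _ H);
    intros; quat_unfold; ring.
Qed.

Lemma is_series_qmul_r (u : nat -> quat) l p :
  is_series u l -> is_series (fun n => (u n * p)%quat) (l * p)%quat.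
Proof.
intros H; destruct p as [[p1 p2] [p3 p4]].
apply is_series_quat; repeat split.
- apply (is_series_components_combination u l p1 (-p2) (-p3) (-p4) _ _ H);
    intros; quat_unfold; ring.
- apply (is_series_components_combination u l p2 p1 p4 (-p3) _ _ H);
    intros; quat_unfold; ring.
- apply (is_series_components_combination u l p3 (-p4) p1 p2 _ _ H);
    intros; quat_unfold; ring.
- apply (is_series_components_combination u l p4 p3 (-p2) p1 _ _ H);
    intros; quat_unfold; ring.
Qed.

Lemma power_series_mul_sc a c q : ball_series a -> ball1 q ->
  power_series (a * sc c)%ser q = (power_series a q * c)%quat.
Proof.
intros Ha Hq; apply is_series_quat_unique.
eapply is_series_ext; [|exact (is_series_qmul_r _ _ c (is_series_power_series a q Ha Hq))].
intros n; simpl. rewrite smul_sc_r. now rewrite qmul_assoc.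
Qed.

Lemma power_series_sub a b q : ball_series a -> ball_series b -> ball1 q ->
  power_series (a - b)%ser q = (power_series a q - power_series b q)%quat.
Proof.
intros Ha Hb Hq.
replace (a - b)%ser with (a + b * sc (qopp q1))%ser.
2:{ apply functional_extensionality; intros n; unfold sadd, ssub; rewrite smul_sc_r.
    non_commutative_ring. }
rewrite power_series_add, power_series_mul_sc; trivial.
- non_commutative_ring.
- apply ball_series_mul; trivial; apply ball_series_sc.
Qed.

Lemma power_series_head a q : ball_series a -> ball1 q ->
  power_series a q = (a O + q * power_series (stl a) q)%quat.
Proof.
intros Ha Hq; apply is_series_quat_unique.
apply (is_series_decr_1 (V := prod_NormedModule R_AbsRing
           (prod_NormedModule R_AbsRing R_NormedModule R_NormedModule)
           (prod_NormedModule R_AbsRing R_NormedModule R_NormedModule))).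
match goal with |- is_series _ ?v => replace v with (q * power_series (stl a) q)%quat end.
- eapply is_series_ext; [|exact (is_series_qmul_l _ _ q
    (is_series_power_series (stl a) q (ball_series_stl a Ha) Hq))].
  intros n; simpl; unfold stl; now rewrite qmul_assoc.
- change (q * power_series (stl a) q = a 0%nat + q * power_series (stl a) q - q1 * a O)%quat.
  non_commutative_ring.
Qed.

Lemma power_series_sc c q : ball1 q -> power_series (sc c) q = c.
Proof.
intros Hq.
assert (Z : power_series (sc q0) q = q0).
{ replace (sc q0) with (sc q0 * sc q0)%ser by (rewrite <- sc_mul; f_equal; apply qmul_0_l).
  rewrite power_series_mul_sc; trivial using ball_series_sc. apply qmul_0_r. }
rewrite power_series_head by trivial using ball_series_sc.
change (stl (sc c)) with (fun n : nat => q0).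
replace (fun _ : nat => q0) with (sc q0) by (apply functional_extensionality, sc_q0).
rewrite Z; simpl; non_commutative_ring.
Qed.

Lemma small_geometric (e K x : R) : 0 <= x < 1 -> (forall n, e <= K * x ^ n) -> e <= 0.
Proof.
intros Hx H.
assert (L : is_lim_seq (fun n => K * x ^ n) (K * 0)).
{ apply (is_lim_seq_scal_l _ K 0), is_lim_seq_geom. rewrite Rabs_pos_eq; lra. }
rewrite Rmult_0_r in L.
exact (is_lim_seq_le (fun _ => e) _ e 0 H (is_lim_seq_const e) L).
Qed.

(** Moving [q] past the value [a(q)] turns it into [p].  The difference of both sides is [q] times
    the same difference for the tail of [b], so that it decreases geometrically. *)
Lemma power_series_mul a b q p : ball_series a -> ball_series b -> ball1 q -> ball1 p ->
  (q * power_series a q = power_series a q * p)%quat ->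
  power_series (a * b)%ser q = (power_series a q * power_series b p)%quat.
Proof.
intros Ha Hb Hq Hp Hw; set (w := power_series a q) in *.
assert (Hrec : forall d, ball_series d ->
  (power_series (a * d)%ser q - w * power_series d p =
   q * (power_series (a * stl d)%ser q - w * power_series (stl d) p))%quat).
{ intros d Hd.
  replace (power_series (a * d)%ser q)
    with (w * d O + q * power_series (a * stl d)%ser q)%quat.
  - rewrite (power_series_head d p) by trivial.
    replace (w * (d O + p * power_series (stl d) p))%quat
      with (w * d O + (w * p) * power_series (stl d) p)%quat by non_commutative_ring.
    rewrite <- Hw; non_commutative_ring.
  - assert (Hd' := ball_series_stl d Hd).
    assert (E : (a * d = a * sc (d O) + sX * (a * stl d))%ser).
    { rewrite (ser_head_tail d) at 1. rewrite smul_add_r, !smul_assoc, sX_comm. reflexivity. }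
    rewrite E, power_series_add, power_series_mul_sc; trivial;
      repeat apply ball_series_mul; trivial using ball_series_sc, ball_series_sX.
    fold w. f_equal.
    rewrite (power_series_head (sX * _)%ser), sX_mul_0; trivial;
      repeat apply ball_series_mul; trivial using ball_series_sX.
    rewrite qadd_0_l. f_equal. f_equal.
    apply functional_extensionality; intros n; exact (eq_sym (sX_mul_S _ _)). }
destruct (radius_between q Hq) as (r1 & Hr1 & Hq1), (radius_between p Hp) as (r2 & Hr2 & Hp2).
set (rho := Rmax r1 r2).
assert (Hr : 0 < rho < 1) by (unfold rho; split; [apply Rlt_le_trans with r1; [lra|apply Rmax_l]
  | apply Rmax_lub_lt; lra]).
assert (Hq' : qmod q < rho) by (apply Rlt_le_trans with (1 := Hq1), Rmax_l).
assert (Hp' : qmod p < rho) by (apply Rlt_le_trans with (1 := Hp2), Rmax_r).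
destruct (ball_series_sum_bound a rho Ha Hr) as (A & HA0 & HA), (Hb rho Hr) as [C HC].
set (K := A * C * / (1 - qmod q / rho) + qmod w * (C * / (1 - qmod p / rho))).
assert (Hgeom : forall n d, ball_series d ->
   (forall k, qmod (d k) * rho ^ k <= C * / rho ^ n) ->
   qmod (power_series (a * d)%ser q - w * power_series d p) <= K * / rho ^ n).
{ intros n d Hd Hdn.
  eapply Rle_trans; [apply qmod_triangle_sub|]. rewrite qmod_mul. unfold K.
  destruct (power_series_bound_aux d rho _ p (proj1 Hr) Hp' Hdn) as [_ B1].
  destruct (power_series_bound_aux (a * d)%ser rho _ q (proj1 Hr) Hq'
    (growth_mul a d rho A _ (proj1 Hr) HA Hdn)) as [_ B2].
  assert (B3 := Rmult_le_compat_l _ _ _ (qmod_pos w) B1). lra. }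
assert (Hit : forall n d, ball_series d ->
   (forall m, (forall k, qmod (d k) * rho ^ k <= C * / rho ^ m) ->
   qmod (power_series (a * d)%ser q - w * power_series d p)
     <= K * / rho ^ m * (qmod q / rho) ^ n)).
{ induction n as [|n IH]; intros d Hd m Hm; simpl.
  - rewrite Rmult_1_r; now apply Hgeom.
  - rewrite Hrec, qmod_mul by trivial.
    eapply Rle_trans; [apply Rmult_le_compat_l; [apply qmod_pos|]|].
    + apply (IH (stl d) (ball_series_stl d Hd) (S m)).
      intros k; specialize (Hm (S k)); unfold stl; simpl in *.
      pose proof (pow_lt rho m (proj1 Hr)).
      apply Rmult_le_reg_l with rho; [lra|].
      replace (rho * (C * / (rho * rho ^ m))) with (C * / rho ^ m) by (field; lra). lra.
    + simpl. apply Req_le. field. pose proof (pow_lt rho m (proj1 Hr)); lra. }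
apply qsub_eq0, qmod_eq0, Rle_antisym; [|apply qmod_pos].
apply (small_geometric _ K (qmod q / rho)).
- apply ratio_bound; trivial; [apply qmod_pos | lra].
- intros n. specialize (Hit n b Hb O); simpl in Hit.
  rewrite Rinv_1, !Rmult_1_r in Hit. apply Hit; apply HC.
Qed.

Lemma power_series_mul_root a b q : ball_series a -> ball_series b -> ball1 q ->
  power_series a q = q0 -> power_series (a * b)%ser q = q0.
Proof.
intros Ha Hb Hq H. rewrite (power_series_mul a b q q); trivial; rewrite H.
- apply qmul_0_l.
- now rewrite qmul_0_l, qmul_0_r.
Qed.

Lemma conjugate_point w q : w <> q0 -> exists p, (q * w = w * p)%quat /\ qmod p = qmod q.
Proof.
intros Hw; exists (qinv w * q * w)%quat; split.
- rewrite !qmul_assoc, qmul_inv_r, qmul_1_l; trivial.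
- rewrite !qmod_mul, qmod_inv by trivial. field. now apply Rgt_not_eq, qmod_gt0.
Qed.

(** Where [a(q)] vanishes, both values are zero and [p = q] will do. *)
Lemma power_series_mul_conjugate a b q : ball_series a -> ball_series b -> ball1 q ->
  exists p, qmod p = qmod q /\ (q * power_series a q = power_series a q * p)%quat /\
  power_series (a * b)%ser q = (power_series a q * power_series b p)%quat.
Proof.
intros Ha Hb Hq.
destruct (excluded_middle_informative (power_series a q = q0)) as [H|H].
- exists q; repeat split; [rewrite H; now rewrite qmul_0_l, qmul_0_r|].
  rewrite H, qmul_0_l; now apply power_series_mul_root.
- destruct (conjugate_point _ q H) as (p & Hp & Hpq); exists p; repeat split; trivial.
  apply power_series_mul; trivial. unfold ball1; now rewrite Hpq.
Qed.

(** * Expansions of the operations on slice regular functions *)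

(** A bound linear in [x] near the origin kills the constant term; then divide by the variable. *)
Lemma power_series_real_zero d : ball_series d ->
  (forall x, 0 < x < / 4 -> power_series d (qreal x) = q0) -> d = sc q0.
Proof.
assert (Hball : forall x, 0 < x < / 4 -> ball1 (qreal x)).
{ intros x Hx; apply ball1_real; rewrite Rabs_pos_eq; lra. }
assert (H0 : forall d, ball_series d ->
  (forall x, 0 < x < / 4 -> power_series d (qreal x) = q0) -> d O = q0).
{ clear d; intros d Hd H.
  destruct (ball_series_stl d Hd (/ 2)) as [C HC]; [lra|].
  assert (0 <= C) by (apply (growth_nonneg (stl d) (/ 2)); trivial; lra).
  assert (B : forall x, 0 < x < / 4 -> qmod (d O) <= x * (C * 2)).
  { intros x Hx. specialize (H x Hx).
    rewrite power_series_head in H by auto.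
    replace (d O) with (qopp (qreal x * power_series (stl d) (qreal x))).
    2:{ replace (d O) with (d O + qreal x * power_series (stl d) (qreal x)
           - qreal x * power_series (stl d) (qreal x))%quat by non_commutative_ring.
        rewrite H; non_commutative_ring. }
    rewrite qmod_opp, qmod_mul, qmod_real, Rabs_pos_eq by lra.
    apply Rmult_le_compat_l; [lra|].
    assert (Hx2 : qmod (qreal x) < / 2) by (rewrite qmod_real, Rabs_pos_eq; lra).
    destruct (power_series_bound_aux (stl d) (/ 2) C (qreal x)) as [_ Hb]; trivial; [lra|].
    eapply Rle_trans; [exact Hb|]. apply Rmult_le_compat_l; trivial.
    rewrite qmod_real, Rabs_pos_eq by lra.
    replace 2 with (/ (1 - / 4 / / 2)) by field. apply Rinv_le_contravar; lra. }
  apply qmod_eq0, Rle_antisym; [|apply qmod_pos].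
  apply Rnot_lt_le; intros Hp.
  pose proof (B (/ 8) ltac:(lra)) as B8.
  assert (0 < C * 2) by lra.
  set (x := Rmin (/ 8) (qmod (d O) / (2 * (C * 2)))).
  assert (Hx1 : x <= / 8) by apply Rmin_l.
  assert (Hx2 : x <= qmod (d O) / (2 * (C * 2))) by apply Rmin_r.
  assert (0 < qmod (d O) / (2 * (C * 2))) by (apply Rdiv_lt_0_compat; lra).
  assert (0 < x) by (unfold x; apply Rmin_glb_lt; lra).
  specialize (B x ltac:(lra)).
  assert (x * (C * 2) <= qmod (d O) / (2 * (C * 2)) * (C * 2)) by (apply Rmult_le_compat_r; lra).
  replace (qmod (d O) / (2 * (C * 2)) * (C * 2)) with (qmod (d O) / 2) in * by (field; lra).
  lra. }
intros Hd H. apply functional_extensionality; intros n; rewrite sc_q0.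
revert d Hd H; induction n as [|n IH]; intros d Hd H; [now apply H0|].
apply (IH (stl d)); [now apply ball_series_stl|].
intros x Hx; pose proof (H x Hx) as Hx0.
rewrite power_series_head, (H0 d), qadd_0_l in Hx0; auto.
apply qmul_integral in Hx0; destruct Hx0 as [Hx0|]; trivial.
exfalso; apply (f_equal re) in Hx0; unfold re in Hx0; simpl in Hx0; lra.
Qed.

Lemma has_expansion_intro f (a : ser) : ball_series a ->
  (forall q, ball1 q -> f q = power_series a q) -> has_expansion f a.
Proof. intros Ha H q Hq; rewrite H by trivial; now apply is_series_power_series. Qed.

Lemma has_expansion_unique f (a b : ser) : has_expansion f a -> has_expansion f b -> a = b.
Proof.
intros Ha Hb; apply ser_sub_eq0.
assert (Sa := has_expansion_ball_series _ _ Ha); assert (Sb := has_expansion_ball_series _ _ Hb).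
apply power_series_real_zero; [now apply ball_series_sub|].
intros x Hx. assert (ball1 (qreal x)) by (apply ball1_real; rewrite Rabs_pos_eq; lra).
rewrite power_series_sub, <- (has_expansion_eq f a), <- (has_expansion_eq f b) by trivial.
apply qsub_diag.
Qed.

Lemma coef_expansion f (a : ser) : has_expansion f a -> coef f = a.
Proof.
intros H; apply (has_expansion_unique f); trivial.
unfold coef; apply epsilon_spec; now exists a.
Qed.

Lemma star_power_series f g (a b : ser) : has_expansion f a -> has_expansion g b ->
  star f g = power_series (a * b)%ser.
Proof. intros Ha Hb; unfold star; now rewrite (coef_expansion f a), (coef_expansion g b). Qed.

Lemma has_expansion_star f g (a b : ser) : has_expansion f a -> has_expansion g b ->
  has_expansion (star f g) (a * b)%ser.
Proof.
intros Ha Hb; rewrite (star_power_series f g a b) by trivial.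
apply has_expansion_power_series, ball_series_mul; eapply has_expansion_ball_series; eassumption.
Qed.

Lemma has_expansion_const c : has_expansion (fun _ => c) (sc c).
Proof.
apply has_expansion_intro; [apply ball_series_sc|].
intros q Hq; now rewrite power_series_sc.
Qed.

Lemma power_series_sX_mul a q : ball_series a -> ball1 q ->
  power_series (sX * a)%ser q = (q * power_series a q)%quat.
Proof.
intros Ha Hq; rewrite power_series_head, sX_mul_0, qadd_0_l;
  auto using ball_series_mul, ball_series_sX.
replace (stl (sX * a)%ser) with a; trivial.
apply functional_extensionality; intros n; exact (eq_sym (sX_mul_S _ _)).
Qed.

Lemma has_expansion_id : has_expansion (fun q => q) sX.
Proof.
apply has_expansion_intro; [apply ball_series_sX|]; intros q Hq.
rewrite <- (sc_1_r sX), power_series_sX_mul, power_series_sc; trivial using ball_series_sc.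
symmetry; apply qmul_1_r.
Qed.

Lemma has_expansion_sub f g (a b : ser) : has_expansion f a -> has_expansion g b ->
  has_expansion (fun q => f q - g q)%quat (a - b)%ser.
Proof.
intros Ha Hb.
assert (Sa := has_expansion_ball_series _ _ Ha); assert (Sb := has_expansion_ball_series _ _ Hb).
apply has_expansion_intro; [now apply ball_series_sub|]; intros q Hq.
rewrite power_series_sub by trivial; f_equal; now apply has_expansion_eq.
Qed.

Lemma has_expansion_mul_const f (a : ser) c : has_expansion f a ->
  has_expansion (fun q => f q * c)%quat (a * sc c)%ser.
Proof.
intros Ha.
assert (Sa := has_expansion_ball_series _ _ Ha).
apply has_expansion_intro; [apply ball_series_mul; trivial using ball_series_sc|]; intros q Hq.
rewrite power_series_mul_sc by trivial; f_equal; now apply has_expansion_eq.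
Qed.

Lemma sconj_sc c : sconj (sc c) = sc (qconj c).
Proof. apply functional_extensionality; intros [|n]; unfold sconj; simpl; trivial. apply qconj_0. Qed.

(** In a domain [(b * a - 1) * b = 0] is enough. *)
Lemma left_inverse_is_right a b : (a * b = sc q1)%ser -> (b * a = sc q1)%ser.
Proof.
intros H. assert (E : ((b * a - sc q1) * b = sc q0)%ser).
{ replace ((b * a - sc q1) * b)%ser with (b * (a * b) - b)%ser by non_commutative_ring.
  rewrite H; non_commutative_ring. }
apply smul_integral in E; destruct E as [E | ->]; [now apply ser_sub_eq0|].
exfalso. assert (K := f_equal (fun s => s O) H); simpl in K. rewrite smul_0 in K.
simpl in K; rewrite qmul_0_r in K. apply (f_equal re) in K; unfold re in K; simpl in K; lra.
Qed.

(** Reality is expressed through the conjugation, an antiautomorphism of the ring of series. *)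
Definition real_ser (a : ser) : Prop := forall n, qconj (a n) = a n.

Lemma real_ser_symmetrization a : real_ser (a * sconj a)%ser.
Proof.
intros n. change (sconj (a * sconj a)%ser n = (a * sconj a)%ser n).
rewrite sconj_mul; f_equal; f_equal.
apply functional_extensionality; intros k; apply qconj_conj.
Qed.

Lemma qconj_fixed_comm c d : qconj c = c -> (c * d = d * c)%quat.
Proof.
intros H; replace c with (qreal (re c)); [apply qreal_comm|].
destruct c as [[x y] [z t]]; unfold qconj, mkq, re, im_i, im_j, im_k in *; simpl in *.
injection H; intros. unfold qreal, mkq; repeat f_equal; lra.
Qed.

Lemma real_ser_comm a b : real_ser a -> (a * b = b * a)%ser.
Proof.
intros Ha; apply functional_extensionality; intros n; revert a Ha b.
induction n as [|n IH]; intros a Ha b.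
- rewrite !smul_0; now apply qconj_fixed_comm.
- rewrite smul_S_l, smul_S_r, IH by (intros k; apply Ha).
  rewrite (qconj_fixed_comm (a O)) by apply Ha. apply qadd_comm.
Qed.

Lemma power_series_real_comm a q : real_ser a -> ball_series a -> ball1 q ->
  (q * power_series a q = power_series a q * q)%quat.
Proof.
intros Hr Ha Hq. pose proof (is_series_power_series a q Ha Hq) as S.
rewrite <- (is_series_quat_unique _ _ (is_series_qmul_l _ _ q S)).
rewrite <- (is_series_quat_unique _ _ (is_series_qmul_r _ _ q S)).
f_equal. apply functional_extensionality; intros n.
rewrite qmul_assoc, qpow_comm, <- !qmul_assoc. f_equal.
symmetry; apply qconj_fixed_comm, Hr.
Qed.

(** The symmetrization [s] of [g] has real coefficients, so that evaluation is multiplicative on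
    products with left factor [s].  The value of [b] then follows from [s * b = sconj a], and [s]
    has no zero in the ball because of [s * (b * sconj b) = 1]. *)
Lemma has_expansion_star_inv g (a b : ser) : has_expansion g a -> ball_series b ->
  (a * b = sc q1)%ser -> has_expansion (star_inv g) b.
Proof.
intros Ha Hb Hab. assert (Sa := has_expansion_ball_series _ _ Ha).
assert (Sc := ball_series_sconj _ Sa).
assert (Hba := left_inverse_is_right _ _ Hab).
apply has_expansion_intro; trivial; intros q Hq.
assert (Hc : regular_conj g = power_series (sconj a)).
{ unfold regular_conj; now rewrite (coef_expansion g a). }
unfold star_inv, symmetrization.
rewrite Hc, (star_power_series g _ a (sconj a)) by auto using has_expansion_power_series.
set (s := (a * sconj a)%ser).
assert (Ss : ball_series s) by now apply ball_series_mul.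
assert (Hs : real_ser s) by apply real_ser_symmetrization.
assert (Hsb : (s * b = sconj a)%ser).
{ rewrite real_ser_comm by trivial. unfold s. rewrite smul_assoc, Hba. apply sc_1_l. }
assert (Hval : forall d, ball_series d -> power_series (s * d)%ser q =
  (power_series s q * power_series d q)%quat).
{ intros d Hd; apply power_series_mul; trivial. now apply power_series_real_comm. }
assert (Hns : power_series s q <> q0).
{ intros Z.
  assert (E : (s * (b * sconj b) = sc q1)%ser).
  { rewrite smul_assoc, Hsb, <- sconj_mul, Hba, sconj_sc. now rewrite qconj_1. }
  assert (K := Hval (b * sconj b)%ser ltac:(auto using ball_series_mul, ball_series_sconj)).
  rewrite E, Z, power_series_sc, qmul_0_l in K by trivial.
  apply (f_equal re) in K; unfold re in K; simpl in K; lra. }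
rewrite <- Hsb, Hval, qmul_assoc, qmul_inv_l by trivial. apply qmul_1_l.
Qed.

(** * Kernels and Moebius series *)

(** [skern p] is the series of [(1 - q conj(p))^{-1}], the reproducing kernel of l^2 at [p]. *)
Definition skern (p : quat) : ser := fun n => (qconj p ^ n)%quat.
Definition mob (p : quat) : ser := (skern p * (sX - sc p))%ser.

Lemma skern_left p : ((sc q1 - sX * sc (qconj p)) * skern p = sc q1)%ser.
Proof.
apply functional_extensionality; intros [|n].
- rewrite smul_0; unfold ssub; rewrite sX_mul_0; simpl; non_commutative_ring.
- replace ((sc q1 - sX * sc (qconj p)) * skern p)%ser
    with (skern p - sX * (sc (qconj p) * skern p))%ser by non_commutative_ring.
  unfold ssub; rewrite sX_mul_S, smul_sc_l; unfold skern; simpl; non_commutative_ring.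
Qed.

Lemma skern_right p : (skern p * (sc q1 - sX * sc (qconj p)) = sc q1)%ser.
Proof. apply left_inverse_is_right, skern_left. Qed.

Lemma ball_series_skern p : ball1 p -> ball_series (skern p).
Proof.
intros Hp; apply ball_series_bounded with 1; intros n; unfold skern.
rewrite qmod_pow, qmod_conj, <- (pow1 n). apply pow_incr. split; [apply qmod_pos|].
unfold ball1 in Hp; lra.
Qed.

Lemma ball_series_mob p : ball1 p -> ball_series (mob p).
Proof.
intros Hp; unfold mob; apply ball_series_mul; [now apply ball_series_skern|].
apply ball_series_sub; auto using ball_series_sX, ball_series_sc.
Qed.

Lemma has_expansion_one_sub_mul_const c :
  has_expansion (fun q => q1 - q * c)%quat (sc q1 - sX * sc c)%ser.
Proof.
apply (has_expansion_sub (fun _ => q1)); [apply has_expansion_const|].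
apply has_expansion_mul_const, has_expansion_id.
Qed.

Lemma has_expansion_sub_const f (a : ser) c : has_expansion f a ->
  has_expansion (fun q => f q - c)%quat (a - sc c)%ser.
Proof. intros Ha; apply (has_expansion_sub f (fun _ => c)); trivial. apply has_expansion_const. Qed.

Lemma has_expansion_mobius p : ball1 p -> has_expansion (mobius p) (mob p).
Proof.
intros Hp; unfold mob, mobius; apply has_expansion_star.
- apply (has_expansion_star_inv _ (sc q1 - sX * sc (qconj p))%ser).
  + apply has_expansion_one_sub_mul_const.
  + now apply ball_series_skern.
  + apply skern_left.
- apply has_expansion_sub_const, has_expansion_id.
Qed.

Lemma power_series_skern_at p : ball1 p -> power_series (skern p) p = qreal (/ (1 - sqnorm p)).
Proof.
intros Hp; assert (Sk := ball_series_skern p Hp).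
assert (H1 : sqnorm p < 1).
{ rewrite <- qmod_sqr; unfold ball1 in Hp; pose proof (qmod_pos p); nra. }
assert (Sa : ball_series (sc q1 - sX * sc (qconj p))%ser)
  by apply (has_expansion_ball_series _ _ (has_expansion_one_sub_mul_const (qconj p))).
assert (V : power_series (sc q1 - sX * sc (qconj p))%ser p = qreal (1 - sqnorm p)).
{ rewrite <- (has_expansion_eq _ _ p (has_expansion_one_sub_mul_const (qconj p))) by trivial.
  rewrite qmul_conj_r. quat_ring. }
assert (K := power_series_mul _ (skern p) p p Sa Sk Hp Hp).
rewrite skern_left, power_series_sc, V in K by trivial.
specialize (K (eq_sym (qreal_comm _ _))).
replace (power_series (skern p) p) with
  (qreal (/ (1 - sqnorm p)) * (qreal (1 - sqnorm p) * power_series (skern p) p))%quat.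
- rewrite <- K. apply qmul_1_r.
- rewrite qmul_assoc, <- qreal_mul, Rinv_l by lra. apply qmul_1_l.
Qed.

(** * Cauchy's formula on a disc *)

(** The real and imaginary parts of [(x + i y) ^ n]. *)
Fixpoint cpow (x y : R) (n : nat) : R * R :=
  match n with
  | O => (1, 0)
  | S m => (x * fst (cpow x y m) - y * snd (cpow x y m),
            x * snd (cpow x y m) + y * fst (cpow x y m))
  end.

Lemma cpow_sqr x y n : fst (cpow x y n) ^ 2 + snd (cpow x y n) ^ 2 = (x * x + y * y) ^ n.
Proof. induction n as [|n IH]; simpl in *; [ring|]. rewrite <- IH; ring. Qed.

Lemma cpow_angle t n : cpow (cos t) (sin t) n = (cos (INR n * t), sin (INR n * t)).
Proof.
induction n as [|n IH]; [simpl; now rewrite Rmult_0_l, cos_0, sin_0|].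
rewrite S_INR, Rmult_plus_distr_r, Rmult_1_l, cos_plus, sin_plus; simpl; rewrite IH; simpl.
f_equal; ring.
Qed.

Lemma cpow_mul x y x' y' n :
  fst (cpow (x * x' - y * y') (x * y' + y * x') n)
    = fst (cpow x y n) * fst (cpow x' y' n) - snd (cpow x y n) * snd (cpow x' y' n) /\
  snd (cpow (x * x' - y * y') (x * y' + y * x') n)
    = fst (cpow x y n) * snd (cpow x' y' n) + snd (cpow x y n) * fst (cpow x' y' n).
Proof. induction n as [|n [IH1 IH2]]; simpl; [split; ring|]. rewrite IH1, IH2; split; ring. Qed.

Lemma cpow_conj x y n : cpow x (- y) n = (fst (cpow x y n), - snd (cpow x y n)).
Proof. induction n as [|n IH]; simpl; [f_equal; ring|]. rewrite IH; simpl; f_equal; ring. Qed.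

(** For [g1], [g2] the boundary values of [u], [v], these are the real part and minus the imaginary
    part of the coefficients of the holomorphic function [u - i v]. *)
Definition fourier_re (g1 g2 : R -> R) (n : nat) : R :=
  / (2 * PI) * RInt (fun t => cos (INR n * t) * g1 t - sin (INR n * t) * g2 t) 0 (2 * PI).
Definition fourier_im (g1 g2 : R -> R) (n : nat) : R :=
  / (2 * PI) * RInt (fun t => sin (INR n * t) * g1 t + cos (INR n * t) * g2 t) 0 (2 * PI).

(** The real and imaginary parts of the Cauchy kernel [e / (e - z)], where [e = exp (i t)]. *)
Definition kernel_den (x y t : R) : R := (cos t - x) * (cos t - x) + (sin t - y) * (sin t - y).
Definition kernel_re (x y t : R) : R := (1 - (cos t * x + sin t * y)) / kernel_den x y t.
Definition kernel_im (x y t : R) : R := (cos t * y - sin t * x) / kernel_den x y t.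

Lemma cos2_sin2 t : cos t * cos t + sin t * sin t = 1.
Proof. pose proof (sin2_cos2 t) as H; unfold Rsqr in H; lra. Qed.

Lemma inner_le x y t : (cos t * x + sin t * y) * (cos t * x + sin t * y) <= x * x + y * y.
Proof.
pose proof (cos2_sin2 t) as H.
replace (x * x + y * y) with ((x * x + y * y) * (cos t * cos t + sin t * sin t)) by (rewrite H; ring).
pose proof (Rle_0_sqr (cos t * y - sin t * x)) as K; unfold Rsqr in K. lra.
Qed.

Lemma kernel_den_pos x y t : x * x + y * y < 1 -> 0 < kernel_den x y t.
Proof.
intros H. unfold kernel_den. pose proof (cos2_sin2 t). pose proof (inner_le x y t).
replace ((cos t - x) * (cos t - x) + (sin t - y) * (sin t - y))
  with (1 - 2 * (cos t * x + sin t * y) + (x * x + y * y)) by lra.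
set (p := cos t * x + sin t * y) in *. clearbody p. nra.
Qed.

Lemma ex_RInt_of_continuous f a b : (forall t, continuous f t) -> ex_RInt (V:=R_NormedModule) f a b.
Proof. intros H; apply (ex_RInt_continuous (V:=R_CompleteNormedModule)); intros; apply H. Qed.

Lemma continuous_cos_n n t : continuous (fun t => cos (INR n * t)) t.
Proof. apply (ex_derive_continuous (V:=R_NormedModule)); auto_derive; trivial. Qed.
Lemma continuous_sin_n n t : continuous (fun t => sin (INR n * t)) t.
Proof. apply (ex_derive_continuous (V:=R_NormedModule)); auto_derive; trivial. Qed.
Lemma continuous_kernel_re x y t : x * x + y * y < 1 -> continuous (kernel_re x y) t.
Proof.
intros H; apply (ex_derive_continuous (V:=R_NormedModule)); unfold kernel_re, kernel_den.
pose proof (kernel_den_pos x y t H) as K; unfold kernel_den in K.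
auto_derive. intros E; apply (Rlt_not_eq _ _ K); rewrite <- E; ring.
Qed.
Lemma continuous_kernel_im x y t : x * x + y * y < 1 -> continuous (kernel_im x y) t.
Proof.
intros H; apply (ex_derive_continuous (V:=R_NormedModule)); unfold kernel_im, kernel_den.
pose proof (kernel_den_pos x y t H) as K; unfold kernel_den in K.
auto_derive. intros E; apply (Rlt_not_eq _ _ K); rewrite <- E; ring.
Qed.

Lemma continuous_mul (f g : R -> R) t :
  continuous f t -> continuous g t -> continuous (fun t => f t * g t) t.
Proof. intros; now apply (continuous_mult (K:=R_AbsRing)). Qed.
Lemma continuous_add (f g : R -> R) t :
  continuous f t -> continuous g t -> continuous (fun t => f t + g t) t.
Proof. intros; now apply (continuous_plus (V:=R_NormedModule)). Qed.
Lemma continuous_sub (f g : R -> R) t :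
  continuous f t -> continuous g t -> continuous (fun t => f t - g t) t.
Proof. intros; now apply (continuous_minus (V:=R_NormedModule)). Qed.

Ltac as_real_eq := match goal with |- ?a = ?b => change (@eq R a b) end.

Lemma RInt_combination (f g : R -> R) c d a b :
  ex_RInt (V:=R_NormedModule) f a b -> ex_RInt (V:=R_NormedModule) g a b ->
  RInt (fun t => c * f t + d * g t) a b = c * RInt f a b + d * RInt g a b.
Proof.
intros Hf Hg; apply is_RInt_unique.
apply (is_RInt_plus (V:=R_NormedModule));
  apply (is_RInt_scal (V:=R_NormedModule)); now apply (RInt_correct (V:=R_CompleteNormedModule)).
Qed.

(** The geometric expansion of the Cauchy kernel, integrated against boundary values. *)
Lemma cauchy_kernel_expansion g1 g2 M x y :
  (forall t, continuous g1 t) -> (forall t, continuous g2 t) ->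
  (forall t, 0 <= t <= 2 * PI -> Rabs (g1 t) <= M /\ Rabs (g2 t) <= M) -> x * x + y * y < 1 ->
  is_series (fun n => fst (cpow x y n) * fourier_re g1 g2 n + snd (cpow x y n) * fourier_im g1 g2 n)
    (/ (2 * PI) * RInt (fun t => kernel_re x y t * g1 t + kernel_im x y t * g2 t) 0 (2 * PI)).
Proof.
intros C1 C2 HM Hz.
pose proof PI_RGT_0 as Hpi.
(* the powers of [z / e], where [e = exp (i t)] *)
set (w := fun t => cpow (cos t * x + sin t * y) (cos t * y - sin t * x)).
assert (Hw : forall t n, fst (w t n) =
    cos (INR n * t) * fst (cpow x y n) + sin (INR n * t) * snd (cpow x y n) /\
  snd (w t n) = cos (INR n * t) * snd (cpow x y n) - sin (INR n * t) * fst (cpow x y n)).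
{ intros t n. unfold w.
  replace (cos t * x + sin t * y) with (cos t * x - - sin t * y) by ring.
  replace (cos t * y - sin t * x) with (cos t * y + - sin t * x) by ring.
  destruct (cpow_mul (cos t) (- sin t) x y n) as [-> ->].
  rewrite cpow_conj, cpow_angle; simpl; split; ring. }
assert (Cw1 : forall n t, continuous (fun t => fst (w t n)) t).
{ intros n t. apply (continuous_ext (fun t => cos (INR n * t) * fst (cpow x y n)
    + sin (INR n * t) * snd (cpow x y n))); [intros s; symmetry; apply Hw|].
  apply continuous_add; apply continuous_mul; auto using continuous_cos_n, continuous_sin_n;
  apply continuous_const. }
assert (Cw2 : forall n t, continuous (fun t => snd (w t n)) t).
{ intros n t. apply (continuous_ext (fun t => cos (INR n * t) * snd (cpow x y n)
    - sin (INR n * t) * fst (cpow x y n))); [intros s; symmetry; apply Hw|].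
  apply continuous_sub; apply continuous_mul; auto using continuous_cos_n, continuous_sin_n;
  apply continuous_const. }
(* the real part of the remainder [e / (e - z) (z / e) ^ N (g1 - i g2)] *)
set (rem := fun N t => (kernel_re x y t * fst (w t N) - kernel_im x y t * snd (w t N)) * g1 t
   + (kernel_re x y t * snd (w t N) + kernel_im x y t * fst (w t N)) * g2 t).
assert (Ck : forall t, continuous (kernel_re x y) t) by (intros; now apply continuous_kernel_re).
assert (Ck' : forall t, continuous (kernel_im x y) t) by (intros; now apply continuous_kernel_im).
assert (Crem : forall N t, continuous (rem N) t).
{ intros N t; unfold rem; apply continuous_add; apply continuous_mul; auto.
  - apply continuous_sub; apply continuous_mul; auto.
  - apply continuous_add; apply continuous_mul; auto. }
(* one more term of the geometric series *)
assert (Hstep : forall N t, rem N t - rem (S N) t = fst (w t N) * g1 t + snd (w t N) * g2 t).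
{ intros N t. unfold rem.
  assert (K : kernel_re x y t * (1 - (cos t * x + sin t * y))
      + kernel_im x y t * (cos t * y - sin t * x) = 1 /\
     kernel_im x y t * (1 - (cos t * x + sin t * y))
      - kernel_re x y t * (cos t * y - sin t * x) = 0).
  { pose proof (kernel_den_pos x y t Hz) as K. unfold kernel_re, kernel_im. split.
    - replace ((1 - (cos t * x + sin t * y)) / kernel_den x y t * (1 - (cos t * x + sin t * y)) +
        (cos t * y - sin t * x) / kernel_den x y t * (cos t * y - sin t * x))
      with (((1 - (cos t * x + sin t * y)) * (1 - (cos t * x + sin t * y)) +
        (cos t * y - sin t * x)* (cos t * y - sin t * x)) / kernel_den x y t) by (field; lra).
      replace ((1 - (cos t * x + sin t * y)) * (1 - (cos t * x + sin t * y)) +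
        (cos t * y - sin t * x)* (cos t * y - sin t * x)) with (kernel_den x y t); [field; lra|].
      unfold kernel_den. pose proof (cos2_sin2 t) as T.
      transitivity ((cos t * cos t + sin t * sin t) - 2 * (cos t * x + sin t * y)
         + (x * x + y * y)); [ring|].
      transitivity (1 - 2 * (cos t * x + sin t * y)
         + (x * x + y * y) * (cos t * cos t + sin t * sin t)); [rewrite T; ring|ring].
    - field; lra. }
  destruct K as [K1 K2]. unfold w in *; simpl.
  set (A := cos t * x + sin t * y) in *. set (B := cos t * y - sin t * x) in *.
  set (p := fst (cpow A B N)); set (q := snd (cpow A B N)).
  transitivity ((kernel_re x y t * (1 - A) + kernel_im x y t * B) * (p * g1 t + q * g2 t)
     + (kernel_im x y t * (1 - A) - kernel_re x y t * B) * (p * g2 t - q * g1 t)); [ring|].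
  rewrite K1, K2; ring. }
assert (Hpart : forall N, sum_n (fun n => fst (cpow x y n) * fourier_re g1 g2 n
     + snd (cpow x y n) * fourier_im g1 g2 n) N =
   / (2 * PI) * RInt (rem O) 0 (2 * PI) - / (2 * PI) * RInt (rem (S N)) 0 (2 * PI)).
{ assert (Hterm : forall n, fst (cpow x y n) * fourier_re g1 g2 n
     + snd (cpow x y n) * fourier_im g1 g2 n =
     / (2 * PI) * RInt (rem n) 0 (2 * PI) - / (2 * PI) * RInt (rem (S n)) 0 (2 * PI)).
  { intros n. unfold fourier_re, fourier_im.
    set (P1 := fun t => cos (INR n * t) * g1 t - sin (INR n * t) * g2 t).
    set (P2 := fun t => sin (INR n * t) * g1 t + cos (INR n * t) * g2 t).
    assert (X1 : ex_RInt P1 0 (2 * PI)).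
    { apply ex_RInt_of_continuous; intros t; apply continuous_sub; apply continuous_mul;
      auto using continuous_cos_n, continuous_sin_n. }
    assert (X2 : ex_RInt P2 0 (2 * PI)).
    { apply ex_RInt_of_continuous; intros t; apply continuous_add; apply continuous_mul;
      auto using continuous_cos_n, continuous_sin_n. }
    assert (Y : forall n, ex_RInt (rem n) 0 (2 * PI)) by (intros; apply ex_RInt_of_continuous, Crem).
    transitivity (/ (2 * PI) * RInt (fun t => fst (cpow x y n) * P1 t
       + snd (cpow x y n) * P2 t) 0 (2 * PI)).
    { rewrite RInt_combination by trivial. ring. }
    rewrite <- Rmult_minus_distr_l. f_equal.
    transitivity (RInt (fun t => 1 * rem n t + (- 1) * rem (S n) t) 0 (2 * PI)).
    - apply RInt_ext; intros t _.
      as_real_eq.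
      transitivity (rem n t - rem (S n) t); [|ring].
      rewrite Hstep. destruct (Hw t n) as [-> ->]. unfold P1, P2; ring.
    - rewrite RInt_combination by trivial; as_real_eq; ring. }
  induction N as [|N IH]; [rewrite sum_O; apply Hterm|].
  rewrite sum_Sn, IH, Hterm. unfold plus; simpl; ring. }
assert (H0 : RInt (fun t => kernel_re x y t * g1 t + kernel_im x y t * g2 t) 0 (2 * PI)
  = RInt (rem O) 0 (2 * PI)).
{ apply RInt_ext; intros t _; unfold rem, w; simpl fst; simpl snd.
  as_real_eq; ring. }
rewrite H0.
set (r := sqrt (x * x + y * y)).
assert (Hr2 : r * r = x * x + y * y) by (apply sqrt_sqrt; nra).
assert (Hr : 0 <= r < 1).
{ split; [apply sqrt_pos|]. rewrite <- sqrt_1. apply sqrt_lt_1_alt; split; trivial; nra. }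
assert (HM0 : 0 <= M) by (destruct (HM 0) as [K _]; [lra|]; pose proof (Rabs_pos (g1 0)); lra).
(* the remainder decreases geometrically, uniformly on the circle *)
assert (Hb : forall N t, 0 <= t <= 2 * PI -> Rabs (rem N t) <= 4 * M / (1 - r) * r ^ N).
{ intros N t Ht.
  assert (Hwb : Rabs (fst (w t N)) <= r ^ N /\ Rabs (snd (w t N)) <= r ^ N).
  { assert (E := cpow_sqr (cos t * x + sin t * y) (cos t * y - sin t * x) N).
    replace ((cos t * x + sin t * y) * (cos t * x + sin t * y)
      + (cos t * y - sin t * x) * (cos t * y - sin t * x))
      with ((cos t * cos t + sin t * sin t) * (x * x + y * y)) in E by ring.
    rewrite cos2_sin2, Rmult_1_l, <- Hr2, Rpow_mult_distr in E.
    change (fst (w t N) ^ 2 + snd (w t N) ^ 2 = r ^ N * r ^ N) in E.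
    assert (0 <= r ^ N) by (apply pow_le; lra).
    split; apply Rabs_le; split; nra. }
  assert (Hkb : Rabs (kernel_re x y t) <= / (1 - r) /\ Rabs (kernel_im x y t) <= / (1 - r)).
  { assert (D := kernel_den_pos x y t Hz).
    assert (E : (kernel_re x y t * kernel_re x y t + kernel_im x y t * kernel_im x y t)
       * kernel_den x y t = 1).
    { unfold kernel_re, kernel_im.
      assert (N0 : (1 - (cos t * x + sin t * y)) * (1 - (cos t * x + sin t * y)) +
        (cos t * y - sin t * x)* (cos t * y - sin t * x) = kernel_den x y t).
      { unfold kernel_den. pose proof (cos2_sin2 t) as T.
        transitivity (1 - 2 * (cos t * x + sin t * y)
          + (x * x + y * y) * (cos t * cos t + sin t * sin t)); [ring|].
        rewrite T. transitivity ((cos t * cos t + sin t * sin t) - 2 * (cos t * x + sin t * y)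
         + (x * x + y * y)); [rewrite T; ring|ring]. }
      transitivity (((1 - (cos t * x + sin t * y)) * (1 - (cos t * x + sin t * y)) +
        (cos t * y - sin t * x)* (cos t * y - sin t * x)) / kernel_den x y t); [field; lra|].
      rewrite N0; field; lra. }
    assert (D2 : (1 - r) * (1 - r) <= kernel_den x y t).
    { unfold kernel_den. pose proof (inner_le x y t) as L. rewrite <- Hr2 in L.
      assert (cos t * x + sin t * y <= r) by nra.
      pose proof (cos2_sin2 t) as T.
      replace ((cos t - x) * (cos t - x) + (sin t - y) * (sin t - y))
        with ((cos t * cos t + sin t * sin t) - 2 * (cos t * x + sin t * y)
           + (x * x + y * y)) by ring.
      rewrite T, <- Hr2. nra. }
    set (k1 := kernel_re x y t) in *; set (k2 := kernel_im x y t) in *.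
    assert (F : (k1 * k1 + k2 * k2) * ((1 - r) * (1 - r)) <= 1).
    { eapply Rle_trans; [apply Rmult_le_compat_l; [nra|exact D2]|lra]. }
    assert (G : forall k, k * k <= k1 * k1 + k2 * k2 -> Rabs k <= / (1 - r)).
    { intros k Hk. apply Rmult_le_reg_r with (1 - r); [lra|]. rewrite Rinv_l by lra.
      rewrite <- (Rabs_pos_eq (1 - r)) by lra. rewrite <- Rabs_mult.
      assert ((k * (1 - r)) * (k * (1 - r)) <= 1).
      { apply Rle_trans with (2 := F). replace (k * (1 - r) * (k * (1 - r)))
          with (k * k * ((1 - r) * (1 - r))) by ring. apply Rmult_le_compat_r; trivial; nra. }
      apply Rabs_le; split; nra. }
    split; apply G; nra. }
  destruct (HM t Ht) as [HM1 HM2]. destruct Hwb as [W1 W2], Hkb as [K1 K2].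
  assert (T : forall k w g, Rabs k <= / (1 - r) -> Rabs w <= r ^ N -> Rabs g <= M ->
     Rabs (k * w * g) <= M / (1 - r) * r ^ N).
  { intros k w' g A1 A2 A3; rewrite !Rabs_mult.
    replace (M / (1 - r) * r ^ N) with (/ (1 - r) * r ^ N * M) by (unfold Rdiv; ring).
    apply Rmult_le_compat; auto using Rabs_pos; [apply Rmult_le_pos; apply Rabs_pos|].
    apply Rmult_le_compat; auto using Rabs_pos. }
  unfold rem.
  replace ((kernel_re x y t * fst (w t N) - kernel_im x y t * snd (w t N)) * g1 t
   + (kernel_re x y t * snd (w t N) + kernel_im x y t * fst (w t N)) * g2 t) with
   (kernel_re x y t * fst (w t N) * g1 t + - (kernel_im x y t * snd (w t N) * g1 t)
    + (kernel_re x y t * snd (w t N) * g2 t + kernel_im x y t * fst (w t N) * g2 t)) by ring.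
  eapply Rle_trans; [apply Rabs_triang|].
  eapply Rle_trans; [apply Rplus_le_compat; apply Rabs_triang|].
  rewrite Rabs_Ropp.
  pose proof (T _ _ _ K1 W1 HM1). pose proof (T _ _ _ K2 W2 HM1).
  pose proof (T _ _ _ K1 W2 HM2). pose proof (T _ _ _ K2 W1 HM2).
  replace (4 * M / (1 - r) * r ^ N) with (4 * (M / (1 - r) * r ^ N)) by (unfold Rdiv; ring). lra. }
apply (filterlim_ext (fun N => / (2 * PI) * RInt (rem O) 0 (2 * PI)
   - / (2 * PI) * RInt (rem (S N)) 0 (2 * PI))); [intros N; symmetry; apply Hpart|].
set (L := / (2 * PI) * RInt (rem O) 0 (2 * PI)).
apply (is_lim_seq_ext (fun N => L - / (2 * PI) * RInt (rem (S N)) 0 (2 * PI)) _ L);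
  [reflexivity|].
replace (Finite L) with (Finite (L - 0)) by (f_equal; ring).
apply is_lim_seq_minus'; [apply is_lim_seq_const|].
apply is_lim_seq_abs_0.
apply (is_lim_seq_le_le (fun _ => 0) _ (fun N => 4 * M / (1 - r) * r * r ^ N)).
- intros N; split; [apply Rabs_pos|]. rewrite Rabs_mult.
  assert (ID := abs_RInt_le_const (rem (S N)) 0 (2 * PI) (4 * M / (1 - r) * r ^ S N)
     ltac:(lra) ltac:(apply ex_RInt_of_continuous, Crem) (Hb (S N))).
  rewrite Rabs_pos_eq by (left; apply Rinv_0_lt_compat; lra).
  apply Rmult_le_reg_l with (2 * PI); [lra|].
  rewrite <- Rmult_assoc, Rinv_r, Rmult_1_l by lra. simpl in *. lra.
- apply is_lim_seq_const.
- replace (Finite 0) with (Finite (4 * M / (1 - r) * r * 0)) by (f_equal; ring).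
  apply (is_lim_seq_scal_l _ _ 0), is_lim_seq_geom. rewrite Rabs_pos_eq; lra.
Qed.

Lemma differentiable_of_partials u a b x y :
  locally (x, y) (fun z : R * R => is_derive (fun t => u t (snd z)) (fst z) (a (fst z) (snd z))) ->
  is_derive (fun t => u x t) y (b x y) -> continuity_2d_pt a x y ->
  differentiable_pt_lim u x y (a x y) (b x y).
Proof.
intros H1 H2 H3. apply filterdiff_differentiable_pt_lim.
apply (is_derive_filterdiff u x y a (b x y)) in H1; trivial.
now apply continuity_2d_pt_filterlim.
Qed.

Lemma continuity_2d_pt_comp f g h x y :
  continuity_2d_pt f (g x y) (h x y) -> continuity_2d_pt g x y -> continuity_2d_pt h x y ->
  continuity_2d_pt (fun u v => f (g u v) (h u v)) x y.
Proof.
intros Hf Hg Hh e. destruct (Hf e) as [d Hd]. destruct (Hg d) as [d1 H1], (Hh d) as [d2 H2].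
exists (mkposreal _ (Rmin_stable_in_posreal d1 d2)); simpl; intros u v Hu Hv.
apply Hd; [apply H1|apply H2]; (eapply Rlt_le_trans; [eassumption|]);
  auto using Rmin_l, Rmin_r.
Qed.

Lemma continuity_2d_pt_lt w x y c : continuity_2d_pt w x y -> w x y < c ->
  locally_2d (fun u v => w u v < c) x y.
Proof.
intros H Hlt. assert (He : 0 < c - w x y) by lra.
destruct (H (mkposreal _ He)) as [d Hd]; exists d; intros u v Hu Hv.
specialize (Hd u v Hu Hv); simpl in Hd. apply Rabs_def2 in Hd; lra.
Qed.

Lemma continuity_2d_pt_sub_r f x y : continuous f y -> continuity_2d_pt (fun _ v => f v) x y.
Proof.
intros H e. destruct (proj1 (filterlim_locally _ _) H e) as [d Hd].
exists d; intros u v _ Hv; apply Hd; exact Hv.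
Qed.

(** The function [u - i v] is holomorphic on the disc of radius [R0]; [a] and [b] are the partial
    derivatives of [u]. *)
Definition conjugate_pair (R0 : R) (u v a b : R -> R -> R) : Prop :=
  forall x y, x * x + y * y < R0 * R0 ->
    is_derive (fun t => u t y) x (a x y) /\ is_derive (fun t => u x t) y (b x y) /\
    is_derive (fun t => v t y) x (b x y) /\ is_derive (fun t => v x t) y (- a x y) /\
    continuity_2d_pt a x y /\ continuity_2d_pt b x y.

Lemma disc_locally R0 x y : x * x + y * y < R0 * R0 ->
  locally_2d (fun u v => u * u + v * v < R0 * R0) x y.
Proof.
intros H; apply continuity_2d_pt_lt; trivial.
apply continuity_2d_pt_plus; apply continuity_2d_pt_mult;
  auto using continuity_2d_pt_id1, continuity_2d_pt_id2.
Qed.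

Lemma conjugate_pair_differentiable R0 u v a b x y :
  conjugate_pair R0 u v a b -> x * x + y * y < R0 * R0 ->
  differentiable_pt_lim u x y (a x y) (b x y) /\
  differentiable_pt_lim v x y (b x y) (- a x y).
Proof.
intros H Hd. destruct (H x y Hd) as (H1 & H2 & H3 & H4 & H5 & H6).
assert (L : forall P : R -> R -> Prop, (forall x y, x * x + y * y < R0 * R0 -> P x y) ->
   locally (x, y) (fun z : R * R => P (fst z) (snd z))).
{ intros P HP. apply locally_2d_locally.
  apply (locally_2d_impl (fun u v => u * u + v * v < R0 * R0)); [|now apply disc_locally].
  apply locally_2d_forall; intros; now apply HP. }
split.
- apply differentiable_of_partials; trivial.
  apply (L (fun x y => is_derive (fun t => u t y) x (a x y))); intros; now apply H.
- apply (differentiable_of_partials v b (fun x y => - a x y)); trivial.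
  apply (L (fun x y => is_derive (fun t => v t y) x (b x y))); intros; now apply H.
Qed.

(** Points of the segment from [z] to [exp (i t)]. *)
Definition seg (x s e : R) : R := (1 - s) * x + s * e.

Lemma seg_in_disc R0 x y s t : 1 < R0 -> x * x + y * y < 1 -> - ((R0 - 1) / 4) < s < 1 + (R0 - 1) / 4 ->
  seg x s (cos t) * seg x s (cos t) + seg y s (sin t) * seg y s (sin t) < R0 * R0.
Proof.
intros HR Hz Hs. unfold seg.
pose proof (inner_le x y t) as L. pose proof (cos2_sin2 t) as T.
set (p := cos t * x + sin t * y) in *.
replace (((1 - s) * x + s * cos t) * ((1 - s) * x + s * cos t) +
  ((1 - s) * y + s * sin t) * ((1 - s) * y + s * sin t))
  with ((1 - s) * (1 - s) * (x * x + y * y) + 2 * ((1 - s) * s) * p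
    + s * s * (cos t * cos t + sin t * sin t)) by (unfold p; ring).
rewrite T.
assert (Hp : -1 <= p <= 1) by (clearbody p; nra).
assert (Hz0 : 0 <= x * x + y * y) by nra.
set (m := x * x + y * y) in *. clearbody m p.
set (d := (R0 - 1) / 4) in *. assert (HR' : R0 = 1 + 4 * d) by (unfold d; lra). clearbody d.
subst R0. assert (0 < d) by lra.
assert (Q : (1 - s) * (1 - s) * m <= (1 - s) * (1 - s)).
{ pose proof (Rle_0_sqr (1 - s)) as K; unfold Rsqr in K.
  pose proof (Rmult_le_compat_l _ m 1 K); lra. }
destruct (Rle_dec 0 ((1 - s) * s)) as [P|P].
- assert (2 * ((1 - s) * s) * p <= 2 * ((1 - s) * s)) by nra. nra.
- assert (2 * ((1 - s) * s) * p <= - (2 * ((1 - s) * s))) by nra.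
  assert ((1 - s) * (1 - s) - 2 * ((1 - s) * s) + s * s <= (1 + 2 * d) * (1 + 2 * d)); [|nra].
  replace ((1 - s) * (1 - s) - 2 * ((1 - s) * s) + s * s) with ((1 - 2 * s) * (1 - 2 * s)) by ring.
  nra.
Qed.

(** The unit circle is contracted to [z = x + i y] along the segments from [exp (i t)] to [z].  The
    integrand [g] at the position [s] is the real part of [e / (e - z) (u - i v)].  Its derivative
    in [s] is [h], and [- s h] is the derivative in [t] of the periodic function [V]; therefore the
    integral of [g] over the circle does not depend on [s]. *)
Section Homotopy.
Variables (R0 : R) (u v a b : R -> R -> R) (x y : R).
Hypotheses (HR : 1 < R0) (Huv : conjugate_pair R0 u v a b) (Hz : x * x + y * y < 1).

(* a neighbourhood of the unit interval for which the segments stay in the disc of radius [R0] *)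
Let good (s : R) := - ((R0 - 1) / 4) < s < 1 + (R0 - 1) / 4.
Let U (s t : R) := u (seg x s (cos t)) (seg y s (sin t)).
Let V (s t : R) := v (seg x s (cos t)) (seg y s (sin t)).
Let g (s t : R) := kernel_re x y t * U s t + kernel_im x y t * V s t.
Let h (s t : R) := cos t * a (seg x s (cos t)) (seg y s (sin t))
                 + sin t * b (seg x s (cos t)) (seg y s (sin t)).

Lemma seg_derive_s c e s : derivable_pt_lim (fun s => seg c s e) s (e - c).
Proof. apply is_derive_Reals; unfold seg; auto_derive; trivial; ring. Qed.

Lemma UV_derive_s s t : good s ->
  is_derive (fun s => U s t) s (a (seg x s (cos t)) (seg y s (sin t)) * (cos t - x)
     + b (seg x s (cos t)) (seg y s (sin t)) * (sin t - y)) /\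
  is_derive (fun s => V s t) s (b (seg x s (cos t)) (seg y s (sin t)) * (cos t - x)
     + - a (seg x s (cos t)) (seg y s (sin t)) * (sin t - y)).
Proof.
intros Hs. destruct (conjugate_pair_differentiable R0 u v a b _ _ Huv
  (seg_in_disc R0 x y s t HR Hz Hs)) as [D1 D2].
split; apply is_derive_Reals;
 apply (derivable_pt_lim_comp_2d _ (fun s => seg x s (cos t)) (fun s => seg y s (sin t)));
 auto using seg_derive_s.
Qed.

Lemma UV_derive_t s t : good s ->
  is_derive (U s) t (a (seg x s (cos t)) (seg y s (sin t)) * (- s * sin t)
     + b (seg x s (cos t)) (seg y s (sin t)) * (s * cos t)) /\
  is_derive (V s) t (- s * h s t).
Proof.
intros Hs. destruct (conjugate_pair_differentiable R0 u v a b _ _ Huv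
  (seg_in_disc R0 x y s t HR Hz Hs)) as [D1 D2].
assert (E1 : derivable_pt_lim (fun t => seg x s (cos t)) t (- s * sin t)).
{ apply is_derive_Reals; unfold seg; auto_derive; trivial; ring. }
assert (E2 : derivable_pt_lim (fun t => seg y s (sin t)) t (s * cos t)).
{ apply is_derive_Reals; unfold seg; auto_derive; trivial; ring. }
split; apply is_derive_Reals.
- now apply (derivable_pt_lim_comp_2d _ (fun t => seg x s (cos t)) (fun t => seg y s (sin t))).
- replace (- s * h s t) with (b (seg x s (cos t)) (seg y s (sin t)) * (- s * sin t)
     + - a (seg x s (cos t)) (seg y s (sin t)) * (s * cos t)) by (unfold h; ring).
  now apply (derivable_pt_lim_comp_2d _ (fun t => seg x s (cos t)) (fun t => seg y s (sin t))).
Qed.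

Lemma UV_continuous_t s t : good s -> continuous (U s) t /\ continuous (V s) t.
Proof.
intros Hs; destruct (UV_derive_t s t Hs) as [H1 H2].
split; apply (ex_derive_continuous (V:=R_NormedModule)); eexists; eassumption.
Qed.

Lemma g_derive_s s t : good s -> is_derive (fun s => g s t) s (h s t).
Proof.
intros Hs; destruct (UV_derive_s s t Hs) as [H1 H2]. unfold g.
assert (K : kernel_re x y t * (cos t - x) - kernel_im x y t * (sin t - y) = cos t /\
  kernel_re x y t * (sin t - y) + kernel_im x y t * (cos t - x) = sin t).
{ pose proof (kernel_den_pos x y t Hz) as D. unfold kernel_re, kernel_im.
  pose proof (cos2_sin2 t) as T.
  split; (apply Rmult_eq_reg_r with (kernel_den x y t); [|lra]).
  - transitivity ((1 - (cos t * x + sin t * y)) * (cos t - x)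
      - (cos t * y - sin t * x) * (sin t - y)); [field; lra|].
    rewrite <- T at 1. unfold kernel_den; ring.
  - transitivity ((1 - (cos t * x + sin t * y)) * (sin t - y)
      + (cos t * y - sin t * x) * (cos t - x)); [field; lra|].
    rewrite <- T at 1. unfold kernel_den; ring. }
destruct K as [K1 K2].
match type of H1 with is_derive _ _ ?l1 => match type of H2 with is_derive _ _ ?l2 =>
  replace (h s t) with (kernel_re x y t * l1 + kernel_im x y t * l2) end end.
- apply (is_derive_plus (V:=R_NormedModule)); now apply is_derive_scal.
- unfold h. set (A := a (seg x s (cos t)) (seg y s (sin t))) in *.
  set (B := b (seg x s (cos t)) (seg y s (sin t))) in *.
  transitivity (A * (kernel_re x y t * (cos t - x) - kernel_im x y t * (sin t - y))
    + B * (kernel_re x y t * (sin t - y) + kernel_im x y t * (cos t - x))); [ring|].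
  rewrite K1, K2; ring.
Qed.

Lemma good_unit s : 0 <= s <= 1 -> good s.
Proof. intros H; unfold good; lra. Qed.

Lemma good_locally s : 0 <= s <= 1 -> locally s good.
Proof.
intros H. assert (He : 0 < (R0 - 1) / 4) by lra.
exists (mkposreal _ He); intros r Hr. change (Rabs (r - s) < (R0 - 1) / 4) in Hr.
apply Rabs_def2 in Hr; unfold good; lra.
Qed.

Lemma g_continuous_t s t : good s -> continuous (g s) t.
Proof.
intros Hs; destruct (UV_continuous_t s t Hs); unfold g.
apply continuous_add; apply continuous_mul; trivial;
  [now apply continuous_kernel_re | now apply continuous_kernel_im].
Qed.

Lemma seg_continuity_2d c f s t : continuous f t -> continuity_2d_pt (fun s t => seg c s (f t)) s t.
Proof.
intros Hf; unfold seg; apply continuity_2d_pt_plus; apply continuity_2d_pt_mult;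
  auto using continuity_2d_pt_const, continuity_2d_pt_id1, continuity_2d_pt_sub_r.
apply continuity_2d_pt_minus; auto using continuity_2d_pt_const, continuity_2d_pt_id1.
Qed.

Lemma h_continuity_2d s t : good s -> continuity_2d_pt h s t.
Proof.
intros Hs. destruct (Huv _ _ (seg_in_disc R0 x y s t HR Hz Hs)) as (_ & _ & _ & _ & Ca & Cb).
unfold h; apply continuity_2d_pt_plus; apply continuity_2d_pt_mult;
  try (apply continuity_2d_pt_sub_r; auto using continuous_cos, continuous_sin);
  apply (continuity_2d_pt_comp _ (fun s t => seg x s (cos t)) (fun s t => seg y s (sin t)));
  auto using seg_continuity_2d, continuous_cos, continuous_sin.
Qed.

Lemma h_continuous_t s t : good s -> continuous (h s) t.
Proof.
intros Hs. pose proof (h_continuity_2d s t Hs) as H. apply continuity_2d_pt_filterlim in H.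
apply (continuous_comp_2 (fun _ => s) (fun t => t) h t).
- apply continuous_const.
- apply continuous_id.
- exact H.
Qed.

Lemma homotopy_derive s : 0 <= s <= 1 ->
  is_derive (fun s => RInt (g s) 0 (2 * PI)) s (RInt (h s) 0 (2 * PI)).
Proof.
intros Hs. pose proof PI_RGT_0.
replace (RInt (h s) 0 (2 * PI)) with (RInt (fun t => Derive (fun s => g s t) s) 0 (2 * PI)).
2:{ apply RInt_ext; intros t _. apply is_derive_unique, g_derive_s, good_unit, Hs. }
apply (is_derive_RInt_param g).
- apply (filter_imp good); [|now apply good_locally].
  intros r Hr t _; exists (h r t); now apply g_derive_s.
- intros t _. apply (continuity_2d_pt_ext_loc h); [|now apply h_continuity_2d, good_unit].
  destruct (good_locally s Hs) as [d Hd]; exists d; intros r t' Hr _.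
  symmetry; apply is_derive_unique, g_derive_s, Hd, Hr.
- apply (filter_imp good); [|now apply good_locally].
  intros r Hr; apply ex_RInt_of_continuous; intros t; now apply g_continuous_t.
Qed.

Lemma h_integral s : 0 < s <= 1 -> RInt (h s) 0 (2 * PI) = 0.
Proof.
intros Hs. assert (Gs : good s) by (apply good_unit; lra).
assert (E : is_RInt (V:=R_NormedModule) (fun t => - s * h s t) 0 (2 * PI)
   (V s (2 * PI) - V s 0)).
{ apply (is_RInt_derive (V:=R_CompleteNormedModule) (V s)).
  - intros t _; now apply UV_derive_t.
  - intros t _; apply continuous_mul; [apply continuous_const | now apply h_continuous_t]. }
assert (EV : V s (2 * PI) - V s 0 = 0).
{ unfold V; rewrite cos_2PI, sin_2PI, cos_0, sin_0; ring. }
rewrite EV in E. apply (is_RInt_unique (V:=R_CompleteNormedModule)) in E.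
assert (X : ex_RInt (V:=R_NormedModule) (h s) 0 (2 * PI))
  by (apply ex_RInt_of_continuous; intros; now apply h_continuous_t).
assert (E2 : RInt (fun t => - s * h s t) 0 (2 * PI) = - s * RInt (h s) 0 (2 * PI)).
{ apply is_RInt_unique, (is_RInt_scal (V:=R_NormedModule)).
  now apply (RInt_correct (V:=R_CompleteNormedModule)). }
change (@eq R (RInt (fun t => - s * h s t) 0 (2 * PI)) 0) in E.
rewrite E2 in E. apply Rmult_integral in E; destruct E as [E|E]; trivial. lra.
Qed.

Lemma homotopy_ends : RInt (g 0) 0 (2 * PI) = RInt (g 1) 0 (2 * PI).
Proof.
destruct (MVT_gen (fun s => RInt (g s) 0 (2 * PI)) 0 1 (fun _ => 0)) as (c & _ & Hc).
- intros s; rewrite Rmin_left, Rmax_right by lra; intros Hs.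
  pose proof (homotopy_derive s ltac:(lra)) as K; rewrite h_integral in K by lra; exact K.
- intros s; rewrite Rmin_left, Rmax_right by lra; intros Hs.
  apply continuity_pt_filterlim.
  apply (ex_derive_continuous (V:=R_NormedModule) (fun s => RInt (g s) 0 (2 * PI))).
  eexists; now apply homotopy_derive.
- lra.
Qed.

Lemma trig_integrals n : (0 < n)%nat ->
  is_RInt (V:=R_NormedModule) (fun t => cos (INR n * t)) 0 (2 * PI) 0 /\
  is_RInt (V:=R_NormedModule) (fun t => sin (INR n * t)) 0 (2 * PI) 0.
Proof.
intros Hn. assert (0 < INR n) by now apply lt_0_INR.
assert (P : forall k, cos (INR k * (2 * PI)) = 1 /\ sin (INR k * (2 * PI)) = 0).
{ intros k; replace (INR k * (2 * PI)) with (0 + 2 * INR k * PI) by ring.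
  now rewrite cos_period, sin_period, cos_0, sin_0. }
destruct (P n) as [P1 P2]. split.
- replace 0 with (minus (sin (INR n * (2 * PI)) / INR n) (sin (INR n * 0) / INR n)) at 2.
  + apply (is_RInt_derive (V:=R_CompleteNormedModule) (fun t => sin (INR n * t) / INR n)).
    * intros t _. auto_derive; [lra|]. field; lra.
    * intros t _; apply continuous_cos_n.
  + rewrite P2, Rmult_0_r, sin_0. unfold minus, plus, opp; simpl; field; lra.
- replace 0 with (minus (- cos (INR n * (2 * PI)) / INR n) (- cos (INR n * 0) / INR n)) at 2.
  + apply (is_RInt_derive (V:=R_CompleteNormedModule) (fun t => - cos (INR n * t) / INR n)).
    * intros t _. auto_derive; [lra|]. field; lra.
    * intros t _; apply continuous_sin_n.
  + rewrite P1, Rmult_0_r, cos_0. unfold minus, plus, opp; simpl; field; lra.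
Qed.

(** At [s = 0] the boundary values are constant, and only the first term of the expansion of the
    kernel survives. *)
Lemma cauchy_formula :
  u x y = / (2 * PI) * RInt (fun t => kernel_re x y t * u (cos t) (sin t)
     + kernel_im x y t * v (cos t) (sin t)) 0 (2 * PI).
Proof.
pose proof PI_RGT_0.
transitivity (/ (2 * PI) * RInt (g 1) 0 (2 * PI)).
2:{ f_equal; apply RInt_ext; intros t _; unfold g, U, V, seg; as_real_eq.
    do 2 f_equal; f_equal; ring. }
rewrite <- homotopy_ends.
assert (E : is_series (fun n => fst (cpow x y n) * fourier_re (fun _ => u x y) (fun _ => v x y) n
   + snd (cpow x y n) * fourier_im (fun _ => u x y) (fun _ => v x y) n)
   (/ (2 * PI) * RInt (g 0) 0 (2 * PI))).
{ replace (RInt (g 0) 0 (2 * PI)) with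
    (RInt (fun t => kernel_re x y t * u x y + kernel_im x y t * v x y) 0 (2 * PI)).
  - apply (cauchy_kernel_expansion _ _ (Rmax (Rabs (u x y)) (Rabs (v x y)))); trivial;
      intros; try apply continuous_const. split; [apply Rmax_l | apply Rmax_r].
  - apply RInt_ext; intros t _; unfold g, U, V, seg; as_real_eq.
    do 2 f_equal; f_equal; ring. }
apply is_series_unique in E. rewrite <- E. clear E. symmetry; apply is_series_unique.
apply (is_series_decr_1 (V:=R_NormedModule)).
assert (F0 : fourier_re (fun _ => u x y) (fun _ => v x y) 0 = u x y).
{ unfold fourier_re; simpl.
  transitivity (/ (2 * PI) * RInt (fun _ => u x y) 0 (2 * PI)).
  - f_equal; apply RInt_ext; intros t _; as_real_eq. rewrite !Rmult_0_l, cos_0, sin_0; ring.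
  - rewrite RInt_const. unfold scal; simpl; unfold mult; simpl. as_real_eq. field; lra. }
assert (Fn : forall n, (0 < n)%nat -> fourier_re (fun _ => u x y) (fun _ => v x y) n = 0
   /\ fourier_im (fun _ => u x y) (fun _ => v x y) n = 0).
{ intros n Hn. destruct (trig_integrals n Hn) as [I1 I2].
  assert (X1 : ex_RInt (V:=R_NormedModule) (fun t => cos (INR n * t)) 0 (2 * PI)) by (eexists; eassumption).
  assert (X2 : ex_RInt (V:=R_NormedModule) (fun t => sin (INR n * t)) 0 (2 * PI)) by (eexists; eassumption).
  apply (is_RInt_unique (V:=R_CompleteNormedModule)) in I1; apply (is_RInt_unique (V:=R_CompleteNormedModule)) in I2.
  unfold fourier_re, fourier_im; split.
  - transitivity (/ (2 * PI) * RInt (fun t => u x y * cos (INR n * t) + - v x y * sin (INR n * t)) 0 (2 * PI)).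
    + f_equal; apply RInt_ext; intros t _; as_real_eq; ring.
    + rewrite RInt_combination by trivial. rewrite I1, I2; as_real_eq; ring.
  - transitivity (/ (2 * PI) * RInt (fun t => v x y * cos (INR n * t) + u x y * sin (INR n * t)) 0 (2 * PI)).
    + f_equal; apply RInt_ext; intros t _; as_real_eq; ring.
    + rewrite RInt_combination by trivial. rewrite I1, I2; as_real_eq; ring. }
rewrite F0.
replace (plus _ _) with 0.
2:{ unfold plus, opp; simpl; ring. }
apply (is_series_ext (fun _ => 0)).
{ intros n. destruct (Fn (S n)) as [-> ->]; [lia|]. as_real_eq; ring. }
apply (filterlim_ext (fun _ => 0)); [|apply filterlim_const].
intros n; rewrite sum_n_const; as_real_eq; ring.
Qed.
End Homotopy.

(** Cauchy's formula with the kernel expanded. *)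
Lemma conjugate_pair_expansion R0 u v a b : 1 < R0 -> conjugate_pair R0 u v a b ->
  exists M, (forall n, Rabs (fourier_re (fun t => u (cos t) (sin t)) (fun t => v (cos t) (sin t)) n) <= M) /\
  forall x y, x * x + y * y < 1 ->
  is_series (fun n =>
     fst (cpow x y n) * fourier_re (fun t => u (cos t) (sin t)) (fun t => v (cos t) (sin t)) n
   + snd (cpow x y n) * fourier_im (fun t => u (cos t) (sin t)) (fun t => v (cos t) (sin t)) n)
   (u x y).
Proof.
intros HR Huv. pose proof PI_RGT_0.
assert (C : forall t, continuous (fun t => u (cos t) (sin t)) t /\
   continuous (fun t => v (cos t) (sin t)) t).
{ intros t.
  destruct (UV_continuous_t R0 u v a b 0 0 HR Huv ltac:(lra) 1 t (good_unit _ HR 1 ltac:(lra)))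
   as [K1 K2].
  split; [revert K1 | revert K2]; apply continuous_ext; intros s; unfold seg; f_equal; ring. }
assert (B : forall f, (forall t, continuous (fun t => f (cos t) (sin t)) t) ->
   exists M, forall t, 0 <= t <= 2 * PI -> Rabs (f (cos t) (sin t)) <= M).
{ intros f Hf.
  destruct (continuity_ab_maj (fun t => Rabs (f (cos t) (sin t))) 0 (2 * PI)) as (m & Hm & _).
  - lra.
  - intros c _. apply continuity_pt_filterlim.
    apply (continuous_comp (fun t => f (cos t) (sin t)) Rabs); [apply Hf|].
    apply continuous_Rabs.
  - exists (Rabs (f (cos m) (sin m))). exact Hm. }
destruct (B u) as [M1 HM1]; [apply C|]. destruct (B v) as [M2 HM2]; [apply C|].
set (M := Rmax M1 M2).
assert (HM : forall t, 0 <= t <= 2 * PI -> Rabs (u (cos t) (sin t)) <= M /\ Rabs (v (cos t) (sin t)) <= M).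
{ intros t Ht; specialize (HM1 t Ht); specialize (HM2 t Ht).
  assert (M1 <= M) by apply Rmax_l; assert (M2 <= M) by apply Rmax_r; lra. }
exists (2 * M). split.
- intros n. unfold fourier_re.
  match goal with |- Rabs (_ * RInt ?F _ _) <= _ =>
    assert (ID := abs_RInt_le_const F 0 (2 * PI) (2 * M) ltac:(lra)) end.
  rewrite Rabs_mult, (Rabs_pos_eq (/ _)) by (left; apply Rinv_0_lt_compat; lra).
  apply Rmult_le_reg_l with (2 * PI); [lra|].
  rewrite <- Rmult_assoc, Rinv_r, Rmult_1_l by lra.
  rewrite Rminus_0_r in ID; apply ID.
  + apply ex_RInt_of_continuous; intros t; apply continuous_sub; apply continuous_mul;
      try apply C; auto using continuous_cos_n, continuous_sin_n.
  + intros t Ht. unfold Rminus. eapply Rle_trans; [apply Rabs_triang|].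
    rewrite Rabs_Ropp, !Rabs_mult. destruct (HM t Ht) as [A1 A2].
    assert (Rabs (cos (INR n * t)) <= 1) by (apply Rabs_le, COS_bound).
    assert (Rabs (sin (INR n * t)) <= 1) by (apply Rabs_le, SIN_bound).
    pose proof (Rabs_pos (u (cos t) (sin t))). pose proof (Rabs_pos (v (cos t) (sin t))).
    pose proof (Rabs_pos (cos (INR n * t))). pose proof (Rabs_pos (sin (INR n * t))). nra.
- intros x y Hxy. rewrite (cauchy_formula R0 u v a b x y) by trivial.
  apply (cauchy_kernel_expansion _ _ M); trivial; intros; apply C.
Qed.

(** * Slice regular functions have power series expansions *)

Notation quat_module := (prod_NormedModule R_AbsRing
  (prod_NormedModule R_AbsRing R_NormedModule R_NormedModule)
  (prod_NormedModule R_AbsRing R_NormedModule R_NormedModule)).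

(** Every real-linear functional has this form; precomposing it with the multiplication by [I]
    replaces [w] by [w I]. *)
Definition functional (w q : quat) : R := re (w * q)%quat.

Lemma is_derive_fst {U V : NormedModule R_AbsRing} (F : R -> prod_NormedModule R_AbsRing U V) x l :
  is_derive F x l -> is_derive (fun t => fst (F t)) x (fst l).
Proof.
intros H. exact (filterdiff_comp' F (fst : prod_NormedModule R_AbsRing U V -> U) x _ _ H
  (filterdiff_linear _ (is_linear_fst (K:=R_AbsRing)))).
Qed.

Lemma is_derive_snd {U V : NormedModule R_AbsRing} (F : R -> prod_NormedModule R_AbsRing U V) x l :
  is_derive F x l -> is_derive (fun t => snd (F t)) x (snd l).
Proof.
intros H. exact (filterdiff_comp' F (snd : prod_NormedModule R_AbsRing U V -> V) x _ _ H
  (filterdiff_linear _ (is_linear_snd (K:=R_AbsRing)))).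
Qed.

Lemma is_derive_components (F : R -> quat) x l : is_derive (F : R -> quat_module) x l ->
  is_derive (fun t => re (F t)) x (re l) /\ is_derive (fun t => im_i (F t)) x (im_i l) /\
  is_derive (fun t => im_j (F t)) x (im_j l) /\ is_derive (fun t => im_k (F t)) x (im_k l).
Proof.
intros H; assert (H1 := is_derive_fst _ _ _ H); assert (H2 := is_derive_snd _ _ _ H).
split; [|split; [|split]].
- exact (is_derive_fst _ _ _ H1).
- exact (is_derive_snd _ _ _ H1).
- exact (is_derive_fst _ _ _ H2).
- exact (is_derive_snd _ _ _ H2).
Qed.

Lemma functional_components w q : functional w q =
  re w * re q + - im_i w * im_i q + - im_j w * im_j q + - im_k w * im_k q.
Proof. unfold functional, qmul, mkq, re, im_i, im_j, im_k; simpl; ring. Qed.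

Lemma is_derive_functional (F : R -> quat) x l w : is_derive (F : R -> quat_module) x l ->
  is_derive (fun t => functional w (F t)) x (functional w l).
Proof.
intros H; destruct (is_derive_components F x l H) as (H1 & H2 & H3 & H4).
eapply is_derive_ext; [intros t; symmetry; apply functional_components|].
rewrite functional_components.
repeat apply (is_derive_plus (V:=R_NormedModule)); now apply is_derive_scal.
Qed.

Lemma continuous_functional (F : R * R -> quat) z w : continuous (F : R * R -> quat_module) z ->
  continuous (fun t => functional w (F t)) z.
Proof.
intros H.
assert (H1 : continuous (fun t => fst (F t) : R * R) z)
  by (apply (continuous_comp F fst); [exact H | apply continuous_fst]).
assert (H2 : continuous (fun t => snd (F t) : R * R) z)
  by (apply (continuous_comp F snd); [exact H | apply continuous_snd]).
apply (continuous_ext (fun t =>  re w * re (F t) + - im_i w * im_i (F t)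
  + - im_j w * im_j (F t) + - im_k w * im_k (F t)));
  [intros t; symmetry; apply functional_components|].
assert (Hc : forall (g : R * R -> R) c, continuous g z -> continuous (fun t => c * g t) z).
{ intros g c Hg; apply (continuous_mult (K:=R_AbsRing)); [apply continuous_const | exact Hg]. }
assert (Hp : forall g1 g2 : R * R -> R, continuous g1 z -> continuous g2 z ->
  continuous (fun t => g1 t + g2 t) z)
  by (intros; now apply (continuous_plus (V:=R_NormedModule))).
apply Hp; [apply Hp; [apply Hp|]|]; apply Hc; unfold re, im_i, im_j, im_k.
- apply (continuous_comp (fun t => fst (F t)) fst); [exact H1 | apply continuous_fst].
- apply (continuous_comp (fun t => fst (F t)) snd); [exact H1 | apply continuous_snd].
- apply (continuous_comp (fun t => snd (F t)) fst); [exact H2 | apply continuous_fst].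
- apply (continuous_comp (fun t => snd (F t)) snd); [exact H2 | apply continuous_snd].
Qed.

Lemma imag_unit_components I : imag_unit I -> re I = 0 /\ sqnorm I = 1.
Proof.
destruct I as [[a b] [c d]]; unfold imag_unit, qmul, qreal, mkq, sqnorm, re, im_i, im_j, im_k; simpl.
intros H; injection H; intros H4 H3 H2 H1.
assert (a * b = 0) by lra. assert (a * c = 0) by lra. assert (a * d = 0) by lra.
assert (a = 0).
{ destruct (Req_dec a 0) as [|Ha]; trivial. exfalso.
  assert (b = 0) by nra. assert (c = 0) by nra. assert (d = 0) by nra. subst; nra. }
subst; split; lra.
Qed.

Lemma slice_pt_mul I x y x' y' : imag_unit I ->
  (slice_pt I x y * slice_pt I x' y' = slice_pt I (x * x' - y * y') (x * y' + y * x'))%quat.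
Proof.
unfold imag_unit, slice_pt; intros H.
transitivity (qreal (x * x') + qreal (y * y') * (I * I) + qreal (x * y' + y * x') * I)%quat.
- quat_ring.
- rewrite H. quat_ring.
Qed.

Lemma slice_pt_pow I x y n : imag_unit I ->
  (slice_pt I x y ^ n)%quat = slice_pt I (fst (cpow x y n)) (snd (cpow x y n)).
Proof.
intros H; induction n as [|n IH]; simpl; [unfold slice_pt; quat_ring|].
now rewrite IH, slice_pt_mul.
Qed.

Lemma sqnorm_slice_pt I x y : imag_unit I -> sqnorm (slice_pt I x y) = x * x + y * y.
Proof.
intros H; destruct (imag_unit_components I H) as [H1 H2].
transitivity (x * x + 2 * x * y * re I + y * y * sqnorm I);
  [unfold slice_pt; clear; quat_ring|].
rewrite H1, H2; ring.
Qed.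

Lemma ball1_sqnorm q : ball1 q <-> sqnorm q < 1.
Proof.
unfold ball1; rewrite <- qmod_sqr; pose proof (qmod_pos q); split; intros; nra.
Qed.

Lemma ball1_slice_pt I x y : imag_unit I -> (ball1 (slice_pt I x y) <-> x * x + y * y < 1).
Proof. intros H; rewrite ball1_sqnorm, sqnorm_slice_pt; tauto. Qed.

Lemma slice_decomposition q : exists I x y, imag_unit I /\ q = slice_pt I x y.
Proof.
destruct q as [[a b] [c d]].
set (m := sqrt (b * b + c * c + d * d)).
assert (Hm : m * m = b * b + c * c + d * d) by (apply sqrt_sqrt; nra).
destruct (Req_dec m 0) as [E|E].
- assert (b = 0 /\ c = 0 /\ d = 0) as (-> & -> & ->) by (rewrite E in Hm; repeat split; nra).
  exists (mkq 0 1 0 0), a, 0; split; [unfold imag_unit|unfold slice_pt]; quat_ring.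
- exists (mkq 0 (b / m) (c / m) (d / m)), a, m; split.
  + unfold imag_unit, qmul, qreal, mkq, re, im_i, im_j, im_k; simpl.
    assert (b / m * (b / m) + c / m * (c / m) + d / m * (d / m) = 1).
    { transitivity ((b * b + c * c + d * d) / (m * m)); [field; trivial|]. rewrite <- Hm; now field. }
    repeat (apply (f_equal2 (@pair _ _))); nra || ring.
  + unfold slice_pt, qadd, qmul, qreal, mkq, re, im_i, im_j, im_k; simpl.
    repeat (apply (f_equal2 (@pair _ _))); field; trivial.
Qed.

(** On a slice [f_y = I f_x], so that the functionals of [w] and [w I] form a conjugate pair.  The
    rescaling by [rho] provides a disc larger than the unit disc. *)
Lemma slice_conjugate_pair f I rho : slice_regular f -> imag_unit I -> 0 < rho < 1 ->
  forall w, exists a b, conjugate_pair (/ rho)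
    (fun x y => functional w (f (slice_pt I (rho * x) (rho * y))))
    (fun x y => functional (w * I) (f (slice_pt I (rho * x) (rho * y)))) a b.
Proof.
intros Hf HI Hr w. destruct (Hf I HI) as (fx & fy & H).
exists (fun x y => rho * functional w (fx (rho * x, rho * y))),
  (fun x y => rho * functional w (fy (rho * x, rho * y))).
intros x y Hxy.
assert (Hd : ball1 (slice_pt I (rho * x) (rho * y))).
{ apply ball1_slice_pt; trivial.
  replace (rho * x * (rho * x) + rho * y * (rho * y)) with (rho * rho * (x * x + y * y)) by ring.
  apply Rlt_le_trans with (rho * rho * (/ rho * / rho)).
  - apply Rmult_lt_compat_l; nra.
  - right; field; lra. }
destruct (H _ _ Hd) as (D1 & D2 & C1 & C2 & E).
assert (Efy : fy (rho * x, rho * y) = qmul I (fx (rho * x, rho * y))).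
{ set (P := fx _) in *; set (Q := fy _) in *.
  assert (E' : (P + I * Q = q0)%quat).
  { apply (qmul_cancel_l (qreal (1 / 2))).
    - intros K; apply (f_equal re) in K; unfold re in K; simpl in K; lra.
    - rewrite E; symmetry; apply qmul_0_r. }
  assert (E'' : (I * (P + I * Q) = q0)%quat) by (rewrite E'; apply qmul_0_r).
  rewrite qmul_add_r, qmul_assoc, HI in E''.
  symmetry; apply qsub_eq0; rewrite <- E''. generalize (I * P)%quat, Q; quat_ring. }
assert (EI : qmul I (fy (rho * x, rho * y)) = qopp (fx (rho * x, rho * y))).
{ rewrite Efy, qmul_assoc, HI. generalize (fx (rho * x, rho * y)); quat_ring. }
assert (K1 : forall w q, functional (w * I) q = functional w (I * q)%quat)
  by (intros; unfold functional; now rewrite qmul_assoc).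
assert (Hcomp1 : forall w l, is_derive (fun t => f (slice_pt I t (rho * y)) : quat_module) (rho * x) l ->
  is_derive (fun t => functional w (f (slice_pt I (rho * t) (rho * y)))) x (rho * functional w l)).
{ intros w' l Hl.
  apply (is_derive_comp (fun s => functional w' (f (slice_pt I s (rho * y)))) (fun t => rho * t)).
  - now apply (is_derive_functional (fun s => f (slice_pt I s (rho * y)))).
  - auto_derive; trivial; ring. }
assert (Hcomp2 : forall w l, is_derive (fun t => f (slice_pt I (rho * x) t) : quat_module) (rho * y) l ->
  is_derive (fun t => functional w (f (slice_pt I (rho * x) (rho * t)))) y (rho * functional w l)).
{ intros w' l Hl.
  apply (is_derive_comp (fun s => functional w' (f (slice_pt I (rho * x) s))) (fun t => rho * t)).
  - now apply (is_derive_functional (fun s => f (slice_pt I (rho * x) s))).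
  - auto_derive; trivial; ring. }
assert (Hcont : forall F, continuous (F : R * R -> quat_module) (rho * x, rho * y) ->
  continuity_2d_pt (fun x y => rho * functional w (F (rho * x, rho * y))) x y).
{ intros F HF. apply continuity_2d_pt_mult; [apply continuity_2d_pt_const|].
  apply (continuity_2d_pt_comp (fun s t => functional w (F (s, t)))).
  - apply continuity_2d_pt_filterlim.
    apply (continuous_ext (fun z => functional w (F z))); [now intros [? ?]|].
    now apply continuous_functional.
  - apply continuity_2d_pt_mult; [apply continuity_2d_pt_const | apply continuity_2d_pt_id1].
  - apply continuity_2d_pt_mult; [apply continuity_2d_pt_const | apply continuity_2d_pt_id2]. }
split; [now apply Hcomp1|]. split; [now apply Hcomp2|].
split; [|split; [|split; [now apply Hcont | now apply Hcont]]].
- rewrite Efy, <- K1. now apply Hcomp1.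
- replace (- (rho * functional w (fx (rho * x, rho * y))))
    with (rho * functional (w * I) (fy (rho * x, rho * y))).
  + now apply Hcomp2.
  + rewrite K1, EI. rewrite !functional_components.
    unfold qopp, mkq, re, im_i, im_j, im_k; simpl; ring.
Qed.

Definition slice_fourier (f : quat -> quat) (I : quat) (rho : R) (w : quat) (n : nat) : R :=
  fourier_re (fun t => functional w (f (slice_pt I (rho * cos t) (rho * sin t))))
    (fun t => functional (w * I) (f (slice_pt I (rho * cos t) (rho * sin t)))) n.

Lemma slice_functional_expansion f I rho : slice_regular f -> imag_unit I -> 0 < rho < 1 ->
  forall w, (exists M, forall n, Rabs (slice_fourier f I rho w n) <= M) /\
  forall x y, x * x + y * y < 1 ->
  is_series (fun n => fst (cpow x y n) * slice_fourier f I rho w n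
    + snd (cpow x y n) * slice_fourier f I rho (w * I) n)
    (functional w (f (slice_pt I (rho * x) (rho * y)))).
Proof.
intros Hf HI Hr w.
destruct (slice_conjugate_pair f I rho Hf HI Hr w) as (a & b & Hp).
assert (H1 : 1 < / rho) by (rewrite <- Rinv_1; apply Rinv_lt_contravar; lra).
destruct (conjugate_pair_expansion _ _ _ _ _ H1 Hp) as (M & HM & Hs).
split; [exists M; exact HM|]. intros x y Hxy.
eapply is_series_ext; [|exact (Hs x y Hxy)]. intros n; cbv beta.
unfold slice_fourier. as_real_eq. do 2 f_equal.
unfold fourier_re, fourier_im; f_equal; apply RInt_ext; intros t _.
set (q := f _). as_real_eq.
replace (functional (w * I * I) q) with (- functional w q); [ring|].
unfold functional. rewrite <- (qmul_assoc w I I), HI.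
destruct w as [[? ?] [? ?]], q as [[? ?] [? ?]];
  unfold qmul, qreal, mkq, re, im_i, im_j, im_k; simpl; ring.
Qed.

(** The functionals of [w], [- i w], [- j w] and [- k w] are the components of [w f]. *)
Definition slice_coef (f : quat -> quat) (I : quat) (rho : R) (w : quat) : ser := fun n =>
  mkq (slice_fourier f I rho w n) (slice_fourier f I rho (mkq 0 (-1) 0 0 * w) n)
    (slice_fourier f I rho (mkq 0 0 (-1) 0 * w) n) (slice_fourier f I rho (mkq 0 0 0 (-1) * w) n).

Lemma cpow_real x n : cpow x 0 n = (x ^ n, 0).
Proof. induction n as [|n IH]; simpl; trivial. rewrite IH; simpl; f_equal; ring. Qed.

Lemma sqr_lt_1 x : Rabs x < 1 -> x * x + 0 * 0 < 1.
Proof.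
intros Hx; apply Rabs_def2 in Hx; destruct Hx as [H1 H2].
pose proof (Rmult_lt_0_compat (1 - x) (1 + x) ltac:(lra) ltac:(lra)). lra.
Qed.

(** The functionals for [1] and [I] give series [A] and [B] such that [f] is the sum of the
    [X_n A_n + Y_n B_n], where [X_n + Y_n I] is the power of [x + y I].  As [B = I A] on the real axis,
    this is the sum of the [(X_n + Y_n I) A_n]. *)
Lemma slice_scaled_expansion f I rho : slice_regular f -> imag_unit I -> 0 < rho < 1 ->
  exists A, ball_series A /\ forall x y, x * x + y * y < 1 ->
    f (slice_pt I (rho * x) (rho * y)) = power_series A (slice_pt I x y).
Proof.
intros Hf HI Hr.
assert (E := slice_functional_expansion f I rho Hf HI Hr).
assert (Hb : forall w, ball_series (slice_coef f I rho w)).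
{ intros w.
  destruct (E w) as [[M1 H1] _], (E (mkq 0 (-1) 0 0 * w)%quat) as [[M2 H2] _],
    (E (mkq 0 0 (-1) 0 * w)%quat) as [[M3 H3] _], (E (mkq 0 0 0 (-1) * w)%quat) as [[M4 H4] _].
  apply ball_series_bounded with (M1 + M2 + M3 + M4); intros n.
  eapply Rle_trans; [apply qmod_le_components|].
  specialize (H1 n); specialize (H2 n); specialize (H3 n); specialize (H4 n).
  unfold slice_coef. revert H1 H2 H3 H4.
  generalize (slice_fourier f I rho w n), (slice_fourier f I rho (mkq 0 (-1) 0 0 * w) n),
    (slice_fourier f I rho (mkq 0 0 (-1) 0 * w) n), (slice_fourier f I rho (mkq 0 0 0 (-1) * w) n).
  unfold mkq, re, im_i, im_j, im_k; simpl; intros; lra. }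
set (A := slice_coef f I rho q1). set (B := slice_coef f I rho I).
assert (Hfun : forall w q, (w * q)%quat = mkq (functional w q)
   (functional (mkq 0 (-1) 0 0 * w) q) (functional (mkq 0 0 (-1) 0 * w) q)
   (functional (mkq 0 0 0 (-1) * w) q)).
{ intros [[? ?] [? ?]] [[? ?] [? ?]];
  unfold functional, qmul, mkq, re, im_i, im_j, im_k; simpl;
  repeat (apply (f_equal2 (@pair _ _))); ring. }
assert (Hs : forall x y, x * x + y * y < 1 ->
  is_series (fun n => (qreal (fst (cpow x y n)) * A n + qreal (snd (cpow x y n)) * B n)%quat)
    (f (slice_pt I (rho * x) (rho * y)))).
{ intros x y Hxy. rewrite <- (qmul_1_l (f _)), (Hfun q1).
  apply is_series_quat; repeat split;
  (eapply is_series_ext; [|apply (proj2 (E _) x y Hxy)]);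
  intros n; unfold A, B, slice_coef; rewrite ?qmul_1_r, <- ?qmul_assoc, ?qmul_1_l;
  unfold qadd, qmul, qreal, mkq, re, im_i, im_j, im_k; simpl; ring. }
assert (HAx : forall x, Rabs x < 1 -> f (slice_pt I (rho * x) (rho * 0)) = power_series A (qreal x)).
{ intros x Hx. symmetry; apply is_series_quat_unique.
  eapply is_series_ext; [|apply (Hs x 0)].
  - intros n; cbv beta. rewrite cpow_real, qpow_real; simpl. generalize (A n), (B n); quat_ring.
  - now apply sqr_lt_1. }
assert (HBx : forall x, Rabs x < 1 ->
  (I * f (slice_pt I (rho * x) (rho * 0)))%quat = power_series B (qreal x)).
{ intros x Hx. symmetry; apply is_series_quat_unique.
  rewrite Hfun.
  assert (Hxy : x * x + 0 * 0 < 1) by now apply sqr_lt_1.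
  apply is_series_quat; repeat split;
  (eapply is_series_ext; [|apply (proj2 (E _) x 0 Hxy)]);
  intros n; cbv beta; rewrite cpow_real, qpow_real; unfold B, slice_coef;
  unfold qadd, qmul, qreal, mkq, re, im_i, im_j, im_k; simpl; as_real_eq; ring. }
assert (HBA : B = (sc I * A)%ser).
{ apply ser_sub_eq0, power_series_real_zero.
  - apply ball_series_sub; [apply Hb|]. apply ball_series_mul; [apply ball_series_sc | apply Hb].
  - intros x Hx. assert (Hx1 : Rabs x < 1) by (rewrite Rabs_pos_eq; lra).
    assert (ball1 (qreal x)) by now apply ball1_real.
    rewrite power_series_sub; trivial; [|apply Hb | apply ball_series_mul; [apply ball_series_sc | apply Hb]].
    rewrite (power_series_mul (sc I) A _ (qreal x)), power_series_sc, <- HBx, <- HAx;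
      trivial using ball_series_sc; [apply qsub_diag | apply Hb |].
    rewrite power_series_sc by trivial. apply qreal_comm. }
exists A; split; [apply Hb|]. intros x y Hxy.
rewrite <- (is_series_quat_unique _ _ (Hs x y Hxy)). unfold power_series. f_equal.
apply functional_extensionality; intros n.
rewrite slice_pt_pow, HBA, smul_sc_l by trivial. unfold slice_pt.
rewrite qmul_assoc, <- qmul_add_l. reflexivity.
Qed.

Lemma slice_pt_scale I r x y : (qreal r * slice_pt I x y)%quat = slice_pt I (r * x) (r * y).
Proof. unfold slice_pt; quat_ring. Qed.

Lemma slice_pt_real I x : slice_pt I x 0 = qreal x.
Proof. unfold slice_pt; quat_ring. Qed.

Lemma imag_unit_i : imag_unit (mkq 0 1 0 0).
Proof. unfold imag_unit; quat_ring. Qed.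

Lemma scale_mul_scale x y u v :
  (qreal x * u * (qreal y * v) = qreal (x * y) * (u * v))%quat.
Proof. quat_ring. Qed.

(** The expansions on different slices agree since they agree on the real axis. *)
Lemma scaled_expansion f rho : slice_regular f -> 0 < rho < 1 ->
  exists A, ball_series A /\ forall q, ball1 q -> f (qreal rho * q)%quat = power_series A q.
Proof.
intros Hf Hr.
destruct (slice_scaled_expansion f _ rho Hf imag_unit_i Hr) as (A & HA & EA).
exists A; split; trivial. intros q Hq.
destruct (slice_decomposition q) as (I & x & y & HI & ->).
apply ball1_slice_pt in Hq; trivial.
destruct (slice_scaled_expansion f _ rho Hf HI Hr) as (B & HB & EB).
rewrite slice_pt_scale, EB by trivial. f_equal.
apply ser_sub_eq0, power_series_real_zero; [now apply ball_series_sub|].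
intros s Hs. assert (Hs1 : Rabs s < 1) by (rewrite Rabs_pos_eq; lra).
assert (Hs2 : ball1 (qreal s)) by now apply ball1_real.
rewrite power_series_sub by trivial.
assert (E1 := EA s 0 (sqr_lt_1 s Hs1)). assert (E2 := EB s 0 (sqr_lt_1 s Hs1)).
rewrite Rmult_0_r, !slice_pt_real in E1, E2. rewrite <- E1, <- E2. apply qsub_diag.
Qed.

(** The expansions on the balls of radius [rho < 1], rescaled, agree on a real segment. *)
Theorem slice_regular_has_expansion f : slice_regular f -> exists a, has_expansion f a.
Proof.
intros Hf.
destruct (scaled_expansion f (/ 2) Hf ltac:(lra)) as (A & HA & EA).
set (a := (fun n => qreal (2 ^ n) * A n)%quat : ser).
assert (Hfit : forall rho, 0 < rho < 1 ->
  exists B, ball_series B /\ (forall q, ball1 q -> f (qreal rho * q)%quat = power_series B q) /\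
  forall n, B n = (qreal (rho ^ n) * a n)%quat).
{ intros rho Hr. destruct (scaled_expansion f rho Hf Hr) as (B & HB & EB).
  exists B; split; [trivial|]; split; [trivial|].
  set (m := Rmin (/ 2) rho).
  assert (Hm : 0 < m) by (unfold m; apply Rmin_glb_lt; lra).
  assert (Hm1 : m <= / 2) by apply Rmin_l. assert (Hm2 : m <= rho) by apply Rmin_r.
  set (s := (2 * m) : R). set (t := m / rho).
  assert (Hs : 0 < s <= 1) by (unfold s; lra).
  assert (Ht : 0 < t <= 1).
  { unfold t; split; [apply Rdiv_lt_0_compat; lra|]. apply Rmult_le_reg_r with rho; [lra|].
    unfold Rdiv; rewrite Rmult_assoc, Rinv_l; lra. }
  assert (Hscale : forall (d : ser) r, ball_series d -> 0 < r <= 1 ->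
    ball_series (fun n => qreal (r ^ n) * d n)%quat /\
    forall x, Rabs x < 1 -> power_series (fun n => qreal (r ^ n) * d n)%quat (qreal x)
      = power_series d (qreal (r * x))).
  { intros d r Hd Hr'. split.
    - apply (ball_series_of_le d); trivial. intros n. rewrite qmod_mul, qmod_real.
      assert (0 <= r ^ n <= 1).
      { split; [apply pow_le; lra|]. rewrite <- (pow1 n). apply pow_incr; lra. }
      rewrite Rabs_pos_eq by lra. pose proof (qmod_pos (d n)); nra.
    - intros x Hx. unfold power_series; f_equal.
      apply functional_extensionality; intros n. rewrite !qpow_real.
      rewrite qmul_assoc, <- qreal_mul, Rpow_mult_distr. do 2 f_equal; ring. }
  destruct (Hscale A s HA Hs) as [SA1 SA2], (Hscale B t HB Ht) as [SB1 SB2].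
  assert (E : (fun n => qreal (s ^ n) * A n)%quat = (fun n => qreal (t ^ n) * B n)%quat :> ser).
  { apply ser_sub_eq0, power_series_real_zero; [now apply ball_series_sub|].
    intros x Hx. assert (Hx1 : Rabs x < 1) by (rewrite Rabs_pos_eq; lra).
    assert (Hx2 : ball1 (qreal x)) by now apply ball1_real.
    rewrite power_series_sub, SA2, SB2 by trivial.
    rewrite <- EA, <- EB.
    - rewrite <- !qreal_mul. replace (/ 2 * (s * x)) with (rho * (t * x)); [apply qsub_diag|].
      unfold s, t; field; lra.
    - apply ball1_real. rewrite Rabs_pos_eq; nra.
    - apply ball1_real. rewrite Rabs_pos_eq; nra. }
  intros n. assert (En := f_equal (fun d => d n) E); simpl in En.
  assert (t ^ n <> 0) by (apply pow_nonzero; lra).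
  apply (qmul_cancel_l (qreal (t ^ n))).
  { intros K; apply (f_equal re) in K; unfold re in K; simpl in K; lra. }
  rewrite <- En. unfold a. rewrite !qmul_assoc, <- !qreal_mul. do 2 f_equal.
  rewrite <- !Rpow_mult_distr. f_equal. unfold s, t; field; lra. }
exists a. apply has_expansion_intro.
- intros rho Hr. destruct (Hfit ((1 + rho) / 2)) as (B & HB & _ & E); [lra|].
  destruct (HB (rho / ((1 + rho) / 2))) as [C HC].
  { split; [apply Rdiv_lt_0_compat; lra|]. apply ratio_bound; lra. }
  exists C; intros n. eapply Rle_trans; [|apply (HC n)].
  rewrite E, qmod_mul, qmod_real, Rabs_pos_eq by (apply pow_le; lra).
  right. unfold Rdiv at 2. rewrite Rpow_mult_distr, pow_inv. field. apply pow_nonzero; lra.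
- intros q Hq. destruct (radius_between q Hq) as (rho & Hr & Hqr).
  destruct (Hfit rho Hr) as (B & HB & EB & E).
  replace q with (qreal rho * (qreal (/ rho) * q))%quat at 1.
  + rewrite EB.
    * unfold power_series; f_equal; apply functional_extensionality; intros n.
      rewrite E. replace ((qreal (/ rho) * q) ^ n)%quat with (qreal (/ rho ^ n) * q ^ n)%quat.
      -- rewrite scale_mul_scale, Rinv_l, qmul_1_l; trivial. apply pow_nonzero; lra.
      -- rewrite <- pow_inv. clear; induction n as [|n IH]; simpl; [quat_ring|].
         rewrite <- IH, qreal_mul. generalize (qreal_comm ((/ rho) ^ n) q).
         intros K. rewrite <- !qmul_assoc, (qmul_assoc (qreal ((/ rho) ^ n))), K. now rewrite !qmul_assoc.
    * unfold ball1; rewrite qmod_mul, qmod_real, Rabs_pos_eq by (left; apply Rinv_0_lt_compat; lra).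
      rewrite Rmult_comm; apply ratio_bound; trivial; [apply qmod_pos | lra].
  + rewrite qmul_assoc, <- qreal_mul, Rinv_r by lra. apply qmul_1_l.
Qed.

(** * Power series are slice regular *)

Definition sderiv (a : ser) : ser := fun n => (qreal (INR (S n)) * a (S n))%quat.

Lemma INR_geom_bound x n : 0 <= x < 1 -> INR (S n) * x ^ n <= / (1 - x).
Proof.
intros Hx. apply Rle_trans with (2 := geom_sum_le x n Hx).
rewrite <- (sum_n_const n (x ^ n)). apply sum_n_le_loc. intros k Hk.
replace n with (k + (n - k))%nat by lia. rewrite pow_add.
rewrite <- (Rmult_1_r (x ^ k)) at 2. apply Rmult_le_compat_l; [apply pow_le; lra|].
rewrite <- (pow1 (n - k)). apply pow_incr; lra.
Qed.

Lemma ball_series_sderiv a : ball_series a -> ball_series (sderiv a).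
Proof.
intros Ha rho Hr. destruct (ball_series_stl a Ha ((1 + rho) / 2)) as [C HC]; [lra|].
assert (0 <= C) by (apply (growth_nonneg (stl a) ((1 + rho) / 2)); trivial; lra).
set (r := (1 + rho) / 2) in *. assert (Hr' : 0 < r < 1) by (unfold r; lra).
assert (Hx : 0 <= rho / r < 1) by (apply ratio_bound; unfold r; lra).
exists (C * / (1 - rho / r)); intros n. unfold sderiv.
rewrite qmod_mul, qmod_real, Rabs_pos_eq by apply pos_INR.
pose proof (growth_term (stl a) r C (qreal rho) n (proj1 Hr') HC) as G.
rewrite qmod_mul, qmod_pow, qmod_real, Rabs_pos_eq in G by lra.
pose proof (INR_geom_bound _ n Hx) as B.
apply Rle_trans with (C * (INR (S n) * (rho / r) ^ n)); [|now apply Rmult_le_compat_l].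
replace (INR (S n) * qmod (a (S n)) * rho ^ n) with (INR (S n) * (rho ^ n * qmod (stl a n)))
  by (unfold stl; ring).
replace (C * (INR (S n) * (rho / r) ^ n)) with (INR (S n) * (C * (rho / r) ^ n)) by ring.
apply Rmult_le_compat_l; trivial. apply pos_INR.
Qed.

(** Induction on [n], as for complex numbers, since [z] and [w] commute.  The factor [rho] on the
    left avoids the exponent [n - 1]. *)
Lemma qpow_taylor rho z w n : 0 < rho -> (z * w = w * z)%quat ->
  qmod z <= rho -> qmod w <= rho ->
  rho * qmod (w ^ S n - z ^ S n - qreal (INR (S n)) * ((w - z) * z ^ n))
    <= INR (S n) * INR (S n) * (qmod (w - z) * qmod (w - z)) * rho ^ n.
Proof.
intros Hr Hzw Hz Hw.
assert (Hpow : forall n, qmod (z ^ n) <= rho ^ n).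
{ intros m; rewrite qmod_pow. apply pow_incr; split; [apply qmod_pos | trivial]. }
set (h := qmod (w - z)). assert (0 <= h) by apply qmod_pos.
induction n as [|n IH].
- simpl (INR 1). match goal with |- _ * qmod ?d <= _ => replace d with q0 end.
  + rewrite qmod_0; simpl; nra.
  + simpl. clear; quat_ring.
- set (D := (w ^ S n - z ^ S n - qreal (INR (S n)) * ((w - z) * z ^ n))%quat) in *.
  assert (E : (w ^ S (S n) - z ^ S (S n) - qreal (INR (S (S n))) * ((w - z) * z ^ S n) =
    w * D + qreal (INR (S n)) * ((w - z) * (w - z) * z ^ n))%quat).
  { unfold D. rewrite (S_INR (S n)), qreal_add. change (qreal 1) with q1.
    assert (Hc : (w * (qreal (INR (S n)) * ((w - z) * z ^ n)) =
       qreal (INR (S n)) * (w * ((w - z) * z ^ n)))%quat).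
    { rewrite !qmul_assoc. now rewrite (qreal_comm _ w). }
    change (w ^ S (S n))%quat with (w * w ^ S n)%quat.
    change (z ^ S (S n))%quat with (z * z ^ S n)%quat.
    transitivity (w * w ^ S n - w * z ^ S n - w * (qreal (INR (S n)) * ((w - z) * z ^ n))
       + qreal (INR (S n)) * ((w - z) * (w - z) * z ^ n))%quat; [|non_commutative_ring].
    rewrite Hc.
    change (z ^ S n)%quat with (z * z ^ n)%quat.
    transitivity (w * w ^ S n - z * (z * z ^ n)
      - (w * z - z * z) * z ^ n
      - qreal (INR (S n)) * ((w * z - z * z) * z ^ n))%quat; [non_commutative_ring|].
    transitivity (w * w ^ S n - w * (z * z ^ n)
      - qreal (INR (S n)) * ((w * z - z * z) * z ^ n)
      + qreal (INR (S n)) * ((w * z - z * w) * z ^ n))%quat; [|non_commutative_ring].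
    rewrite Hzw, qsub_diag. non_commutative_ring. }
  rewrite E. clear E.
  eapply Rle_trans; [apply Rmult_le_compat_l; [lra|apply qmod_triangle]|].
  rewrite !qmod_mul, qmod_real, Rabs_pos_eq by apply pos_INR. fold h.
  specialize (Hpow n). pose proof (qmod_pos D). pose proof (qmod_pos w).
  assert (0 <= rho ^ n) by (apply pow_le; lra).
  rewrite (S_INR (S n)). set (N := INR (S n)) in *. assert (0 <= N) by apply pos_INR.
  simpl (rho ^ S n).
  assert (T1 : rho * (qmod w * qmod D) <= rho * (N * N * (h * h) * rho ^ n)).
  { replace (rho * (qmod w * qmod D)) with (qmod w * (rho * qmod D)) by ring.
    apply Rmult_le_compat; trivial; nra. }
  assert (T2 : N * (h * h * qmod (z ^ n)) <= N * (h * h * rho ^ n)).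
  { apply Rmult_le_compat_l; trivial. apply Rmult_le_compat_l; trivial. nra. }
  assert (0 <= h * h * (rho * rho ^ n)) by (apply Rmult_le_pos; nra).
  assert (0 <= N * (h * h * (rho * rho ^ n))) by (apply Rmult_le_pos; trivial).
  apply (Rmult_le_compat_l rho) in T2; [|lra].
  rewrite Rmult_plus_distr_l.
  replace ((N + 1) * (N + 1) * (h * h) * (rho * rho ^ n)) with
    (rho * (N * N * (h * h) * rho ^ n) + rho * (N * (h * h * rho ^ n))
     + N * (h * h * (rho * rho ^ n)) + h * h * (rho * rho ^ n)) by ring.
  lra.
Qed.

Lemma qmod_series_le_sums (u : nat -> quat) (l : quat) (m : R) :
  is_series u l -> (forall n, sum_n (fun k => qmod (u k)) n <= m) -> qmod l <= m.
Proof.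
intros Hu Hm.
assert (Hn : is_lim_seq (fun n => qmod (sum_n u n)) (qmod l)).
{ rewrite <- quat_norm.
  apply (filterlim_ext (fun n => norm (sum_n u n : quat_module))).
  { intros n; apply quat_norm. }
  apply (filterlim_comp _ _ _ (sum_n u) _ _ _ _ Hu).
  apply (filterlim_norm (V := quat_module)). }
apply (is_lim_seq_le _ _ (qmod l) m) with (2 := Hn) (3 := is_lim_seq_const m).
intros n; eapply Rle_trans; [apply qmod_sum_le | apply Hm].
Qed.

Lemma power_series_taylor a rho : ball_series a -> 0 < rho < 1 ->
  exists K, 0 <= K /\ forall z w, (z * w = w * z)%quat -> qmod z <= rho -> qmod w <= rho ->
  qmod (power_series a w - power_series a z - (w - z) * power_series (sderiv a) z)
    <= K * (qmod (w - z) * qmod (w - z)).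
Proof.
intros Ha Hr.
set (d2 := (fun n => qreal (INR (S n)) * sderiv a n)%quat : ser).
assert (H2 : ball_series d2).
{ replace d2 with (sderiv (sX * sderiv a)%ser).
  - apply ball_series_sderiv, ball_series_mul; [apply ball_series_sX | now apply ball_series_sderiv].
  - apply functional_extensionality; intros n; unfold d2, sderiv at 1; now rewrite sX_mul_S. }
destruct (ball_series_sum_bound d2 rho H2 Hr) as (A & HA0 & HA).
exists (A / rho); split; [apply Rdiv_le_0_compat; lra|].
intros z w Hzw Hz Hw.
assert (Bz : ball1 z) by (unfold ball1; lra). assert (Bw : ball1 w) by (unfold ball1; lra).
set (h := qmod (w - z)). assert (0 <= h) by apply qmod_pos.
assert (Sa := ball_series_stl a Ha). assert (Sd := ball_series_sderiv a Ha).
assert (S1 := is_series_qmul_l _ _ w (is_series_power_series (stl a) w Sa Bw)).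
assert (S2 := is_series_qmul_l _ _ z (is_series_power_series (stl a) z Sa Bz)).
assert (S3 := is_series_qmul_l _ _ (w - z)%quat (is_series_power_series (sderiv a) z Sd Bz)).
assert (Ss := is_series_minus (V:=quat_module) _ _ _ _ (is_series_minus (V:=quat_module) _ _ _ _ S1 S2) S3).
replace (power_series a w - power_series a z - (w - z) * power_series (sderiv a) z)%quat
  with (w * power_series (stl a) w - z * power_series (stl a) z
    - (w - z) * power_series (sderiv a) z)%quat.
2:{ rewrite (power_series_head a w), (power_series_head a z) by trivial.
    non_commutative_ring. }
apply (qmod_series_le_sums _ _ _ Ss).
intros n. replace (A / rho * (h * h)) with (h * h / rho * A) by (unfold Rdiv; ring).
apply Rle_trans with (h * h / rho * sum_n (fun k => qmod (d2 k) * rho ^ k) n).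
2:{ apply Rmult_le_compat_l; trivial. apply Rdiv_le_0_compat; nra. }
rewrite <- sum_n_scal_R. apply sum_n_le_loc; intros k _; cbv beta.
change (qmod (w * (w ^ k * stl a k) - z * (z ^ k * stl a k) - (w - z) * (z ^ k * sderiv a k))
   <= h * h / rho * (qmod (d2 k) * rho ^ k)).
replace (w * (w ^ k * stl a k) - z * (z ^ k * stl a k) - (w - z) * (z ^ k * sderiv a k))%quat
  with ((w ^ S k - z ^ S k - qreal (INR (S k)) * ((w - z) * z ^ k)) * a (S k))%quat.
2:{ unfold sderiv, stl. change (w ^ S k)%quat with (w * w ^ k)%quat.
    change (z ^ S k)%quat with (z * z ^ k)%quat.
    rewrite (qreal_comm _ (a (S k))), (qreal_comm _ ((w - z) * z ^ k)%quat).
    rewrite <- (qreal_comm _ (a (S k))). non_commutative_ring. }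
pose proof (qpow_taylor rho z w k (proj1 Hr) Hzw Hz Hw) as T. fold h in T.
unfold d2, sderiv. rewrite !qmod_mul, qmod_real, Rabs_pos_eq by apply pos_INR.
set (N := INR (S k)) in *. set (D := qmod _) in *. set (ak := qmod (a (S k))).
assert (0 <= ak) by apply qmod_pos.
apply Rmult_le_reg_l with rho; [lra|].
replace (rho * (h * h / rho * (N * (N * ak) * rho ^ k)))
  with (N * N * (h * h) * rho ^ k * ak) by (field; lra).
rewrite <- Rmult_assoc. now apply Rmult_le_compat_r.
Qed.

Lemma scal_qreal (k : R) (l : quat) : scal k (l : quat_module) = (qreal k * l)%quat.
Proof.
destruct l as [[? ?] [? ?]]; unfold scal; simpl; unfold prod_scal, scal; simpl;
  unfold prod_scal, scal; simpl; unfold mult; simpl.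
unfold qmul, qreal, mkq, re, im_i, im_j, im_k; simpl.
repeat (apply (f_equal2 (@pair _ _))); ring.
Qed.

Lemma is_derive_of_quadratic_error (F : R -> quat) x l K delta : 0 < delta -> 0 <= K ->
  (forall t, Rabs (t - x) < delta ->
     qmod (F t - F x - qreal (t - x) * l) <= K * ((t - x) * (t - x))) ->
  is_derive (F : R -> quat_module) x l.
Proof.
intros Hd HK H; split; [apply is_linear_scal_l|].
intros y Hy. apply (is_filter_lim_locally_unique (V:=R_NormedModule)) in Hy; subst y.
intros e.
assert (He : 0 < Rmin delta (e / (K + 1))).
{ apply Rmin_glb_lt; trivial. apply Rdiv_lt_0_compat; [apply cond_pos | lra]. }
exists (mkposreal _ He); intros t Ht. change (Rabs (t - x) < Rmin delta (e / (K + 1))) in Ht.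
assert (H1 : Rabs (t - x) < delta) by (eapply Rlt_le_trans; [exact Ht | apply Rmin_l]).
assert (H2 : Rabs (t - x) < e / (K + 1)) by (eapply Rlt_le_trans; [exact Ht | apply Rmin_r]).
specialize (H t H1).
match goal with |- norm ?d <= _ => replace (norm d) with
  (qmod (F t - F x - qreal (t - x) * l)) end.
2:{ rewrite <- quat_norm. apply f_equal. rewrite <- scal_qreal. reflexivity. }
eapply Rle_trans; [exact H|].
change (norm (minus t x)) with (Rabs (t - x)).
replace ((t - x) * (t - x)) with (Rabs (t - x) * Rabs (t - x))
  by (unfold Rabs; destruct Rcase_abs; ring).
rewrite <- Rmult_assoc. apply Rmult_le_compat_r; [apply Rabs_pos|].
apply Rlt_le. apply Rle_lt_trans with ((K + 1) * Rabs (t - x)).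
- apply Rmult_le_compat_r; [apply Rabs_pos | lra].
- replace (pos e) with ((K + 1) * (e / (K + 1))) by (field; lra).
  apply Rmult_lt_compat_l; lra.
Qed.

Lemma quat_ball_of_qmod (x y : quat) (e : R) : qmod (y - x) < e -> ball (x : quat_module) e y.
Proof.
intros H. destruct (component_le (y - x)%quat) as (H1 & H2 & H3 & H4).
destruct x as [[? ?] [? ?]], y as [[? ?] [? ?]].
unfold qsub, qadd, qopp, mkq, re, im_i, im_j, im_k in *; simpl in *.
unfold ball; simpl; unfold prod_ball; simpl; unfold ball; simpl; unfold prod_ball; simpl.
unfold ball; simpl; unfold AbsRing_ball, minus, plus, opp, abs; simpl.
repeat split; lra.
Qed.

Lemma slice_pt_comm I x y x' y' : imag_unit I ->
  (slice_pt I x y * slice_pt I x' y' = slice_pt I x' y' * slice_pt I x y)%quat.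
Proof. intros H; rewrite !slice_pt_mul by trivial; f_equal; ring. Qed.

Lemma slice_pt_sub I x y x' y' :
  (slice_pt I x y - slice_pt I x' y')%quat = slice_pt I (x - x') (y - y').
Proof. unfold slice_pt; quat_ring. Qed.

Lemma qmod_slice_pt_le I x y : imag_unit I -> qmod (slice_pt I x y) <= Rabs x + Rabs y.
Proof.
intros H; rewrite qmod_sqrt, sqnorm_slice_pt by trivial.
pose proof (Rabs_pos x); pose proof (Rabs_pos y).
rewrite <- (sqrt_Rsqr (Rabs x + Rabs y)) by lra. apply sqrt_le_1_alt. unfold Rsqr.
assert (E : forall t, t * t = Rabs t * Rabs t) by (intros t; unfold Rabs; destruct Rcase_abs; ring).
rewrite (E x), (E y). nra.
Qed.

Lemma power_series_lipschitz_bound a rho z : ball_series a -> 0 < rho < 1 -> qmod z <= rho ->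
  exists L, 0 <= L /\ forall w, (z * w = w * z)%quat -> qmod w <= rho ->
  qmod (power_series a w - power_series a z) <= L * qmod (w - z).
Proof.
intros Ha Hr Hz. destruct (power_series_taylor a rho Ha Hr) as (K & HK & H).
exists (K * (2 * rho) + qmod (power_series (sderiv a) z)).
assert (H0 := qmod_pos (power_series (sderiv a) z)). split; [nra|].
intros w Hzw Hw. specialize (H z w Hzw Hz Hw).
set (d := power_series (sderiv a) z) in *.
set (e := (power_series a w - power_series a z)%quat) in *.
replace e with (e - (w - z) * d + (w - z) * d)%quat by non_commutative_ring.
eapply Rle_trans; [apply qmod_triangle|]. rewrite qmod_mul.
assert (qmod (w - z) <= 2 * rho) by (pose proof (qmod_triangle_sub w z); lra).
pose proof (qmod_pos (w - z)%quat).
assert (K * (qmod (w - z) * qmod (w - z)) <= K * (2 * rho * qmod (w - z))).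
{ apply Rmult_le_compat_l; trivial. now apply Rmult_le_compat_r. }
lra.
Qed.

Lemma continuous_of_lipschitz (G : R * R -> quat) x y L delta : 0 < delta -> 0 <= L ->
  (forall x' y', Rabs (x' - x) + Rabs (y' - y) < delta ->
    qmod (G (x', y') - G (x, y)) <= L * (Rabs (x' - x) + Rabs (y' - y))) ->
  continuous (G : R * R -> quat_module) (x, y).
Proof.
intros Hd HL H. apply (filterlim_locally (U := quat_module)). intros e.
set (r := Rmin delta (e / (L + 1))).
assert (Hr1 : r <= delta) by apply Rmin_l.
assert (Hr2 : r <= e / (L + 1)) by apply Rmin_r.
assert (Hr : 0 < r / 2).
{ assert (0 < r); [|lra]. unfold r; apply Rmin_glb_lt; trivial.
  apply Rdiv_lt_0_compat; [apply cond_pos | lra]. }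
exists (mkposreal _ Hr). intros [x' y'] [H1 H2].
change (Rabs (x' - x) < r / 2) in H1. change (Rabs (y' - y) < r / 2) in H2.
apply quat_ball_of_qmod.
eapply Rle_lt_trans; [apply H; lra|].
apply Rle_lt_trans with ((L + 1) * (Rabs (x' - x) + Rabs (y' - y))).
- apply Rmult_le_compat_r; [|lra]. pose proof (Rabs_pos (x' - x)); pose proof (Rabs_pos (y' - y)); lra.
- replace (pos e) with ((L + 1) * (e / (L + 1))) by (field; lra).
  apply Rmult_lt_compat_l; lra.
Qed.

(** Points of one slice commute, so that the series has a derivative along the slice; the partial
    derivatives are this derivative and [I] times it. *)
Theorem slice_regular_of_expansion f a : has_expansion f a -> slice_regular f.
Proof.
intros Hf I HI. assert (Ha := has_expansion_ball_series _ _ Hf).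
set (F := fun z : R * R => power_series (sderiv a) (slice_pt I (fst z) (snd z))).
exists F, (fun z => (I * F z)%quat). intros x y Hxy.
set (z := slice_pt I x y) in *.
destruct (radius_between z Hxy) as (rho & Hr & Hzr).
assert (Hgap : 0 < rho - qmod z) by lra.
(* nearby points of the slice stay in the ball of radius rho *)
assert (Hnear : forall x' y', Rabs (x' - x) + Rabs (y' - y) < rho - qmod z ->
  qmod (slice_pt I x' y') <= rho).
{ intros x' y' H. replace (slice_pt I x' y') with (z + slice_pt I (x' - x) (y' - y))%quat.
  - eapply Rle_trans; [apply qmod_triangle|].
    pose proof (qmod_slice_pt_le I (x' - x) (y' - y) HI). lra.
  - unfold z, slice_pt; quat_ring. }
assert (Hball : forall w, qmod w <= rho -> ball1 w) by (unfold ball1; intros; lra).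
destruct (power_series_taylor a rho Ha Hr) as (K & HK & HT).
assert (HI1 : qmod I = 1).
{ destruct (imag_unit_components I HI) as [_ E]; rewrite qmod_sqrt, E; apply sqrt_1. }
assert (HF : exists L, 0 <= L /\ forall x' y', Rabs (x' - x) + Rabs (y' - y) < rho - qmod z ->
  qmod (F (x', y') - F (x, y)) <= L * (Rabs (x' - x) + Rabs (y' - y))).
{ destruct (power_series_lipschitz_bound (sderiv a) rho z (ball_series_sderiv a Ha) Hr
    (Rlt_le _ _ Hzr)) as (L & HL & HLip).
  exists L; split; trivial. intros x' y' H.
  eapply Rle_trans; [apply (HLip _ (slice_pt_comm I x y x' y' HI) (Hnear _ _ H))|].
  apply Rmult_le_compat_l; trivial. unfold z; rewrite slice_pt_sub. now apply qmod_slice_pt_le. }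
destruct HF as (L & HL & HF).
split; [|split; [|split; [|split]]].
- apply (is_derive_of_quadratic_error _ x _ K (rho - qmod z)); trivial.
  intros t Ht.
  assert (Hw : qmod (slice_pt I t y) <= rho).
  { apply Hnear. rewrite Rminus_diag, Rabs_R0. lra. }
  rewrite (has_expansion_eq f a (slice_pt I t y)), (has_expansion_eq f a (slice_pt I x y)); auto.
  specialize (HT z (slice_pt I t y) (slice_pt_comm I x y t y HI) (Rlt_le _ _ Hzr) Hw).
  unfold z in HT. rewrite slice_pt_sub, Rminus_diag, slice_pt_real in HT.
  eapply Rle_trans; [exact HT|]. rewrite qmod_sqr, sqnorm_real. lra.
- apply (is_derive_of_quadratic_error _ y _ K (rho - qmod z)); trivial.
  intros t Ht.
  assert (Hw : qmod (slice_pt I x t) <= rho).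
  { apply Hnear. rewrite Rminus_diag, Rabs_R0. lra. }
  rewrite (has_expansion_eq f a (slice_pt I x t)), (has_expansion_eq f a (slice_pt I x y)); auto.
  specialize (HT z (slice_pt I x t) (slice_pt_comm I x y x t HI) (Rlt_le _ _ Hzr) Hw).
  unfold z in HT. rewrite slice_pt_sub, Rminus_diag in HT.
  replace (slice_pt I 0 (t - y)) with (qreal (t - y) * I)%quat in HT by (unfold slice_pt; quat_ring).
  rewrite qmul_assoc. eapply Rle_trans; [exact HT|].
  rewrite qmod_mul, HI1, Rmult_1_r, qmod_sqr, sqnorm_real. lra.
- exact (continuous_of_lipschitz F x y L _ Hgap HL HF).
- apply (continuous_of_lipschitz (fun z => I * F z)%quat x y L _ Hgap HL).
  intros x' y' H. replace (I * F (x', y') - I * F (x, y))%quat with (I * (F (x', y') - F (x, y)))%quat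
    by non_commutative_ring.
  rewrite qmod_mul, HI1, Rmult_1_l. now apply HF.
- unfold F; simpl. set (d := power_series _ _).
  rewrite qmul_assoc, HI. replace (d + qreal (-1) * d)%quat with q0; [apply qmul_0_r|].
  generalize d; quat_ring.
Qed.

(** * Contractive multipliers *)

Definition sum_sq (x : ser) (N : nat) : R := sum_n (fun n => sqnorm (x n)) N.

(** Left multiplication by [a] contracts l^2.  Partial sums suffice, since the coefficients up to
    [N] of a product depend only on those of the factors. *)
Definition contractive (a : ser) : Prop := forall x N, sum_sq (a * x)%ser N <= sum_sq x N.

Definition im_sq (q : quat) : R := im_i q * im_i q + im_j q * im_j q + im_k q * im_k q.
Definition im_dot (p q : quat) : R := im_i p * im_i q + im_j p * im_j q + im_k p * im_k q.

Lemma im_dot_le p q : im_dot p q * im_dot p q <= im_sq p * im_sq q.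
Proof.
unfold im_dot, im_sq. generalize (im_i p), (im_j p), (im_k p), (im_i q), (im_j q), (im_k q).
intros a b c x y z.
pose proof (Rle_0_sqr (a * y - b * x)); pose proof (Rle_0_sqr (a * z - c * x));
pose proof (Rle_0_sqr (b * z - c * y)); unfold Rsqr in *. lra.
Qed.

Lemma im_sq_pos q : 0 <= im_sq q.
Proof.
unfold im_sq; pose proof (Rle_0_sqr (im_i q)); pose proof (Rle_0_sqr (im_j q));
pose proof (Rle_0_sqr (im_k q)); unfold Rsqr in *; lra.
Qed.

Lemma im_sq_le q : im_sq q <= sqnorm q.
Proof. unfold im_sq, sqnorm; pose proof (Rle_0_sqr (re q)); unfold Rsqr in *; lra. Qed.

Lemma sqnorm_add_imag_mul J al be : re J = 0 -> sqnorm (al + J * be) =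
  sqnorm al + sqnorm J * sqnorm be - 2 * im_dot J (be * qconj al).
Proof.
destruct J as [[j0 ?] [? ?]], al as [[? ?] [? ?]], be as [[? ?] [? ?]].
unfold im_dot, sqnorm, qadd, qmul, qconj, mkq, re, im_i, im_j, im_k; simpl; intros ->; ring.
Qed.

Lemma im_dot_mkq a b c d q : im_dot (mkq a b c d) q = b * im_i q + c * im_j q + d * im_k q.
Proof. reflexivity. Qed.

(** The square norm is an affine function of [J], maximal in the direction of its linear part.  The
    maximum is the squared norm of the left multiplication by the complexified quaternion [al + i be]. *)
Lemma sphere_maximum al be : exists J, imag_unit J /\
  sqnorm (al + J * be) = sqnorm al + sqnorm be + 2 * sqrt (im_sq (qconj al * be)).
Proof.
set (d := (be * qconj al)%quat).
assert (Hd : im_sq d = im_sq (qconj al * be)).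
{ unfold d, im_sq. destruct al as [[? ?] [? ?]], be as [[? ?] [? ?]].
  unfold qmul, qconj, mkq, re, im_i, im_j, im_k; simpl; ring. }
rewrite <- Hd. set (m := sqrt (im_sq d)).
assert (Hm : m * m = im_sq d) by (apply sqrt_sqrt, im_sq_pos).
assert (HJ : forall J, re J = 0 -> sqnorm (al + J * be) =
  sqnorm al + sqnorm J * sqnorm be - 2 * im_dot J d).
{ intros J; apply sqnorm_add_imag_mul. }
destruct (Req_dec m 0) as [E|E].
- exists (mkq 0 1 0 0); split; [apply imag_unit_i|]. rewrite HJ by reflexivity.
  rewrite E in Hm. rewrite E. unfold im_sq in Hm.
  rewrite im_dot_mkq.
  replace (sqnorm (mkq 0 1 0 0)) with 1 by (clear; quat_ring).
  assert (im_i d = 0); [|lra].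
  pose proof (Rle_0_sqr (im_i d)); pose proof (Rle_0_sqr (im_j d));
  pose proof (Rle_0_sqr (im_k d)); unfold Rsqr in *. nra.
- set (J := mkq 0 (- im_i d / m) (- im_j d / m) (- im_k d / m)).
  assert (HJ1 : sqnorm J = 1).
  { assert (S : forall a b c, sqnorm (mkq 0 a b c) = a * a + b * b + c * c) by (clear; quat_ring).
    unfold J; rewrite S.
    transitivity (im_sq d / (m * m)); [unfold im_sq; field; trivial | rewrite <- Hm; field; trivial]. }
  exists J; split.
  + unfold imag_unit. replace (qreal (-1)) with (qreal (- sqnorm J)) by (rewrite HJ1; reflexivity).
    unfold J; generalize (- im_i d / m), (- im_j d / m), (- im_k d / m); quat_ring.
  + rewrite HJ, HJ1 by reflexivity.
    assert (Hdot : im_dot J d = - m); [|rewrite Hdot; ring].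
    transitivity (- (im_sq d / m)); [|rewrite <- Hm; field; trivial].
    transitivity (- im_i d / m * im_i d + - im_j d / m * im_j d + - im_k d / m * im_k d).
    * reflexivity.
    * unfold im_sq; field; trivial.
Qed.

(** The product is that of [al + i be] and [A + i B], where [i] is central; [sphere_maximum] gives the
    norm of the first factor. *)
Lemma complexified_norm_bound al be A B K :
  (forall J, imag_unit J -> sqnorm (al + J * be) <= K) ->
  sqnorm (al * A - be * B) + sqnorm (al * B + be * A) <= K * (sqnorm A + sqnorm B).
Proof.
intros H. destruct (sphere_maximum al be) as (J & HJ & E). specialize (H J HJ). rewrite E in H.
set (g := (qconj al * be)%quat) in *. set (P := im_dot g (A * qconj B)).
assert (EL : sqnorm (al * A - be * B) + sqnorm (al * B + be * A) =
  (sqnorm al + sqnorm be) * (sqnorm A + sqnorm B) - 4 * P).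
{ unfold P, g, im_dot. destruct al as [[? ?] [? ?]], be as [[? ?] [? ?]],
    A as [[? ?] [? ?]], B as [[? ?] [? ?]].
  unfold sqnorm, qsub, qopp, qadd, qmul, qconj, mkq, re, im_i, im_j, im_k; simpl; ring. }
rewrite EL. clear EL.
set (m := sqrt (im_sq g)) in *.
assert (Hm0 : 0 <= m) by apply sqrt_pos.
assert (Hm : m * m = im_sq g) by (apply sqrt_sqrt, im_sq_pos).
assert (HP : P * P <= im_sq g * (sqnorm A * sqnorm B)).
{ eapply Rle_trans; [apply im_dot_le|]. apply Rmult_le_compat_l; [apply im_sq_pos|].
  eapply Rle_trans; [apply im_sq_le|]. rewrite sqnorm_mul, sqnorm_conj; lra. }
pose proof (sqnorm_pos A) as HA; pose proof (sqnorm_pos B) as HB.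
set (u := sqnorm A) in *; set (v := sqnorm B) in *.
assert (HP2 : - P <= m * ((u + v) / 2)).
{ rewrite <- Hm in HP.
  assert (m * m * (u * v) <= m * ((u + v) / 2) * (m * ((u + v) / 2))).
  { replace (m * ((u + v) / 2) * (m * ((u + v) / 2))) with (m * m * ((u + v) / 2 * ((u + v) / 2))) by ring.
    apply Rmult_le_compat_l; [nra|]. pose proof (Rle_0_sqr (u - v)); unfold Rsqr in *; lra. }
  assert (0 <= m * ((u + v) / 2)) by (apply Rmult_le_pos; lra).
  apply Rnot_lt_le; intros Hlt. nra. }
apply Rle_trans with ((sqnorm al + sqnorm be + 2 * m) * (u + v)).
- lra.
- apply Rmult_le_compat_r; lra.
Qed.

Lemma sqnorm_parallelogram I p q : imag_unit I ->
  sqnorm (p + I * q) + sqnorm (p - I * q) = 2 * (sqnorm p + sqnorm q).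
Proof.
intros HI; destruct (imag_unit_components I HI) as [_ E].
transitivity (2 * (sqnorm p + sqnorm (I * q))).
- generalize (I * q)%quat; clear; quat_ring.
- rewrite sqnorm_mul, E; ring.
Qed.

(** The real and the imaginary part of [(x + y J) ^ n] do not depend on [J]; so [al] and [be] are
    found from the values at two opposite points. *)
Lemma representation_formula a x y : ball_series a -> x * x + y * y < 1 ->
  exists al be, forall J, imag_unit J ->
    power_series a (slice_pt J x y) = (al + J * be)%quat.
Proof.
intros Ha Hxy.
set (q := slice_pt (mkq 0 1 0 0) x y).
set (qb := slice_pt (mkq 0 1 0 0) x (- y)).
assert (Hq : ball1 q) by (apply ball1_slice_pt; trivial; apply imag_unit_i).
assert (Hqb : ball1 qb) by (apply ball1_slice_pt; [apply imag_unit_i | lra]).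
assert (S1 := is_series_power_series a q Ha Hq).
assert (S2 := is_series_power_series a qb Ha Hqb).
set (al := (qreal (/ 2) * (power_series a q + power_series a qb))%quat).
set (be := (mkq 0 (- / 2) 0 0 * (power_series a q - power_series a qb))%quat).
exists al, be. intros J HJ. apply is_series_quat_unique.
assert (T1 := is_series_qmul_l _ _ (qreal (/ 2)) (is_series_plus (V:=quat_module) _ _ _ _ S1 S2)).
assert (T2 := is_series_qmul_l _ _ J (is_series_qmul_l _ _ (mkq 0 (- / 2) 0 0)
   (is_series_minus (V:=quat_module) _ _ _ _ S1 S2))).
eapply is_series_ext; [|exact (is_series_plus (V:=quat_module) _ _ _ _ T1 T2)].
intros n; cbv beta.
change (qreal (/ 2) * (q ^ n * a n + qb ^ n * a n) +
  J * (mkq 0 (- / 2) 0 0 * (q ^ n * a n - qb ^ n * a n)) = slice_pt J x y ^ n * a n)%quat.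
unfold q, qb. rewrite !slice_pt_pow by (trivial; apply imag_unit_i).
rewrite cpow_conj. simpl fst; simpl snd.
set (X := fst (cpow x y n)); set (Y := snd (cpow x y n)).
assert (E1 : forall d, (qreal (/ 2) * (slice_pt (mkq 0 1 0 0) X Y * d
  + slice_pt (mkq 0 1 0 0) X (- Y) * d) = qreal X * d)%quat).
{ clear; intros [[? ?] [? ?]]; unfold slice_pt; quat_unfold;
  repeat (apply (f_equal2 (@pair _ _))); field. }
assert (E2 : forall d, (mkq 0 (- / 2) 0 0 * (slice_pt (mkq 0 1 0 0) X Y * d
  - slice_pt (mkq 0 1 0 0) X (- Y) * d) = qreal Y * d)%quat).
{ clear; intros [[? ?] [? ?]]; unfold slice_pt; quat_unfold;
  repeat (apply (f_equal2 (@pair _ _))); field. }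
rewrite E1, E2. unfold slice_pt. rewrite qmul_add_l, (qmul_assoc J), <- (qreal_comm Y J). reflexivity.
Qed.

(** By the product formula, the values [A + J B] of [b] on the sphere are multiplied by the
    complexified quaternion [al + i be] of [a].  The mean over two opposite points produces the
    norm [|A|^2 + |B|^2] for which [complexified_norm_bound] holds. *)
Lemma product_on_sphere a b I x y K : ball_series a -> ball_series b -> imag_unit I ->
  x * x + y * y < 1 ->
  (forall J, imag_unit J -> sqnorm (power_series a (slice_pt J x y)) <= K) ->
  sqnorm (power_series (a * b)%ser (slice_pt I x y)) + sqnorm (power_series (a * b)%ser (slice_pt I x (- y)))
  <= K * (sqnorm (power_series b (slice_pt I x y)) + sqnorm (power_series b (slice_pt I x (- y)))).
Proof.
intros Ha Hb HI Hxy HK.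
destruct (representation_formula a x y Ha Hxy) as (al & be & Ea).
destruct (representation_formula b x y Hb Hxy) as (A & B & Eb).
assert (Hopp : forall J, imag_unit J -> imag_unit (qopp J)).
{ intros J HJ; unfold imag_unit in *; rewrite <- HJ; clear; quat_ring. }
assert (Hflip : forall J, slice_pt J x (- y) = slice_pt (qopp J) x y)
  by (intros; unfold slice_pt; quat_ring).
assert (Eab : forall J, imag_unit J ->
  power_series (a * b)%ser (slice_pt J x y) = ((al * A - be * B) + J * (al * B + be * A))%quat).
{ intros J HJ. set (q := slice_pt J x y). set (w := power_series a q).
  assert (Hw : w = (al + J * be)%quat) by now apply Ea.
  assert (Hq : ball1 q) by now apply ball1_slice_pt.
  assert (EJ : ((al * A - be * B) + J * (al * B + be * A) = w * A + J * (w * B))%quat).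
  { rewrite Hw. transitivity (al * A + J * J * (be * B) + J * (al * B + be * A))%quat.
    - rewrite HJ. generalize (be * B)%quat, (al * A)%quat, (J * (al * B + be * A))%quat; clear; quat_ring.
    - non_commutative_ring. }
  rewrite EJ.
  destruct (excluded_middle_informative (w = q0)) as [E|E].
  - rewrite power_series_mul_root, E by trivial. clear; quat_ring.
  - set (J' := (qinv w * J * w)%quat).
    assert (HwJ : (w * J' = J * w)%quat)
      by (unfold J'; rewrite !qmul_assoc, qmul_inv_r, qmul_1_l; trivial).
    assert (HJ' : imag_unit J').
    { unfold imag_unit. apply (qmul_cancel_l w); trivial.
      rewrite qmul_assoc, HwJ, <- qmul_assoc, HwJ, qmul_assoc, HJ. apply qreal_comm. }
    rewrite (power_series_mul a b q (slice_pt J' x y)); trivial.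
    + fold w. rewrite Eb by trivial. rewrite qmul_add_r, !qmul_assoc, HwJ. reflexivity.
    + now apply ball1_slice_pt.
    + fold w. unfold q, slice_pt. rewrite qmul_add_l, qmul_add_r, !qmul_assoc, <- !qreal_comm.
      rewrite <- !qmul_assoc, HwJ. reflexivity. }
rewrite !Hflip, !Eab, !Eb by auto.
assert (Hneg : forall u v, (u + qopp I * v = u - I * v)%quat) by (clear; quat_ring).
rewrite !Hneg, !sqnorm_parallelogram by trivial.
assert (T := complexified_norm_bound al be A B K).
enough (sqnorm (al * A - be * B) + sqnorm (al * B + be * A) <= K * (sqnorm A + sqnorm B)) by lra.
apply T. intros J HJ. rewrite <- Ea by trivial. now apply HK.
Qed.

(** After multiplication by [2 sin h], where [2 h] is the step of the angle, the sum telescopes. *)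
Lemma cos_sum_roots_of_unity N j : (0 < j <= N)%nat ->
  sum_n (fun k => cos (INR j * (2 * PI * INR k / INR (S N)))) N = 0.
Proof.
intros Hj. set (h := PI * INR j / INR (S N)).
assert (HN : 0 < INR (S N)) by (apply lt_0_INR; lia).
assert (Hj0 : 0 < INR j) by (apply lt_0_INR; lia).
assert (HjN : INR j < INR (S N)) by (apply lt_INR; lia).
pose proof PI_RGT_0.
assert (Hh : 0 < h < PI).
{ unfold h; split; [apply Rdiv_lt_0_compat; nra|].
  apply Rmult_lt_reg_r with (INR (S N)); trivial. unfold Rdiv; rewrite Rmult_assoc, Rinv_l; nra. }
assert (Hs : 0 < sin h) by (apply sin_gt_0; lra).
assert (T : forall m, 2 * sin h * sum_n (fun k => cos (INR j * (2 * PI * INR k / INR (S N)))) m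
  = sin (2 * INR m * h + h) + sin h).
{ assert (E : forall k, cos (INR j * (2 * PI * INR k / INR (S N))) = cos (2 * INR k * h)).
  { intros k; f_equal; unfold h; field; lra. }
  induction m as [|m IH].
  - rewrite sum_O, E. simpl INR. rewrite Rmult_0_r, Rmult_0_l, cos_0, Rplus_0_l; as_real_eq; ring.
  - rewrite sum_Sn. unfold plus; simpl plus. rewrite Rmult_plus_distr_l, IH, E.
    rewrite !S_INR.
    replace (2 * (INR m + 1) * h + h) with (2 * (INR m + 1) * h + h) by ring.
    replace (2 * INR m * h + h) with (2 * (INR m + 1) * h - h) by ring.
    rewrite sin_plus, sin_minus. as_real_eq; ring. }
specialize (T N).
replace (2 * INR N * h + h) with (- h + 2 * INR j * PI) in T.
2:{ unfold h; rewrite S_INR in *; field; lra. }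
rewrite sin_period, sin_neg in T.
assert (T2 : 2 * sin h * sum_n (fun k => cos (INR j * (2 * PI * INR k / INR (S N)))) N = 0) by lra.
apply Rmult_integral in T2; destruct T2 as [T2|T2]; trivial. lra.
Qed.

Lemma sum_n_add (u v : nat -> R) n : sum_n (fun k => u k + v k) n = sum_n u n + sum_n v n.
Proof. apply (sum_n_plus (G:=R_AbelianMonoid)). Qed.

Lemma sum_n_zero n : sum_n (fun _ => 0) n = 0.
Proof. rewrite sum_n_const; as_real_eq; ring. Qed.

Lemma sum_n_mono (u : nat -> R) n m : (forall k, 0 <= u k) -> (n <= m)%nat -> sum_n u n <= sum_n u m.
Proof.
intros Hu H; induction H as [|m _ IH]; [apply Rle_refl|].
rewrite sum_Sn. change (@plus R_AbelianMonoid) with Rplus. specialize (Hu (S m)); lra.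
Qed.

Lemma sum_sq_pos x N : 0 <= sum_sq x N.
Proof. rewrite <- (sum_n_zero N). apply sum_n_le_loc; intros; apply sqnorm_pos. Qed.

Lemma sum_sq_mono x N M : (N <= M)%nat -> sum_sq x N <= sum_sq x M.
Proof. apply sum_n_mono; intros k; apply sqnorm_pos. Qed.

Lemma sqnorm_le_sum_sq x n : sqnorm (x n) <= sum_sq x n.
Proof.
unfold sum_sq; destruct n as [|n]; [rewrite sum_O; apply Rle_refl|].
rewrite sum_Sn. change (@plus R_AbelianMonoid) with Rplus.
pose proof (sum_sq_pos x n) as P; unfold sum_sq in P; lra.
Qed.

Lemma sum_sq_1 n : sum_sq (sc q1) n = 1.
Proof.
unfold sum_sq; induction n as [|n IH]; [rewrite sum_O; simpl; quat_ring|].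
rewrite sum_Sn. change (@plus R_AbelianMonoid) with Rplus.
rewrite IH; simpl; clear; quat_ring.
Qed.

Lemma parseval_real (u : nat -> R) N L : (L <= N)%nat ->
  sum_n (fun k => (sum_n (fun n => cos (INR n * (2 * PI * INR k / INR (S N))) * u n) L) ^ 2
    + (sum_n (fun n => sin (INR n * (2 * PI * INR k / INR (S N))) * u n) L) ^ 2) N
  = INR (S N) * sum_n (fun n => u n ^ 2) L.
Proof.
set (th := fun k => 2 * PI * INR k / INR (S N)).
induction L as [|L IH]; intros HL.
- rewrite (sum_n_ext _ (fun _ => u O ^ 2)).
  + rewrite sum_n_const, sum_O. reflexivity.
  + intros k; rewrite !sum_O. simpl INR. rewrite !Rmult_0_l, cos_0, sin_0. as_real_eq; ring.
- set (C := fun k => sum_n (fun n => cos (INR n * th k) * u n) L) in *.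
  set (S' := fun k => sum_n (fun n => sin (INR n * th k) * u n) L) in *.
  rewrite (sum_n_ext _ (fun k => (C k ^ 2 + S' k ^ 2) + (u (S L) ^ 2 +
    2 * u (S L) * (cos (INR (S L) * th k) * C k + sin (INR (S L) * th k) * S' k)))).
  2:{ intros k. rewrite !sum_Sn.
      change ((C k + cos (INR (S L) * th k) * u (S L)) ^ 2 + (S' k + sin (INR (S L) * th k) * u (S L)) ^ 2
        = C k ^ 2 + S' k ^ 2 + (u (S L) ^ 2 + 2 * u (S L) *
          (cos (INR (S L) * th k) * C k + sin (INR (S L) * th k) * S' k))).
      pose proof (cos2_sin2 (INR (S L) * th k)) as T.
      set (c := cos (INR (S L) * th k)) in *; set (s := sin (INR (S L) * th k)) in *. as_real_eq.
      transitivity ((C k ^ 2 + S' k ^ 2) + (u (S L) ^ 2 * (c * c + s * s)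
         + 2 * u (S L) * (c * C k + s * S' k))); [ring | rewrite T; ring]. }
  assert (IH' : sum_n (fun k => C k ^ 2 + S' k ^ 2) N = INR (S N) * sum_n (fun n => u n ^ 2) L)
    by (apply IH; lia).
  rewrite sum_n_add, IH', sum_n_add, sum_n_scal_R, sum_n_const, sum_Sn.
  assert (Z : forall l, (l <= L)%nat -> sum_n (fun k => cos (INR (S L) * th k)
     * sum_n (fun n => cos (INR n * th k) * u n) l + sin (INR (S L) * th k)
     * sum_n (fun n => sin (INR n * th k) * u n) l) N = 0).
  { assert (Z1 : forall n, (n <= L)%nat -> sum_n (fun k => cos (INR (S L) * th k)
     * (cos (INR n * th k) * u n) + sin (INR (S L) * th k) * (sin (INR n * th k) * u n)) N = 0).
    { intros n Hn. rewrite (sum_n_ext _ (fun k => u n * cos (INR (S L - n) * th k))).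
      - rewrite sum_n_scal_R. unfold th. rewrite cos_sum_roots_of_unity by lia. as_real_eq; ring.
      - intros k. rewrite minus_INR by lia. rewrite Rmult_minus_distr_r, cos_minus. as_real_eq; ring. }
    induction l as [|l IHl]; intros Hl.
    - rewrite <- (Z1 O ltac:(lia)). apply sum_n_ext; intros k; now rewrite !sum_O.
    - rewrite (sum_n_ext _ (fun k => (cos (INR (S L) * th k)
       * sum_n (fun n => cos (INR n * th k) * u n) l + sin (INR (S L) * th k)
       * sum_n (fun n => sin (INR n * th k) * u n) l) + (cos (INR (S L) * th k)
     * (cos (INR (S l) * th k) * u (S l)) + sin (INR (S L) * th k) * (sin (INR (S l) * th k) * u (S l))))).
      + rewrite sum_n_add, IHl, Z1 by lia. as_real_eq; ring.
      + intros k; rewrite !sum_Sn; change (@plus R_AbelianMonoid) with Rplus. as_real_eq; ring. }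
  assert (Z' : sum_n (fun k => cos (INR (S L) * th k) * C k + sin (INR (S L) * th k) * S' k) N = 0)
    by (apply (Z L); lia).
  rewrite Z'. change (@plus R_AbelianMonoid) with Rplus. as_real_eq. ring.
Qed.

Definition trunc (M : nat) (a : ser) : ser := fun n => if Nat.leb n M then a n else q0.

Lemma trunc_le M a n : (n <= M)%nat -> trunc M a n = a n.
Proof. intros H; unfold trunc; now rewrite (proj2 (Nat.leb_le n M) H). Qed.

Lemma trunc_gt M a n : (M < n)%nat -> trunc M a n = q0.
Proof. intros H; unfold trunc. now rewrite (proj2 (Nat.leb_gt n M) H). Qed.

Lemma ball_series_trunc M a : ball_series (trunc M a).
Proof.
induction M as [|M IH].
- apply (ball_series_bounded _ (qmod (a O))). intros [|n]; unfold trunc; simpl; [lra|].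
  rewrite qmod_0; apply qmod_pos.
- destruct (IH (/ 2)) as [_ _]; [lra|].
  apply ball_series_bounded with (sum_n (fun k => qmod (a k)) (S M)). intros n.
  assert (P : forall N, 0 <= sum_n (fun k => qmod (a k)) N).
  { induction N as [|N IHN]; [rewrite sum_O; apply qmod_pos|].
    rewrite sum_Sn; apply Rplus_le_le_0_compat; trivial; apply qmod_pos. }
  destruct (le_lt_dec n (S M)) as [H|H].
  + rewrite trunc_le by trivial. revert H; generalize (S M); clear - P.
    induction n0 as [|m IHm]; intros H.
    * replace n with O by lia; rewrite sum_O; lra.
    * rewrite sum_Sn; change (@plus R_AbelianMonoid) with Rplus.
      destruct (Nat.eq_dec n (S m)) as [->|Hn].
      -- specialize (P m); lra.
      -- specialize (IHm ltac:(lia)). pose proof (qmod_pos (a (S m))). lra.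
  + rewrite trunc_gt, qmod_0 by trivial; apply P.
Qed.

Lemma smul_local a b a' b' n : (forall k, (k <= n)%nat -> a k = a' k) ->
  (forall k, (k <= n)%nat -> b k = b' k) -> (a * b)%ser n = (a' * b')%ser n.
Proof.
intros Ha Hb; unfold smul; apply sum_n_ext_loc; intros l Hl.
rewrite Ha, Hb by lia; reflexivity.
Qed.

Lemma smul_degree a b M N n : (forall k, (M < k)%nat -> a k = q0) ->
  (forall k, (N < k)%nat -> b k = q0) -> (M + N < n)%nat -> (a * b)%ser n = q0.
Proof.
intros Ha Hb Hn; unfold smul.
rewrite (sum_n_ext_loc _ (fun _ => q0)).
- clear; induction n as [|n IH]; [now rewrite sum_O|].
  rewrite sum_Sn, IH. apply qadd_0_l.
- intros l Hl; destruct (le_lt_dec l N) as [H|H].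
  + rewrite Ha by lia; apply qmul_0_l.
  + rewrite Hb by lia; apply qmul_0_r.
Qed.

Lemma power_series_finite y L q : (forall n, (L < n)%nat -> y n = q0) ->
  power_series y q = sum_n (fun n => q ^ n * y n)%quat L.
Proof.
intros Hy; apply is_series_quat_unique.
apply (filterlim_ext_loc (fun _ => sum_n (fun n => q ^ n * y n)%quat L));
  [|apply (filterlim_const (U := quat_module))].
exists L; intros n Hn. induction n as [|n IH]; [now replace L with O by lia|].
destruct (Nat.eq_dec L (S n)) as [->|E]; trivial.
rewrite sum_Sn, <- IH, Hy, qmul_0_r by lia. symmetry; apply qadd_0_r.
Qed.

(** Parseval's identity.  Sampling at [N + 1] roots of unity is exact for polynomials of degree at
    most [N]; adding the conjugate point decouples the real components of the coefficients. *)
Lemma parseval y r N L : 0 <= r < 1 -> (L <= N)%nat -> (forall n, (L < n)%nat -> y n = q0) ->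
  ball_series y ->
  sum_n (fun k => let t := 2 * PI * INR k / INR (S N) in
     sqnorm (power_series y (slice_pt (mkq 0 1 0 0) (r * cos t) (r * sin t)))
   + sqnorm (power_series y (slice_pt (mkq 0 1 0 0) (r * cos t) (- (r * sin t))))) N
  = 2 * INR (S N) * sum_n (fun n => (r ^ n) ^ 2 * sqnorm (y n)) L.
Proof.
intros Hr HL Hy Sy. set (I := mkq 0 1 0 0). assert (HI : imag_unit I) by apply imag_unit_i.
set (th := fun k => 2 * PI * INR k / INR (S N)).
set (C := fun t => sum_n (fun n => qreal (cos (INR n * t)) * (qreal (r ^ n) * y n))%quat L).
set (D := fun t => sum_n (fun n => qreal (sin (INR n * t)) * (qreal (r ^ n) * y n))%quat L).
assert (Hval : forall t, power_series y (slice_pt I (r * cos t) (r * sin t)) = (C t + I * D t)%quat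
  /\ power_series y (slice_pt I (r * cos t) (- (r * sin t))) = (C t - I * D t)%quat).
{ intros t.
  assert (Hn : forall n, cpow (r * cos t) (r * sin t) n =
    (r ^ n * cos (INR n * t), r ^ n * sin (INR n * t))).
  { intros n. replace (r * cos t) with (r * cos t - 0 * sin t) by ring.
    replace (r * sin t) with (r * sin t + 0 * cos t) by ring.
    destruct (cpow_mul r 0 (cos t) (sin t) n) as [E1 E2].
    rewrite cpow_real, cpow_angle in E1, E2; simpl in E1, E2.
    rewrite (surjective_pairing (cpow _ _ n)), E1, E2. f_equal; ring. }
  assert (Hs : forall X Y d, (slice_pt I X Y * d = qreal X * d + I * (qreal Y * d))%quat).
  { clear; intros; unfold slice_pt; rewrite qmul_add_l, (qmul_assoc I), <- (qreal_comm Y I).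
    reflexivity. }
  assert (Hr2 : forall a b d, (qreal (a * b) * d = qreal b * (qreal a * d))%quat)
    by (clear; intros; rewrite qmul_assoc, <- qreal_mul; do 2 f_equal; ring).
  assert (Ht : forall n, (slice_pt I (r * cos t) (r * sin t) ^ n * y n =
      qreal (cos (INR n * t)) * (qreal (r ^ n) * y n)
      + I * (qreal (sin (INR n * t)) * (qreal (r ^ n) * y n)))%quat /\
    (slice_pt I (r * cos t) (- (r * sin t)) ^ n * y n =
      qreal (cos (INR n * t)) * (qreal (r ^ n) * y n)
      - I * (qreal (sin (INR n * t)) * (qreal (r ^ n) * y n)))%quat).
  { intros n. rewrite !slice_pt_pow, cpow_conj, Hn, !Hs by trivial. cbn [fst snd].
    rewrite !Hr2. split; [reflexivity|].
    replace (qreal (- (r ^ n * sin (INR n * t))) * y n)%quat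
      with (qopp (qreal (sin (INR n * t)) * (qreal (r ^ n) * y n)))%quat.
    - generalize (qreal (sin (INR n * t)) * (qreal (r ^ n) * y n))%quat; clear; intros d.
      non_commutative_ring.
    - rewrite <- Hr2. generalize (r ^ n * sin (INR n * t)), (y n); clear; quat_ring. }
  rewrite !(power_series_finite y L) by trivial. unfold C, D.
  split.
  - rewrite (sum_n_ext _ _ _ (fun n => proj1 (Ht n))). clear.
    induction L as [|L IH]; [now rewrite !sum_O|].
    rewrite !sum_Sn, IH, !plus_qadd. non_commutative_ring.
  - rewrite (sum_n_ext _ _ _ (fun n => proj2 (Ht n))). clear.
    induction L as [|L IH]; [now rewrite !sum_O|].
    rewrite !sum_Sn, IH, !plus_qadd. non_commutative_ring. }
rewrite (sum_n_ext _ (fun k => 2 * (sqnorm (C (th k)) + sqnorm (D (th k))))).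
2:{ intros k; cbv zeta. fold (th k). destruct (Hval (th k)) as [-> ->].
    now apply sqnorm_parallelogram. }
rewrite sum_n_scal_R, Rmult_assoc. f_equal.
(* a component commutes with real factors, so that each one is subject to [parseval_real] *)
assert (Hc : forall (c : quat -> R), (forall p q, c (p + q)%quat = c p + c q) ->
  (forall s p, c (qreal s * p)%quat = s * c p) ->
  sum_n (fun k => c (C (th k)) ^ 2 + c (D (th k)) ^ 2) N
  = INR (S N) * sum_n (fun n => (r ^ n) ^ 2 * c (y n) ^ 2) L).
{ intros c Hadd Hscal.
  assert (Hsum : forall u l, c (sum_n u l) = sum_n (fun n => c (u n)) l).
  { intros u l; induction l as [|l IH]; [now rewrite !sum_O|].
    rewrite !sum_Sn, plus_qadd, Hadd, IH; reflexivity. }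
  rewrite (sum_n_ext (fun n => (r ^ n) ^ 2 * c (y n) ^ 2) (fun n => (r ^ n * c (y n)) ^ 2))
    by (intros n; as_real_eq; ring).
  rewrite <- (parseval_real _ N L HL). apply sum_n_ext; intros k.
  unfold C, D; rewrite !Hsum.
  f_equal; f_equal; apply sum_n_ext; intros n; rewrite !Hscal; as_real_eq; reflexivity. }
assert (H1 := Hc re ltac:(reflexivity) ltac:(intros ? [[? ?] [? ?]]; quat_unfold; ring)).
assert (H2 := Hc im_i ltac:(reflexivity) ltac:(intros ? [[? ?] [? ?]]; quat_unfold; ring)).
assert (H3 := Hc im_j ltac:(reflexivity) ltac:(intros ? [[? ?] [? ?]]; quat_unfold; ring)).
assert (H4 := Hc im_k ltac:(reflexivity) ltac:(intros ? [[? ?] [? ?]]; quat_unfold; ring)).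
transitivity (sum_n (fun k => re (C (th k)) ^ 2 + re (D (th k)) ^ 2) N
  + sum_n (fun k => im_i (C (th k)) ^ 2 + im_i (D (th k)) ^ 2) N
  + (sum_n (fun k => im_j (C (th k)) ^ 2 + im_j (D (th k)) ^ 2) N
  + sum_n (fun k => im_k (C (th k)) ^ 2 + im_k (D (th k)) ^ 2) N)).
- rewrite <- !sum_n_add. apply sum_n_ext; intros k; unfold sqnorm; as_real_eq; ring.
- rewrite H1, H2, H3, H4, <- !Rmult_plus_distr_l. f_equal. rewrite <- !sum_n_add.
  apply sum_n_ext; intros n; unfold sqnorm; as_real_eq; ring.
Qed.

Lemma trunc_approximation a r eps : ball_series a -> 0 < r < 1 -> 0 < eps ->
  forall M0, exists M, (M0 <= M)%nat /\ forall q, qmod q <= r ->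
  qmod (power_series (trunc M a) q - power_series a q) <= eps.
Proof.
intros Ha Hr He M0.
(* [r < r1 < r2 < 1]: the growth bound at [r2] makes the remainder small at [r1] *)
set (r1 := (1 + 2 * r) / 3). set (r2 := (2 + r) / 3).
destruct (Ha r2) as [C HC]; [unfold r2; lra|].
assert (HC0 : 0 <= C) by (apply (growth_nonneg a r2); trivial; unfold r2; lra).
assert (Hx : 0 <= r1 / r2 < 1) by (apply ratio_bound; unfold r1, r2; lra).
assert (Hy : 0 <= r / r1 < 1) by (apply ratio_bound; unfold r1; lra).
set (K := C * / (1 - r / r1)).
assert (HK : 0 <= K) by (apply Rmult_le_pos; trivial; left; apply Rinv_0_lt_compat; lra).
assert (Hlim : is_lim_seq (fun M => K * (r1 / r2) ^ M) (K * 0)).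
{ apply (is_lim_seq_scal_l _ K 0), is_lim_seq_geom. rewrite Rabs_pos_eq; lra. }
rewrite Rmult_0_r in Hlim.
destruct (proj1 (filterlim_locally _ _) Hlim (mkposreal eps He)) as [M1 HM1].
exists (max M0 M1); split; [lia|]. set (M := max M0 M1). intros q Hq.
specialize (HM1 M ltac:(unfold M; lia)). change (Rabs (K * (r1 / r2) ^ M - 0) < eps) in HM1.
rewrite Rminus_0_r in HM1. apply Rabs_def2 in HM1; destruct HM1 as [HM1 _].
assert (Hb : ball1 q) by (unfold ball1; lra).
assert (St := ball_series_trunc M a).
rewrite <- power_series_sub by trivial.
assert (G : forall n, qmod ((trunc M a - a)%ser n) * r1 ^ n <= C * (r1 / r2) ^ M).
{ intros n. assert (P : 0 <= (r1 / r2) ^ M) by (apply pow_le; lra).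
  unfold ssub; destruct (le_lt_dec n M) as [H|H].
  - rewrite trunc_le, qsub_diag, qmod_0, Rmult_0_l by trivial. now apply Rmult_le_pos.
  - rewrite trunc_gt by trivial.
    replace (q0 - a n)%quat with (qopp (a n)) by (generalize (a n); quat_ring).
    rewrite qmod_opp.
    pose proof (growth_term a r2 C (qreal r1) n ltac:(unfold r2; lra) HC) as T.
    rewrite qmod_mul, qmod_pow, qmod_real, Rabs_pos_eq in T by (unfold r1; lra).
    rewrite Rmult_comm. eapply Rle_trans; [exact T|]. apply Rmult_le_compat_l; trivial.
    replace n with (M + (n - M))%nat by lia. rewrite pow_add.
    rewrite <- (Rmult_1_r ((r1 / r2) ^ M)) at 2. apply Rmult_le_compat_l; trivial.
    rewrite <- (pow1 (n - M)). apply pow_incr; lra. }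
assert (Hqr : qmod q < r1) by (unfold r1; lra).
destruct (power_series_bound_aux _ r1 _ q ltac:(unfold r1; lra) Hqr G) as [_ B].
eapply Rle_trans; [exact B|]. apply Rlt_le, Rle_lt_trans with (2 := HM1).
unfold K. rewrite Rmult_assoc, (Rmult_comm ((r1 / r2) ^ M)), <- Rmult_assoc.
apply Rmult_le_compat_r; [apply pow_le; lra|]. apply Rmult_le_compat_l; trivial.
assert (qmod q / r1 <= r / r1).
{ apply Rmult_le_compat_r; trivial. left; apply Rinv_0_lt_compat; unfold r1; lra. }
apply Rinv_le_contravar; lra.
Qed.

(** Compare the quadratic means of truncations over circles of radius [r < 1], then let [r] tend
    to [1]. *)
Theorem contractive_of_bounded a : ball_series a ->
  (forall q, ball1 q -> qmod (power_series a q) <= 1) -> contractive a.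
Proof.
intros Ha Hbound x N.
assert (Sx := ball_series_trunc N x).
assert (Key : forall eta, 0 < eta < 1 ->
  sum_n (fun n => ((1 - eta) ^ n) ^ 2 * sqnorm ((a * x)%ser n)) N
    <= (1 + eta) * (1 + eta) * sum_sq x N).
{ intros eta He. set (r := 1 - eta). assert (Hr : 0 < r < 1) by (unfold r; lra).
  destruct (trunc_approximation a r eta Ha Hr (proj1 He) N) as (M & HM & HMa).
  set (a' := trunc M a). set (x' := trunc N x). set (y := (a' * x')%ser).
  assert (Sa' : ball_series a') by apply ball_series_trunc.
  set (L := (M + N)%nat).
  assert (Hy : forall n, (L < n)%nat -> y n = q0).
  { intros n Hn; apply (smul_degree a' x' M N); trivial; intros; now apply trunc_gt. }
  assert (Hx : forall n, (L < n)%nat -> x' n = q0)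
    by (intros n Hn; apply trunc_gt; unfold L in Hn; lia).
  assert (P1 := parseval y r L L ltac:(lra) ltac:(lia) Hy (ball_series_mul _ _ Sa' Sx)).
  assert (P2 := parseval x' r L L ltac:(lra) ltac:(lia) Hx Sx).
  cbv zeta in P1, P2.
  assert (HL : 0 < INR (S L)) by (apply lt_0_INR; lia).
  assert (Hle : sum_n (fun n => (r ^ n) ^ 2 * sqnorm (y n)) L
     <= (1 + eta) * (1 + eta) * sum_n (fun n => (r ^ n) ^ 2 * sqnorm (x' n)) L).
  { apply Rmult_le_reg_l with (2 * INR (S L)); [lra|].
    rewrite <- P1. rewrite <- Rmult_assoc, (Rmult_comm (2 * INR (S L))), Rmult_assoc, <- P2.
    rewrite <- sum_n_scal_R. apply sum_n_le_loc. intros k _. cbv beta.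
    set (t := 2 * PI * INR k / INR (S L)).
    assert (Hxy : r * cos t * (r * cos t) + r * sin t * (r * sin t) = r * r).
    { transitivity (r * r * (cos t * cos t + sin t * sin t)); [ring | rewrite cos2_sin2; ring]. }
    apply product_on_sphere; trivial; [apply imag_unit_i | rewrite Hxy; nra |].
    intros J HJ. set (q := slice_pt J (r * cos t) (r * sin t)).
    assert (Hq : qmod q = r).
    { unfold q; rewrite qmod_sqrt, sqnorm_slice_pt, Hxy by trivial. apply sqrt_square; lra. }
    assert (Hb : ball1 q) by (unfold ball1; lra).
    specialize (HMa q ltac:(lra)). specialize (Hbound q Hb).
    assert (Hm : qmod (power_series a' q) <= 1 + eta).
    { replace (power_series a' q) with (power_series a q + (power_series a' q - power_series a q))%quat
        by (generalize (power_series a q), (power_series a' q); clear; quat_ring).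
      eapply Rle_trans; [apply qmod_triangle|]. fold a' in HMa. lra. }
    rewrite <- qmod_sqr. pose proof (qmod_pos (power_series a' q)). nra. }
  apply Rle_trans with (sum_n (fun n => (r ^ n) ^ 2 * sqnorm (y n)) N).
  { apply Req_le. apply sum_n_ext_loc; intros n Hn. do 2 f_equal.
    apply smul_local; intros k Hk; symmetry; apply trunc_le; lia. }
  apply Rle_trans with (sum_n (fun n => (r ^ n) ^ 2 * sqnorm (y n)) L).
  { apply sum_n_mono; [|unfold L; lia]. intros n; apply Rmult_le_pos;
    [apply pow2_ge_0 | apply sqnorm_pos]. }
  eapply Rle_trans; [exact Hle|]. apply Rmult_le_compat_l; [nra|].
  (* the terms beyond N vanish *)
  assert (Hsum : forall m, sum_n (fun n => (r ^ n) ^ 2 * sqnorm (x' n)) (N + m) <= sum_sq x N).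
  { induction m as [|m IH].
    - rewrite Nat.add_0_r. apply sum_n_le_loc; intros n Hn. unfold x'; rewrite trunc_le by trivial.
      assert (0 <= r ^ n <= 1).
      { split; [apply pow_le; lra|]. rewrite <- (pow1 n). apply pow_incr; lra. }
      pose proof (sqnorm_pos (x n)). rewrite <- (Rmult_1_l (sqnorm (x n))) at 2.
      apply Rmult_le_compat_r; trivial. nra.
    - rewrite Nat.add_succ_r, sum_Sn. change (@plus R_AbelianMonoid) with Rplus.
      unfold x' at 2; rewrite trunc_gt by lia.
      replace (sqnorm q0) with 0 by (unfold q0; rewrite sqnorm_real; ring). lra. }
  unfold L; rewrite Nat.add_comm; apply Hsum. }
(* Bernoulli's inequality turns the estimate into a linear one in eta *)
set (A := sum_sq (a * x)%ser N) in *. set (X := sum_sq x N) in *.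
assert (HA : 0 <= A) by apply sum_sq_pos. assert (HX : 0 <= X) by apply sum_sq_pos.
assert (Bern : forall eta, 0 < eta < 1 -> (1 - 2 * INR N * eta) * A <= (1 + eta) * (1 + eta) * X).
{ intros eta He. eapply Rle_trans; [|apply (Key eta He)].
  unfold A, sum_sq. rewrite <- sum_n_scal_R. apply sum_n_le_loc; intros n Hn.
  apply Rmult_le_compat_r; [apply sqnorm_pos|].
  assert (B : forall m, 1 - INR m * eta <= (1 - eta) ^ m).
  { induction m as [|m IH]; [simpl; lra|]. rewrite S_INR; simpl.
    assert (0 <= INR m * (eta * eta)) by (apply Rmult_le_pos; [apply pos_INR | nra]).
    apply Rle_trans with ((1 - eta) * (1 - INR m * eta)).
    - lra.
    - apply Rmult_le_compat_l; lra. }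
  rewrite <- pow_mult. eapply Rle_trans; [|apply B]. rewrite mult_INR. simpl (INR 2).
  assert (INR n <= INR N) by now apply le_INR. nra. }
apply Rnot_lt_le; intros Hlt.
set (c := 2 * INR N * A + 3 * X + 1). assert (HN := pos_INR N).
assert (Hc : 1 <= c) by (unfold c; nra).
set (eta := Rmin (/ 2) ((A - X) / (2 * c))).
assert (E1 : eta <= / 2) by apply Rmin_l. assert (E2 : eta <= (A - X) / (2 * c)) by apply Rmin_r.
assert (E3 : 0 < eta) by (unfold eta; apply Rmin_glb_lt; [lra|]; apply Rdiv_lt_0_compat; lra).
specialize (Bern eta ltac:(lra)).
assert (E4 : eta * c <= (A - X) / 2).
{ replace ((A - X) / 2) with ((A - X) / (2 * c) * c) by (field; lra).
  apply Rmult_le_compat_r; lra. }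
assert (E5 : eta * eta * X <= eta * X) by (apply Rmult_le_compat_r; nra).
unfold c in E4. lra.
Qed.

Lemma contractive_coef_le a n : contractive a -> qmod (a n) <= 1.
Proof.
intros H. specialize (H (sc q1) n). rewrite sc_1_r, sum_sq_1 in H.
assert (H2 := sqnorm_le_sum_sq a n).
rewrite qmod_sqrt, <- sqrt_1. apply sqrt_le_1_alt. lra.
Qed.

Lemma contractive_ball_series a : contractive a -> ball_series a.
Proof. intros H; apply ball_series_bounded with 1; intros n; now apply contractive_coef_le. Qed.

(** Expand the square norm of [(a - mu) * k_w], where [k_w] is the kernel at [w].  The mixed term
    contains the value of [a * k_w] at [q], and [w] is such that this value is
    [mu / (1 - |q|^2)]. *)
Lemma contractive_defect a q w : contractive a -> ball1 q -> ball1 w -> qmod w = qmod q ->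
  let mu := power_series a q in (q * mu = mu * w)%quat ->
  forall N, sum_sq ((a - sc mu) * skern w)%ser N <= (1 - sqnorm mu) / (1 - sqnorm q).
Proof.
intros Ha Hq Hw Hwq mu Hmu N.
assert (Sa := contractive_ball_series a Ha). assert (Sk := ball_series_skern w Hw).
set (F := (a * skern w)%ser). set (G := ((a - sc mu) * skern w)%ser).
assert (SF : ball_series F) by now apply ball_series_mul.
set (s := sqnorm q). assert (Hs : 0 <= s < 1).
{ split; [apply sqnorm_pos | now apply ball1_sqnorm]. }
assert (Hsw : sqnorm w = s) by (unfold s; now rewrite <- !qmod_sqr, Hwq).
assert (Hkn : forall n, sqnorm (skern w n) = s ^ n).
{ intros n; unfold skern. rewrite <- qmod_sqr, qmod_pow, qmod_conj, <- Rpow_mult_distr, qmod_sqr.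
  now rewrite Hsw. }
assert (HFq : power_series F q = (mu * qreal (/ (1 - s)))%quat).
{ unfold F; rewrite (power_series_mul a (skern w) q w); trivial.
  now rewrite power_series_skern_at, Hsw. }
assert (Hterm : forall n, sqnorm (G n) =
  sqnorm (F n) + (sqnorm mu * s ^ n - 2 * re (qconj mu * (q ^ n * F n))%quat)).
{ intros n. replace (G n) with (F n - mu * skern w n)%quat.
  2:{ unfold G, F. replace ((a - sc mu) * skern w)%ser with (a * skern w - sc mu * skern w)%ser
        by non_commutative_ring. unfold ssub at 1; now rewrite smul_sc_l. }
  assert (E : qconj (mu * skern w n) = (qconj mu * q ^ n)%quat).
  { rewrite qconj_mul. unfold skern.
    assert (Hc : forall m, qconj (qconj w ^ m)%quat = (w ^ m)%quat).
    { induction m as [|m IH]; simpl; [apply qconj_1|].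
      now rewrite qconj_mul, IH, qconj_conj, qpow_comm. }
    rewrite Hc.
    destruct (excluded_middle_informative (mu = q0)) as [Z|Z].
    - rewrite Z, qconj_0, qmul_0_l, qmul_0_r; reflexivity.
    - apply (qmul_cancel_l mu); trivial.
      rewrite !qmul_assoc, qmul_conj_r, <- (qpow_conj_by mu q w n Hmu).
      rewrite <- qmul_assoc, qmul_conj_r. symmetry; apply qreal_comm. }
  rewrite qmul_assoc, <- E.
  replace (sqnorm mu * s ^ n) with (sqnorm (mu * skern w n)) by now rewrite sqnorm_mul, Hkn.
  generalize (F n), (mu * skern w n)%quat; clear; quat_ring. }
set (g := fun n => s ^ n + (sqnorm mu * s ^ n - 2 * re (qconj mu * (q ^ n * F n))%quat)).
assert (HG : is_series g ((1 - sqnorm mu) / (1 - s))).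
{ assert (H1 : is_series (fun n => s ^ n) (/ (1 - s)))
    by (apply is_series_geom; rewrite Rabs_pos_eq; lra).
  assert (H2 := is_series_qmul_l _ _ (qconj mu) (is_series_power_series F q SF Hq)).
  apply is_series_quat in H2; destruct H2 as [H2 _].
  assert (V : re (qconj mu * power_series F q)%quat = sqnorm mu / (1 - s)).
  { rewrite HFq, qmul_assoc, qmul_conj_l, <- qreal_mul. reflexivity. }
  rewrite V in H2.
  replace ((1 - sqnorm mu) / (1 - s)) with
    (/ (1 - s) + (sqnorm mu * / (1 - s) + - (2 * (sqnorm mu / (1 - s))))) by (field; lra).
  apply (is_series_ext (fun n => s ^ n + (sqnorm mu * s ^ n
     + - (2 * re (qconj mu * (q ^ n * F n))%quat)))).
  { intros n; unfold g; as_real_eq; ring. }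
  apply (is_series_plus (V:=R_NormedModule)); trivial.
  apply (is_series_plus (V:=R_NormedModule)).
  - now apply (is_series_scal_l (K:=R_AbsRing) (V:=R_NormedModule)).
  - apply (is_series_opp (V:=R_NormedModule)).
    now apply (is_series_scal_l (K:=R_AbsRing) (V:=R_NormedModule)). }
assert (Hle : forall m, sum_sq G m <= sum_n g m).
{ intros m. unfold sum_sq.
  rewrite (sum_n_ext _ (fun n => sqnorm (F n)
    + (sqnorm mu * s ^ n - 2 * re (qconj mu * (q ^ n * F n))%quat)) m Hterm).
  unfold g; rewrite !sum_n_add. apply Rplus_le_compat_r.
  eapply Rle_trans; [apply Ha|]. apply Req_le, sum_n_ext; exact Hkn. }
apply (is_lim_seq_le_loc (fun _ => sum_sq G N) (fun m => sum_n g m) (sum_sq G N)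
  ((1 - sqnorm mu) / (1 - s))); trivial.
- exists N; intros m Hm. apply Rle_trans with (2 := Hle m). now apply sum_sq_mono.
- apply is_lim_seq_const.
Qed.

Lemma conjugating_point a q : ball1 q -> exists w, ball1 w /\ qmod w = qmod q /\
  (q * power_series a q = power_series a q * w)%quat.
Proof.
intros Hq. destruct (excluded_middle_informative (power_series a q = q0)) as [E|E].
- exists q; rewrite E, qmul_0_l, qmul_0_r; auto.
- destruct (conjugate_point _ q E) as (w & Hw & Hwq). exists w; unfold ball1; rewrite Hwq; auto.
Qed.

(** The right-hand side of [contractive_defect] is nonnegative. *)
Lemma contractive_bound a q : contractive a -> ball1 q -> qmod (power_series a q) <= 1.
Proof.
intros Ha Hq. destruct (conjugating_point a q Hq) as (w & Hw & Hwq & E).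
assert (H := contractive_defect a q w Ha Hq Hw Hwq E O).
apply (Rle_trans _ _ _ (sum_sq_pos _ _)) in H.
assert (Hs := proj1 (ball1_sqnorm q) Hq).
assert (Hm : sqnorm (power_series a q) <= 1).
{ apply Rnot_lt_le; intros Hlt.
  assert (0 < / (1 - sqnorm q)) by (apply Rinv_0_lt_compat; lra). unfold Rdiv in H. nra. }
rewrite qmod_sqrt, <- sqrt_1. now apply sqrt_le_1_alt.
Qed.

(** The right-hand side of [contractive_defect] vanishes, hence so does [(a - mu) * k_w]. *)
Lemma contractive_maximum a q : contractive a -> ball1 q -> qmod (power_series a q) = 1 ->
  a = sc (power_series a q).
Proof.
intros Ha Hq Hmax. destruct (conjugating_point a q Hq) as (w & Hw & Hwq & E).
assert (H := contractive_defect a q w Ha Hq Hw Hwq E).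
rewrite <- qmod_sqr, Hmax in H.
assert (Z : ((a - sc (power_series a q)) * skern w)%ser = sc q0).
{ apply functional_extensionality; intros n; rewrite sc_q0. apply sqnorm_eq0.
  apply Rle_antisym; [|apply sqnorm_pos].
  eapply Rle_trans; [apply sqnorm_le_sum_sq|]. eapply Rle_trans; [apply (H n)|].
  apply Req_le; unfold Rdiv; ring. }
apply smul_integral in Z; destruct Z as [Z|Z]; [now apply ser_sub_eq0|].
exfalso. apply (f_equal (fun s => re (s O))) in Z. unfold skern, re in Z; simpl in Z; lra.
Qed.

(** * Moebius action and division for contractive series *)

(** The inverse of [a], correct up to the coefficient [n]. *)
Fixpoint inverse_prefix (a : ser) (n : nat) : ser :=
  match n with
  | O => sc (qinv (a O))
  | S m => (sc (qinv (a O)) * (sc q1 - sX * (stl a * inverse_prefix a m)))%ser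
  end.

Lemma inverse_prefix_stable a n : forall m k, (k <= n)%nat -> (k <= m)%nat ->
  inverse_prefix a n k = inverse_prefix a m k.
Proof.
assert (H0 : forall n, inverse_prefix a n O = qinv (a O)).
{ intros [|m]; simpl; trivial. rewrite smul_0; unfold ssub; rewrite sX_mul_0; simpl.
  generalize (qinv (a O)); clear; quat_ring. }
induction n as [|n IH]; intros m k Hn Hm.
- replace k with O by lia. now rewrite !H0.
- destruct m as [|m]; [replace k with O by lia; now rewrite !H0|].
  simpl. rewrite !smul_sc_l; unfold ssub. f_equal; f_equal.
  destruct k as [|k]; [now rewrite !sX_mul_0|]. rewrite !sX_mul_S.
  apply smul_local; trivial. intros l Hl; apply IH; lia.
Qed.

Lemma ser_inverse a : a O <> q0 -> exists b, (a * b = sc q1)%ser.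
Proof.
intros Ha. set (b := (fun n => inverse_prefix a n n) : ser). exists b.
assert (Hb : (b = sc (qinv (a O)) * (sc q1 - sX * (stl a * b)))%ser).
{ apply functional_extensionality; intros n. rewrite smul_sc_l; unfold ssub. destruct n as [|n].
  - rewrite sX_mul_0; unfold b; simpl. generalize (qinv (a O)); clear; quat_ring.
  - unfold b at 1. simpl inverse_prefix. rewrite smul_sc_l; unfold ssub. f_equal; f_equal.
    rewrite !sX_mul_S. apply smul_local; trivial.
    intros k Hk; unfold b; apply inverse_prefix_stable; lia. }
rewrite (ser_head_tail a), smul_add_l, <- smul_assoc. rewrite Hb at 1.
rewrite smul_assoc, <- sc_mul, qmul_inv_r, sc_1_l by trivial. non_commutative_ring.
Qed.

Lemma sqnorm_add_le t u v : 0 < t ->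
  sqnorm (u + v) <= (1 + / t) * sqnorm u + (1 + t) * sqnorm v.
Proof.
intros Ht.
assert (K : forall x y, (x + y) * (x + y) <= (1 + / t) * (x * x) + (1 + t) * (y * y)).
{ intros x y. apply Rmult_le_reg_l with t; trivial.
  replace (t * ((1 + / t) * (x * x) + (1 + t) * (y * y)))
    with ((t + 1) * (x * x) + t * (1 + t) * (y * y)) by (field; lra).
  pose proof (Rle_0_sqr (x - t * y)) as Q; unfold Rsqr in Q. nra. }
destruct u as [[a b] [c d]], v as [[a' b'] [c' d']].
unfold sqnorm, qadd, mkq, re, im_i, im_j, im_k; simpl.
pose proof (K a a'); pose proof (K b b'); pose proof (K c c'); pose proof (K d d'). lra.
Qed.

Lemma sum_sq_sc_mul c x N : sum_sq (sc c * x)%ser N = sqnorm c * sum_sq x N.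
Proof.
unfold sum_sq; rewrite <- sum_n_scal_R; apply sum_n_ext; intros n.
now rewrite smul_sc_l, sqnorm_mul.
Qed.

(** The inverse satisfies [b = 1 + d * b], which bounds its norm since [d] has norm less than one.  The
    triangle inequality is used in the weighted form [sqnorm_add_le], which keeps to squares. *)
Lemma one_sub_inverse d kappa : 0 <= kappa < 1 ->
  (forall x N, sum_sq (d * x)%ser N <= kappa * sum_sq x N) ->
  exists b, ball_series b /\ ((sc q1 - d) * b = sc q1)%ser /\ (b * (sc q1 - d) = sc q1)%ser.
Proof.
intros Hk Hd.
destruct (ser_inverse (sc q1 - d)%ser) as [b Hb].
{ unfold ssub; simpl. intros E. specialize (Hd (sc q1) O).
  rewrite sc_1_r in Hd; unfold sum_sq in Hd; rewrite !sum_O in Hd.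
  apply qsub_eq0 in E. rewrite <- E in Hd. simpl in Hd.
  assert (sqnorm q1 = 1) by (clear; quat_ring). rewrite H in Hd; lra. }
exists b; split; [|split; [exact Hb | now apply left_inverse_is_right]].
assert (E : b = (sc q1 + d * b)%ser).
{ rewrite <- Hb. non_commutative_ring. }
set (t := (1 - kappa) / 2). assert (Ht : 0 < t) by (unfold t; lra).
assert (Hk' : (1 + t) * kappa <= (1 + kappa) / 2) by (unfold t; nra).
set (C := (1 + / t) * 2 / (1 - kappa)).
assert (HB : forall N, sum_sq b N <= C).
{ intros N.
  assert (L : sum_sq b N <= (1 + / t) * sum_sq (sc q1) N + (1 + t) * sum_sq (d * b)%ser N).
  { unfold sum_sq; rewrite <- !sum_n_scal_R, <- sum_n_add. apply sum_n_le_loc; intros n _.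
    replace (b n) with (sc q1 n + (d * b)%ser n)%quat
      by exact (f_equal (fun s => s n) (eq_sym E)). now apply sqnorm_add_le. }
  specialize (Hd b N). rewrite sum_sq_1 in L. pose proof (sum_sq_pos b N) as P.
  assert ((1 + t) * sum_sq (d * b)%ser N <= (1 + kappa) / 2 * sum_sq b N).
  { apply Rle_trans with ((1 + t) * (kappa * sum_sq b N)); [apply Rmult_le_compat_l; lra|].
    rewrite <- Rmult_assoc. now apply Rmult_le_compat_r. }
  apply Rmult_le_reg_r with ((1 - kappa) / 2); [lra|].
  replace (C * ((1 - kappa) / 2)) with (1 + / t) by (unfold C; field; lra). lra. }
apply ball_series_bounded with (sqrt C). intros n. rewrite qmod_sqrt. apply sqrt_le_1_alt.
apply Rle_trans with (2 := HB n). apply sqnorm_le_sum_sq.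
Qed.

(** The two forms of the Moebius image agree because of
    [(1 - a conj(c)) (a - c) = (a - c) (1 - conj(c) a)]. *)
Lemma mobius_denominators a c : contractive a -> ball1 c -> exists b b',
  ball_series b /\ ball_series b' /\
  ((sc q1 - a * sc (qconj c)) * b = sc q1)%ser /\ (b * (sc q1 - a * sc (qconj c)) = sc q1)%ser /\
  ((sc q1 - sc (qconj c) * a) * b' = sc q1)%ser /\ (b' * (sc q1 - sc (qconj c) * a) = sc q1)%ser /\
  (b * (a - sc c) = (a - sc c) * b')%ser.
Proof.
intros Ha Hc. assert (Hk : 0 <= sqnorm c < 1) by (split; [apply sqnorm_pos | now apply ball1_sqnorm]).
destruct (one_sub_inverse (a * sc (qconj c))%ser (sqnorm c) Hk) as (b & Sb & H1 & H2).
{ intros x N. rewrite <- smul_assoc, <- (sqnorm_conj c), <- sum_sq_sc_mul. apply Ha. }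
destruct (one_sub_inverse (sc (qconj c) * a)%ser (sqnorm c) Hk) as (b' & Sb' & H3 & H4).
{ intros x N. rewrite <- smul_assoc, sum_sq_sc_mul, sqnorm_conj.
  apply Rmult_le_compat_l; [lra | apply Ha]. }
exists b, b'. repeat (split; [assumption|]).
assert (E : ((sc q1 - a * sc (qconj c)) * (a - sc c) =
  (a - sc c) * (sc q1 - sc (qconj c) * a))%ser).
{ assert (Ec : (sc (qconj c) * sc c = sc c * sc (qconj c))%ser).
  { now rewrite <- !sc_mul, qmul_conj_l, qmul_conj_r. }
  assert (Er : (a * (sc (qconj c) * sc c) = sc c * sc (qconj c) * a)%ser).
  { rewrite Ec, <- !sc_mul, qmul_conj_r. symmetry; apply sc_real_comm. }
  transitivity (a - sc c - a * sc (qconj c) * a + a * (sc (qconj c) * sc c))%ser;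
    [non_commutative_ring|]. rewrite Er. non_commutative_ring. }
transitivity (b * ((a - sc c) * (sc q1 - sc (qconj c) * a)) * b')%ser.
- rewrite <- !smul_assoc, H3, sc_1_r. reflexivity.
- rewrite <- E, !smul_assoc, H2, sc_1_l. reflexivity.
Qed.

(** With [u = b' * x], the image of [x] is [a u - c u] and [x] itself is [u - conj(c) a u]; their square
    norms differ by [(1 - |c|^2) (|u|^2 - |a u|^2)]. *)
Lemma contractive_mobius a c b' : contractive a -> ball1 c ->
  ((sc q1 - sc (qconj c) * a) * b' = sc q1)%ser -> contractive ((a - sc c) * b')%ser.
Proof.
intros Ha Hc Hb x N. set (u := (b' * x)%ser).
assert (Ex : x = (u - sc (qconj c) * (a * u))%ser).
{ unfold u. rewrite <- (sc_1_l x) at 1. rewrite <- Hb. non_commutative_ring. }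
assert (Ey : ((a - sc c) * b' * x = a * u - sc c * u)%ser) by (unfold u; non_commutative_ring).
rewrite Ey. replace (sum_sq x N) with (sum_sq (u - sc (qconj c) * (a * u))%ser N) by now rewrite <- Ex.
assert (Hc1 := proj1 (ball1_sqnorm c) Hc).
assert (E : sum_sq (u - sc (qconj c) * (a * u))%ser N - sum_sq (a * u - sc c * u)%ser N
   = (1 - sqnorm c) * (sum_sq u N - sum_sq (a * u)%ser N)).
{ assert (Hn : forall n, sqnorm ((u - sc (qconj c) * (a * u))%ser n) =
     sqnorm ((a * u - sc c * u)%ser n) + ((1 - sqnorm c) * sqnorm (u n)
       + (-(1 - sqnorm c)) * sqnorm ((a * u)%ser n))).
  { intros n; unfold ssub; rewrite !smul_sc_l. generalize (u n), ((a * u)%ser n).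
    clear; intros; quat_ring. }
  unfold sum_sq at 1. rewrite (sum_n_ext _ _ N Hn).
  rewrite !sum_n_add, !sum_n_scal_R. unfold sum_sq; ring. }
specialize (Ha u N).
assert (0 <= (1 - sqnorm c) * (sum_sq u N - sum_sq (a * u)%ser N)) by (apply Rmult_le_pos; lra). lra.
Qed.

(** All factors have their coefficients in the commutative field generated by [p]. *)
Lemma mob_alt p : (mob p * (sc q1 - sX * sc (qconj p)) = sX - sc p)%ser.
Proof.
unfold mob.
assert (E : ((sX - sc p) * (sc q1 - sX * sc (qconj p)) =
  (sc q1 - sX * sc (qconj p)) * (sX - sc p))%ser).
{ assert (E1 : (sc p * sX = sX * sc p)%ser) by (symmetry; apply sX_comm).
  assert (E2 : (sc (qconj p) * sX = sX * sc (qconj p))%ser) by (symmetry; apply sX_comm).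
  assert (E3 : (sc p * sc (qconj p) = sc (qconj p) * sc p)%ser).
  { now rewrite <- !sc_mul, qmul_conj_l, qmul_conj_r. }
  transitivity (sX - sX * sX * sc (qconj p) - sc p + sc p * sX * sc (qconj p))%ser;
    [non_commutative_ring|].
  rewrite E1.
  transitivity (sX - sX * (sc (qconj p) * sX) - sc p + sX * (sc (qconj p) * sc p))%ser;
    [|non_commutative_ring].
  rewrite E2, <- E3. non_commutative_ring. }
rewrite <- smul_assoc, E, smul_assoc, skern_right. apply sc_1_l.
Qed.

(** Horner's scheme for the division by [q - p]. *)
Definition squotient (a : ser) (p : quat) : ser :=
  fun n => power_series (fun k => a (S (n + k))) p.

Lemma ball_series_shift a n : ball_series a -> ball_series (fun k => a (n + k)%nat).
Proof.
intros Ha; revert a Ha; induction n as [|n IH]; intros a Ha; [exact Ha|].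
apply (IH (stl a)), ball_series_stl, Ha.
Qed.

Lemma squotient_rec a p n : ball_series a -> ball1 p ->
  squotient a p n = (a (S n) + p * squotient a p (S n))%quat.
Proof.
intros Ha Hp; unfold squotient.
rewrite power_series_head; trivial; [|apply (ball_series_shift a (S n)), Ha].
rewrite Nat.add_0_r. do 2 f_equal. f_equal.
apply functional_extensionality; intros k; unfold stl; f_equal; lia.
Qed.

Lemma squotient_spec a p : ball_series a -> ball1 p ->
  a = (sc (power_series a p) + (sX - sc p) * squotient a p)%ser.
Proof.
intros Ha Hp. apply functional_extensionality; intros n; unfold sadd.
replace ((sX - sc p) * squotient a p)%ser with (sX * squotient a p - sc p * squotient a p)%ser
  by non_commutative_ring.
unfold ssub; rewrite smul_sc_l. destruct n as [|n].
- rewrite sX_mul_0; simpl. rewrite (power_series_head a p Ha Hp).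
  change (squotient a p O) with (power_series (stl a) p).
  generalize (p * power_series (stl a) p)%quat, (a O); quat_ring.
- rewrite sX_mul_S, (squotient_rec a p n Ha Hp); simpl.
  generalize (p * squotient a p (S n))%quat, (a (S n)); quat_ring.
Qed.

Lemma ball_series_squotient a p : ball_series a -> ball1 p -> ball_series (squotient a p).
Proof.
intros Ha Hp rho0 Hr0. destruct (radius_between p Hp) as (r1 & Hr1 & Hp1).
set (rho := Rmax rho0 r1).
assert (Hr : 0 < rho < 1) by (unfold rho; split;
  [apply Rlt_le_trans with r1; [lra|apply Rmax_r] | apply Rmax_lub_lt; lra]).
assert (Hp' : qmod p < rho) by (apply Rlt_le_trans with (1 := Hp1), Rmax_r).
destruct (Ha rho Hr) as [C HC].
assert (HC0 : 0 <= C) by (apply (growth_nonneg a rho); trivial; lra).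
exists (C / rho * / (1 - qmod p / rho)). intros n.
assert (Hrn : 0 < rho ^ n) by (apply pow_lt; lra).
assert (G : forall k, qmod (a (S (n + k))) * rho ^ k <= C / rho * / rho ^ n).
{ intros k. specialize (HC (S (n + k))). simpl in HC. rewrite pow_add in HC.
  apply Rmult_le_reg_r with (rho * rho ^ n); [nra|].
  replace (C / rho * / rho ^ n * (rho * rho ^ n)) with C by (field; lra). lra. }
destruct (power_series_bound_aux (fun k => a (S (n + k))) rho _ p (proj1 Hr) Hp' G) as [_ B].
fold (squotient a p n) in B.
destruct (ratio_bound _ _ (qmod_pos p) (proj1 Hr) Hp') as [H0 H1].
apply Rle_trans with (qmod (squotient a p n) * rho ^ n).
- apply Rmult_le_compat_l; [apply qmod_pos|]. apply pow_incr. split; [lra|apply Rmax_l].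
- apply Rle_trans with (C / rho * / rho ^ n * / (1 - qmod p / rho) * rho ^ n).
  + apply Rmult_le_compat_r; lra.
  + right; field; lra.
Qed.

Lemma square_summable_small m B eps : (forall K, sum_sq m K <= B) -> 0 < eps ->
  exists n0, forall n, (n0 <= n)%nat -> qmod (m n) <= eps.
Proof.
intros HB He.
destruct (ex_finite_lim_seq_incr (sum_sq m) B) as [l Hl].
- intros n; unfold sum_sq; rewrite sum_Sn. change (@plus R_AbelianMonoid) with Rplus.
  pose proof (sqnorm_pos (m (S n))); lra.
- exact HB.
- assert (Hz : is_lim_seq (fun n => sqnorm (m n)) 0).
  { apply ex_series_lim_0. exists l. exact Hl. }
  assert (He2 : 0 < eps * eps) by nra.
  destruct (proj1 (filterlim_locally _ _) Hz (mkposreal _ He2)) as [n0 Hn0].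
  exists n0; intros n Hn. specialize (Hn0 n Hn).
  change (Rabs (sqnorm (m n) - 0) < eps * eps) in Hn0.
  rewrite Rminus_0_r, Rabs_pos_eq, <- qmod_sqr in Hn0 by apply sqnorm_pos.
  pose proof (qmod_pos (m n)). nra.
Qed.

Lemma squotient_small m p B eps : ball_series m -> ball1 p ->
  (forall K, sum_sq m K <= B) -> 0 < eps ->
  exists n0, forall n, (n0 <= n)%nat -> qmod (squotient m p n) <= eps.
Proof.
intros Hm Hp HB He. destruct (radius_between p Hp) as (r & Hr & Hpr).
destruct (ratio_bound _ _ (qmod_pos p) (proj1 Hr) Hpr) as [H0 H1].
destruct (square_summable_small m B (eps * (1 - qmod p / r)) HB) as [n0 Hn0].
{ apply Rmult_lt_0_compat; lra. }
exists n0; intros n Hn. unfold squotient.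
assert (G : forall k, qmod (m (S (n + k))) * r ^ k <= eps * (1 - qmod p / r)).
{ intros k. assert (0 <= r ^ k <= 1).
  { split; [apply pow_le; lra|]. rewrite <- (pow1 k). apply pow_incr; lra. }
  specialize (Hn0 (S (n + k)) ltac:(lia)). pose proof (qmod_pos (m (S (n + k)))). nra. }
destruct (power_series_bound_aux (fun k => m (S (n + k))) r _ p (proj1 Hr) Hpr G) as [_ Q].
eapply Rle_trans; [exact Q|]. right; field; lra.
Qed.

Lemma smul_cancel_l a x y : a <> sc q0 -> (a * x = a * y)%ser -> x = y.
Proof.
intros Ha H. apply ser_sub_eq0.
assert (E : (a * (x - y) = sc q0)%ser).
{ replace (a * (x - y))%ser with (a * x - a * y)%ser by non_commutative_ring.
  rewrite H; non_commutative_ring. }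
apply smul_integral in E; tauto.
Qed.

Lemma sX_sub_nz p : (sX - sc p)%ser <> sc q0.
Proof.
intros E; apply (f_equal (fun s => re (s 1%nat))) in E.
unfold ssub, qsub, qopp, qadd, mkq, re in E; simpl in E; lra.
Qed.

Lemma mob_nz p : mob p <> sc q0.
Proof.
intros E. apply (sX_sub_nz p). rewrite <- mob_alt, E. non_commutative_ring.
Qed.

(** The difference of the two sums telescopes.  Since [mob p] maps [(1 - q conj(p)) u] to [(q - p) u],
    it is an isometry up to the boundary term. *)
Lemma mob_isometry p u N :
  sum_sq ((sX - sc p) * u)%ser N
  = sum_sq ((sc q1 - sX * sc (qconj p)) * u)%ser N - (1 - sqnorm p) * sqnorm (u N).
Proof.
replace ((sX - sc p) * u)%ser with (sX * u - sc p * u)%ser by non_commutative_ring.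
replace ((sc q1 - sX * sc (qconj p)) * u)%ser with (u - sX * (sc (qconj p) * u))%ser
  by non_commutative_ring.
unfold sum_sq; induction N as [|N IH].
- rewrite !sum_O; unfold ssub. rewrite !sX_mul_0, smul_sc_l.
  generalize (u O); quat_ring.
- rewrite !sum_Sn. change (@plus R_AbelianMonoid) with Rplus. rewrite IH. unfold ssub.
  rewrite !sX_mul_S, !smul_sc_l.
  match goal with |- ?s - ?x + ?y = ?s + ?z - ?t => enough (y - x = z - t) by lra end.
  generalize (u N), (u (S N)); quat_ring.
Qed.

(** Division by [mob p] preserves contractivity if the boundary term of [mob_isometry] tends to
    zero.  It does: [a * x] is square summable for truncated [x], and its quotient by [q - p] then has
    coefficients that tend to zero. *)
Theorem schur_division a p : contractive a -> ball1 p -> power_series a p = q0 ->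
  let h := ((sc q1 - sX * sc (qconj p)) * squotient a p)%ser in
  a = (mob p * h)%ser /\ contractive h.
Proof.
intros Ha Hp Hroot h.
assert (Sa := contractive_ball_series a Ha).
assert (Hspec := squotient_spec a p Sa Hp).
assert (Ea : a = ((sX - sc p) * squotient a p)%ser).
{ rewrite Hspec at 1. rewrite Hroot. non_commutative_ring. }
split; [unfold h; now rewrite smul_assoc, mob_alt|].
intros x N. set (x' := trunc N x).
assert (Sx : ball_series x') by apply ball_series_trunc.
set (u := (squotient a p * x')%ser).
assert (Em : (a * x' = (sX - sc p) * u)%ser) by (unfold u; rewrite smul_assoc, <- Ea; reflexivity).
assert (Ey : (h * x' = (sc q1 - sX * sc (qconj p)) * u)%ser)
  by (unfold u, h; non_commutative_ring).
assert (Sm : ball_series (a * x')%ser) by now apply ball_series_mul.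
assert (Hu : u = squotient (a * x')%ser p).
{ apply (smul_cancel_l (sX - sc p)%ser); [apply sX_sub_nz|].
  rewrite <- Em. rewrite (squotient_spec (a * x')%ser p Sm Hp) at 1.
  rewrite power_series_mul_root by trivial. non_commutative_ring. }
assert (Hx' : forall k, sum_sq x' (N + k) = sum_sq x N).
{ unfold sum_sq; induction k as [|k IH].
  - rewrite Nat.add_0_r. apply sum_n_ext_loc; intros n Hn. unfold x'; now rewrite trunc_le.
  - rewrite Nat.add_succ_r, sum_Sn. change (@plus R_AbelianMonoid) with Rplus.
    rewrite IH. unfold x' at 1; rewrite trunc_gt by lia.
    replace (sqnorm q0) with 0 by (clear; quat_ring). as_real_eq; ring. }
assert (Hp1 := proj1 (ball1_sqnorm p) Hp). assert (Hp0 := sqnorm_pos p).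
replace (sum_sq (h * x)%ser N) with (sum_sq (h * x')%ser N).
2:{ apply sum_n_ext_loc; intros n Hn; f_equal. apply smul_local; trivial.
    intros k Hk; apply trunc_le; lia. }
assert (HB : forall K, sum_sq (a * x')%ser K <= sum_sq x N).
{ intros K. destruct (le_lt_dec N K) as [H|H].
  - replace K with (N + (K - N))%nat by lia. rewrite <- (Hx' (K - N)%nat). apply Ha.
  - rewrite <- (Hx' O), Nat.add_0_r. eapply Rle_trans; [|apply (Ha x' N)].
    apply sum_sq_mono; lia. }
apply Rnot_lt_le; intros Hlt.
set (gap := sum_sq (h * x')%ser N - sum_sq x N).
assert (Hg : 0 < gap) by (unfold gap; lra).
destruct (squotient_small (a * x')%ser p (sum_sq x N) (sqrt (gap / 2)) Sm Hp HB) as [n0 Hn0].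
{ apply sqrt_lt_R0; lra. }
rewrite <- Hu in Hn0.
specialize (Hn0 (N + n0)%nat ltac:(lia)).
assert (Hun : sqnorm (u (N + n0)%nat) <= gap / 2).
{ rewrite <- qmod_sqr, <- (sqrt_sqrt (gap / 2)) by lra.
  pose proof (qmod_pos (u (N + n0)%nat)). apply Rmult_le_compat; trivial. }
assert (I1 := mob_isometry p u (N + n0)). rewrite <- Em, <- Ey in I1.
specialize (HB (N + n0)%nat).
assert (Hmono := sum_sq_mono (h * x')%ser N (N + n0) ltac:(lia)).
pose proof (sqnorm_pos (u (N + n0)%nat)).
assert ((1 - sqnorm p) * sqnorm (u (N + n0)%nat) <= 1 * sqnorm (u (N + n0)%nat))
  by (apply Rmult_le_compat_r; lra).
unfold gap in *. lra.
Qed.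

(** * Defects of finite rank *)

Definition outer (x : ser) (i j : nat) : quat := (x i * qconj (x j))%quat.

(** A defect of rank at most two involves three squares on either side. *)
Definition outer_eq (x1 x2 x3 y1 y2 y3 : ser) : Prop := forall i j,
  (outer x1 i j + outer x2 i j + outer x3 i j = outer y1 i j + outer y2 i j + outer y3 i j)%quat.

Definition right_linear_on (D : ser -> Prop) (Phi : ser -> quat) : Prop := forall x y c,
  D x -> D y -> D (x + y)%ser /\ D (x * sc c)%ser /\
  Phi (x + y)%ser = (Phi x + Phi y)%quat /\ Phi (x * sc c)%ser = (Phi x * c)%quat.

Lemma right_linear_combination D Phi x1 x2 x3 c1 c2 c3 : right_linear_on D Phi ->
  D x1 -> D x2 -> D x3 ->
  Phi (x1 * sc c1 + x2 * sc c2 + x3 * sc c3)%ser = (Phi x1 * c1 + Phi x2 * c2 + Phi x3 * c3)%quat.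
Proof.
intros HP H1 H2 H3.
destruct (HP x1 x1 c1 H1 H1) as (_ & D1 & _ & E1).
destruct (HP x2 x2 c2 H2 H2) as (_ & D2 & _ & E2).
destruct (HP x3 x3 c3 H3 H3) as (_ & D3 & _ & E3).
destruct (HP (x1 * sc c1)%ser (x2 * sc c2)%ser q0 D1 D2) as (D12 & _ & E12 & _).
destruct (HP (x1 * sc c1 + x2 * sc c2)%ser (x3 * sc c3)%ser q0 D12 D3) as (_ & _ & E & _).
now rewrite E, E12, E1, E2, E3.
Qed.

(** The first index is tested against [Phi]; conjugation exchanges the indices, and then the second
    one is tested against [Psi]. *)
Lemma outer_eq_apply D1 D2 Phi Psi x1 x2 x3 y1 y2 y3 :
  right_linear_on D1 Phi -> right_linear_on D2 Psi ->
  D1 x1 -> D1 x2 -> D1 x3 -> D1 y1 -> D1 y2 -> D1 y3 ->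
  D2 x1 -> D2 x2 -> D2 x3 -> D2 y1 -> D2 y2 -> D2 y3 ->
  outer_eq x1 x2 x3 y1 y2 y3 ->
  (Phi x1 * qconj (Psi x1) + Phi x2 * qconj (Psi x2) + Phi x3 * qconj (Psi x3) =
   Phi y1 * qconj (Psi y1) + Phi y2 * qconj (Psi y2) + Phi y3 * qconj (Psi y3))%quat.
Proof.
intros L1 L2 a1 a2 a3 b1 b2 b3 c1 c2 c3 d1 d2 d3 H.
assert (Hconj : forall p q r p' q' r' : quat, (p + q + r = p' + q' + r')%quat ->
   (qconj p + qconj q + qconj r = qconj p' + qconj q' + qconj r')%quat).
{ intros p q r p' q' r' E. rewrite <- !qconj_add. now rewrite E. }
assert (Hswap : forall p q, qconj (p * qconj q) = (q * qconj p)%quat)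
  by (intros; now rewrite qconj_mul, qconj_conj).
assert (S1 : forall j, (Phi x1 * qconj (x1 j) + Phi x2 * qconj (x2 j) + Phi x3 * qconj (x3 j) =
   Phi y1 * qconj (y1 j) + Phi y2 * qconj (y2 j) + Phi y3 * qconj (y3 j))%quat).
{ intros j. rewrite <- !(right_linear_combination D1 Phi) by trivial. f_equal.
  apply functional_extensionality; intros i; unfold sadd; rewrite !smul_sc_r. apply H. }
assert (S2 : (x1 * sc (qconj (Phi x1)) + x2 * sc (qconj (Phi x2)) + x3 * sc (qconj (Phi x3)) =
   y1 * sc (qconj (Phi y1)) + y2 * sc (qconj (Phi y2)) + y3 * sc (qconj (Phi y3)))%ser).
{ apply functional_extensionality; intros j; unfold sadd; rewrite !smul_sc_r.
  specialize (S1 j). apply Hconj in S1. now rewrite !Hswap in S1. }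
assert (S3 := f_equal Psi S2). rewrite !(right_linear_combination D2 Psi) in S3 by trivial.
apply Hconj in S3. now rewrite !Hswap in S3.
Qed.

Lemma right_linear_coefficient g i : right_linear_on (fun _ => True) (fun x => (g * x)%ser i).
Proof.
intros x y c _ _; repeat split.
- now rewrite smul_add_r.
- now rewrite smul_assoc, smul_sc_r.
Qed.

Lemma right_linear_entry i : right_linear_on (fun _ => True) (fun x => x i).
Proof. intros x y c _ _; repeat split. apply smul_sc_r. Qed.

Lemma right_linear_power_series z : ball1 z -> right_linear_on ball_series (fun x => power_series x z).
Proof.
intros Hz x y c Hx Hy; repeat split.
- now apply ball_series_add.
- apply ball_series_mul; trivial; apply ball_series_sc.
- now apply power_series_add.
- now apply power_series_mul_sc.
Qed.

Lemma outer_eq_smul g x1 x2 x3 y1 y2 y3 : outer_eq x1 x2 x3 y1 y2 y3 ->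
  outer_eq (g * x1)%ser (g * x2)%ser (g * x3)%ser (g * y1)%ser (g * y2)%ser (g * y3)%ser.
Proof.
intros H i j.
exact (outer_eq_apply _ _ _ _ x1 x2 x3 y1 y2 y3 (right_linear_coefficient g i)
  (right_linear_coefficient g j) Logic.I Logic.I Logic.I Logic.I Logic.I Logic.I
  Logic.I Logic.I Logic.I Logic.I Logic.I Logic.I H).
Qed.

(** Left multiplication by [g] is injective on the right combinations of columns; it is cancelled in
    one index after the other. *)
Lemma outer_eq_smul_cancel g x1 x2 x3 y1 y2 y3 : g <> sc q0 ->
  outer_eq (g * x1)%ser (g * x2)%ser (g * x3)%ser (g * y1)%ser (g * y2)%ser (g * y3)%ser ->
  outer_eq x1 x2 x3 y1 y2 y3.
Proof.
intros Hg H.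
assert (Hsums : forall c1 c2 c3 d1 d2 d3,
  (g * x1 * sc c1 + g * x2 * sc c2 + g * x3 * sc c3 = g * y1 * sc d1 + g * y2 * sc d2 + g * y3 * sc d3)%ser ->
  (x1 * sc c1 + x2 * sc c2 + x3 * sc c3 = y1 * sc d1 + y2 * sc d2 + y3 * sc d3)%ser).
{ intros c1 c2 c3 d1 d2 d3 E. apply (smul_cancel_l g); trivial.
  rewrite !smul_add_r, !smul_assoc. exact E. }
assert (Hconj : forall p q r p' q' r' : quat, (p + q + r = p' + q' + r')%quat ->
   (qconj p + qconj q + qconj r = qconj p' + qconj q' + qconj r')%quat).
{ intros p q r p' q' r' E. rewrite <- !qconj_add. now rewrite E. }
assert (Hswap : forall p q, qconj (p * qconj q) = (q * qconj p)%quat)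
  by (intros; now rewrite qconj_mul, qconj_conj).
assert (S1 : forall i j, (x1 i * qconj ((g * x1)%ser j) + x2 i * qconj ((g * x2)%ser j) + x3 i * qconj ((g * x3)%ser j)
  = y1 i * qconj ((g * y1)%ser j) + y2 i * qconj ((g * y2)%ser j) + y3 i * qconj ((g * y3)%ser j))%quat).
{ intros i j.
  assert (E := Hsums (qconj ((g * x1)%ser j)) (qconj ((g * x2)%ser j)) (qconj ((g * x3)%ser j))
    (qconj ((g * y1)%ser j)) (qconj ((g * y2)%ser j)) (qconj ((g * y3)%ser j))).
  refine (_ (f_equal (fun s => s i) (E _))).
  - unfold sadd; rewrite !smul_sc_r; trivial.
  - apply functional_extensionality; intros k; unfold sadd; rewrite !smul_sc_r. apply H. }
intros i j.
assert (E := Hsums (qconj (x1 j)) (qconj (x2 j)) (qconj (x3 j)) (qconj (y1 j)) (qconj (y2 j)) (qconj (y3 j))).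
refine (_ (f_equal (fun s => s i) (E _))).
- unfold sadd; rewrite !smul_sc_r; trivial.
- apply functional_extensionality; intros k; unfold sadd; rewrite !smul_sc_r.
  specialize (S1 j k). apply Hconj in S1. now rewrite !Hswap in S1.
Qed.

(** In terms of coefficients, this says that [(1 - a(q) conj(a(r))) / (1 - q conj(r))] is
    [v(q) conj(v(r)) + w(q) conj(w(r))]: the defect of [a] has rank at most two. *)
Definition defect2 (a v w : ser) : Prop :=
  outer_eq (sc q1) (sX * v)%ser (sX * w)%ser a v w.
Definition defect1 (a v : ser) : Prop := defect2 a v (sc q0).

Lemma outer_zero i j : outer (sc q0) i j = q0.
Proof. unfold outer; rewrite sc_q0; apply qmul_0_l. Qed.

Lemma smul_zero a : (a * sc q0 = sc q0)%ser.
Proof. non_commutative_ring. Qed.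

Lemma zero_smul a : (sc q0 * a = sc q0)%ser.
Proof. non_commutative_ring. Qed.

Lemma defect_scale_identity P Q K D A V W v w : (P - Q = K * (D - A) ->
  D + V + W = A + v + w -> P + K * V + K * W = Q + K * v + K * w)%quat.
Proof.
intros H1 H2. apply qsub_eq0.
transitivity ((P - Q) + K * (V + W - v - w))%quat; [non_commutative_ring|].
rewrite H1. transitivity (K * (D + V + W - (A + v + w)))%quat; [non_commutative_ring|].
rewrite H2, qsub_diag. apply qmul_0_r.
Qed.

(** The identity [|1 - a conj(c)|^2 - |a - c|^2 = (1 - |c|^2) (1 - |a|^2)], read as one between kernels,
    is multiplied by [b] from both sides. *)
Lemma defect2_mobius a v w c b : ball1 c -> defect2 a v w ->
  (b * (sc q1 - a * sc (qconj c)) = sc q1)%ser ->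
  let s := sc (qreal (sqrt (1 - sqnorm c))) in
  defect2 (b * (a - sc c))%ser (b * v * s)%ser (b * w * s)%ser.
Proof.
intros Hc H Hb s. apply ball1_sqnorm in Hc.
set (sr := sqrt (1 - sqnorm c)) in *.
assert (Hs : sr * sr = 1 - sqnorm c) by (apply sqrt_sqrt; lra).
unfold defect2. rewrite <- Hb.
replace (sX * (b * v * s))%ser with (b * (sX * v * s))%ser
  by (rewrite !smul_assoc, (sX_comm b); non_commutative_ring).
replace (sX * (b * w * s))%ser with (b * (sX * w * s))%ser
  by (rewrite !smul_assoc, (sX_comm b); non_commutative_ring).
rewrite <- (smul_assoc b v s), <- (smul_assoc b w s).
apply (outer_eq_smul b). intros i j. specialize (H i j). unfold outer, ssub in *.
unfold s; rewrite !smul_sc_r.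
set (V := (sX * v)%ser) in *; set (W := (sX * w)%ser) in *.
assert (Hd : exists d e, sc q1 i = qreal d /\ sc q1 j = qreal e /\ sc c i = (c * qreal d)%quat
   /\ sc c j = (c * qreal e)%quat).
{ exists (match i with O => 1 | _ => 0 end), (match j with O => 1 | _ => 0 end).
  destruct i, j; simpl; repeat split; clear; quat_ring. }
destruct Hd as (d & e & E1 & E2 & E3 & E4). rewrite E3, E4; rewrite E1, E2 in *.
assert (Esc : forall x y, (x * qreal sr * qconj (y * qreal sr) = qreal (sr * sr) * (x * qconj y))%quat)
  by (clear; intros; rewrite qreal_mul; quat_ring).
rewrite !Esc, Hs.
assert (Eac : forall x y, ((qreal d - x * qconj c) * qconj (qreal e - y * qconj c)
   - (x - c * qreal d) * qconj (y - c * qreal e) =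
   qreal (1 - sqnorm c) * (qreal d * qconj (qreal e) - x * qconj y))%quat) by (clear; quat_ring).
specialize (Eac (a i) (a j)).
set (P := ((qreal d - a i * qconj c) * qconj (qreal e - a j * qconj c))%quat) in *.
set (Q := ((a i - c * qreal d) * qconj (a j - c * qreal e))%quat) in *.
exact (defect_scale_identity _ _ _ _ _ _ _ _ _ Eac H).
Qed.

Lemma defect1_mobius a v c b : ball1 c -> defect1 a v ->
  (b * (sc q1 - a * sc (qconj c)) = sc q1)%ser ->
  exists v', defect1 (b * (a - sc c))%ser v'.
Proof.
intros Hc H Hb. pose proof (defect2_mobius a v (sc q0) c b Hc H Hb) as K. cbv zeta in K.
eexists. unfold defect1. rewrite smul_zero, zero_smul in K. exact K.
Qed.

(** The kernel at [p], normalised in l^2. *)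
Definition mob_vec (p : quat) : ser := (skern p * sc (qreal (sqrt (1 - sqnorm p))))%ser.

Lemma ball_series_mob_vec p : ball1 p -> ball_series (mob_vec p).
Proof.
intros Hp. unfold mob_vec. apply (ball_series_mul (skern p)); [now apply ball_series_skern | apply ball_series_sc].
Qed.

Lemma defect1_mob p : ball1 p -> defect1 (mob p) (mob_vec p).
Proof.
intros Hp; apply ball1_sqnorm in Hp. unfold defect1, defect2, mob_vec, mob.
set (sr := sqrt (1 - sqnorm p)). assert (Hs : sr * sr = 1 - sqnorm p) by (apply sqrt_sqrt; lra).
rewrite <- (skern_right p).
replace (sX * (skern p * sc (qreal sr)))%ser with (skern p * (sX * sc (qreal sr)))%ser
  by (rewrite !smul_assoc, (sX_comm (skern p)); reflexivity).
replace (sX * sc q0)%ser with (skern p * sc q0)%ser by (now rewrite !smul_zero).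
rewrite <- (smul_zero (skern p)) at 2.
apply (outer_eq_smul (skern p)). intros i j. unfold outer, ssub.
rewrite !smul_sc_r, !sc_q0.
assert (Hd : exists d x, sc q1 i = qreal d /\ sX i = qreal x /\ sc p i = (p * qreal d)%quat
   /\ sc (qreal sr) i = qreal (sr * d)).
{ exists (match i with O => 1 | _ => 0 end), (match i with 1%nat => 1 | _ => 0 end).
  destruct i as [|[|i]]; simpl; repeat split; try (clear; quat_ring). }
assert (He : exists e y, sc q1 j = qreal e /\ sX j = qreal y /\ sc p j = (p * qreal e)%quat
   /\ sc (qreal sr) j = qreal (sr * e)).
{ exists (match j with O => 1 | _ => 0 end), (match j with 1%nat => 1 | _ => 0 end).
  destruct j as [|[|j]]; simpl; repeat split; try (clear; quat_ring). }
destruct Hd as (d & x & -> & -> & -> & ->), He as (e & y & -> & -> & -> & ->).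
assert (Er : forall s t, (qreal (sr * s) * qconj (qreal (sr * t)) = qreal ((1 - sqnorm p) * (s * t)))%quat).
{ intros s t; rewrite qconj_real, <- qreal_mul; f_equal. rewrite <- Hs; ring. }
assert (Ex : forall s, (qreal s * qreal sr)%quat = qreal (sr * s))
  by (intros s; rewrite <- qreal_mul; f_equal; ring).
rewrite !Ex, !Er. clear; quat_ring.
Qed.

(** With primes for adjoints, [1 - M g g' M' = (1 - M M') + M (1 - g g') M']. *)
Lemma defect2_mob_mul p g v : ball1 p -> defect1 g v ->
  defect2 (mob p * g)%ser (mob_vec p) (mob p * v)%ser.
Proof.
intros Hp Hg i j. assert (K := defect1_mob p Hp i j).
assert (G := outer_eq_smul (mob p) _ _ _ _ _ _ Hg i j).
rewrite sc_1_r in G.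
replace (mob p * (sX * v))%ser with (sX * (mob p * v))%ser in G
  by (rewrite !smul_assoc, (sX_comm (mob p)); reflexivity).
rewrite !smul_zero, !outer_zero in *. rewrite !qadd_0_r in *.
rewrite K. rewrite <- !qadd_assoc, (qadd_comm (outer (mob p) i j)), <- qadd_assoc.
rewrite (qadd_comm _ (outer (mob p) i j)), G. non_commutative_ring.
Qed.

(** On the diagonal the identity telescopes. *)
Lemma defect2_bounded a v w n : defect2 a v w -> sqnorm (v n) + sqnorm (w n) <= 1.
Proof.
intros H.
assert (Hre : forall x k, re (outer x k k) = sqnorm (x k)).
{ intros x k; unfold outer; generalize (x k); clear; quat_ring. }
assert (Hn : forall k, sqnorm (sc q1 k) + sqnorm ((sX * v)%ser k) + sqnorm ((sX * w)%ser k)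
   = sqnorm (a k) + sqnorm (v k) + sqnorm (w k)).
{ intros k. rewrite <- !Hre. exact (f_equal re (H k k)). }
assert (Z : sqnorm q0 = 0) by (clear; quat_ring).
induction n as [|n IH].
- specialize (Hn O). rewrite !sX_mul_0, Z in Hn. simpl in Hn.
  assert (sqnorm q1 = 1) by (clear; quat_ring). pose proof (sqnorm_pos (a O)). lra.
- specialize (Hn (S n)). rewrite !sX_mul_S in Hn. simpl in Hn. rewrite Z in Hn.
  pose proof (sqnorm_pos (a (S n))). lra.
Qed.

Lemma defect2_ball_series a v w : defect2 a v w -> ball_series v /\ ball_series w.
Proof.
intros H.
assert (B : forall n, qmod (v n) <= 1 /\ qmod (w n) <= 1).
{ intros n; pose proof (defect2_bounded a v w n H).
  pose proof (sqnorm_pos (v n)); pose proof (sqnorm_pos (w n)).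
  rewrite !qmod_sqrt, <- sqrt_1; split; apply sqrt_le_1_alt; lra. }
split; apply ball_series_bounded with 1; intros n; apply B.
Qed.

(** For [al <> 0] the second column [(- al conj(be) / |al|, |al|)] makes [(al, be)] the first column of a
    unitary matrix. *)
Lemma unit_completion al be : sqnorm al + sqnorm be = 1 -> exists ga de,
  (al * qconj al + ga * qconj ga = q1)%quat /\ (al * qconj be + ga * qconj de = q0)%quat /\
  (be * qconj be + de * qconj de = q1)%quat.
Proof.
intros H. destruct (excluded_middle_informative (al = q0)) as [E|E].
- subst al. exists q1, q0.
  assert (sqnorm be = 1) by (rewrite <- H; clear; quat_ring).
  repeat split; [clear; quat_ring | clear; quat_ring |].
  rewrite qmul_conj_r, H0. clear; quat_ring.
- set (m := qmod al). assert (Hm : 0 < m) by now apply qmod_gt0.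
  assert (Hmm : m * m = sqnorm al) by apply qmod_sqr.
  exists (qopp (qreal (/ m) * (al * qconj be)))%quat, (qreal m).
  assert (E2 : (qopp (qreal (/ m) * (al * qconj be)) * qconj (qopp (qreal (/ m) * (al * qconj be)))
     = qreal (/ m * / m * (sqnorm al * sqnorm be)))%quat).
  { rewrite qmul_conj_r. f_equal.
    replace (sqnorm (qopp (qreal (/ m) * (al * qconj be)))) with (sqnorm (qreal (/ m) * (al * qconj be)))
      by (generalize (qreal (/ m) * (al * qconj be))%quat; clear; quat_ring).
    rewrite !sqnorm_mul, sqnorm_conj, sqnorm_real. ring. }
  repeat split.
  + rewrite E2, qmul_conj_r, <- qreal_add. unfold q1; f_equal. rewrite <- Hmm, <- H.
    rewrite <- Hmm. field; lra.
  + rewrite qconj_real.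
    transitivity (al * qconj be - qreal (/ m) * qreal m * (al * qconj be))%quat.
    * rewrite <- qreal_mul, Rinv_l by lra.
      replace (qopp (qreal (/ m) * (al * qconj be)) * qreal m)%quat with
       (qopp (qreal (/ m * m) * (al * qconj be)))%quat.
      -- rewrite Rinv_l by lra. generalize (al * qconj be)%quat; clear; quat_ring.
      -- generalize (al * qconj be)%quat, (/ m); clear; quat_ring.
    * rewrite <- qreal_mul, Rinv_l by lra. generalize (al * qconj be)%quat; clear; quat_ring.
  + rewrite qconj_real, qmul_conj_r, <- qreal_mul, <- qreal_add, Hmm. unfold q1; f_equal; lra.
Qed.

(** A unitary change of basis in the defect space. *)
Lemma outer_unitary v w al be ga de :
  (al * qconj al + ga * qconj ga = q1)%quat -> (al * qconj be + ga * qconj de = q0)%quat ->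
  (be * qconj be + de * qconj de = q1)%quat -> forall i j,
  (outer (v * sc al + w * sc be)%ser i j + outer (v * sc ga + w * sc de)%ser i j
   = outer v i j + outer w i j)%quat.
Proof.
intros H1 H2 H3 i j. unfold outer, sadd; rewrite !smul_sc_r.
assert (H4 : (be * qconj al + de * qconj ga = q0)%quat).
{ assert (K := f_equal qconj H2). rewrite qconj_add, !qconj_mul, !qconj_conj, qconj_0 in K. exact K. }
rewrite !qconj_add, !qconj_mul.
transitivity (v i * (al * qconj al + ga * qconj ga) * qconj (v j)
  + v i * (al * qconj be + ga * qconj de) * qconj (w j)
  + w i * (be * qconj al + de * qconj ga) * qconj (v j)
  + w i * (be * qconj be + de * qconj de) * qconj (w j))%quat.
{ repeat first [rewrite qmul_add_l | rewrite qmul_add_r]. rewrite !qmul_assoc.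
  repeat match goal with |- context [qmul ?x ?y] => generalize (qmul x y); intro end.
  non_commutative_ring. }
rewrite H1, H2, H3, H4. non_commutative_ring.
Qed.

Lemma sqnorm_nz_root p u : sqnorm p < 1 -> sqnorm p * sqnorm u = sqnorm u -> u = q0.
Proof. intros Hp H; apply sqnorm_eq0. pose proof (sqnorm_pos u). nra. Qed.

(** At a zero [p] the kernel at [p] is a unit vector of the defect space, up to normalisation.  Complete
    it to an orthonormal basis.  The other basis vector vanishes at [p] too, and its quotient by
    [mob p] spans the defect of [g]. *)
Theorem defect2_division p a g v w : ball1 p -> ball_series a -> a = (mob p * g)%ser ->
  power_series a p = q0 -> defect2 a v w -> exists v', defect1 g v'.
Proof.
intros Hp Sa Eag Hroot H.
assert (Hp1 := proj1 (ball1_sqnorm p) Hp). assert (Hp0 := sqnorm_pos p).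
destruct (defect2_ball_series a v w H) as [Sv Sw].
set (al := qconj (power_series v p)). set (be := qconj (power_series w p)).
(* evaluating the second index at [p] shows that this combination is the kernel at [p] *)
assert (Hk : (v * sc al + w * sc be)%ser = skern p).
{ assert (Hrow : forall i, (sc q1 i + (sX * (v * sc al + w * sc be))%ser i * qconj p
     = (v * sc al + w * sc be)%ser i)%quat).
  { intros i.
    assert (K := outer_eq_apply _ _ _ _ _ _ _ _ _ _ (right_linear_entry i)
      (right_linear_power_series p Hp) Logic.I Logic.I Logic.I Logic.I Logic.I Logic.I
      (ball_series_sc q1) (ball_series_mul _ _ ball_series_sX Sv)
      (ball_series_mul _ _ ball_series_sX Sw) Sa Sv Sw H). cbv beta in K.
    rewrite power_series_sc, !power_series_sX_mul, Hroot, qconj_0, !qconj_mul in K by trivial.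
    fold al be in K. unfold sadd at 2; rewrite !smul_sc_r.
    rewrite smul_add_r, !smul_assoc. unfold sadd; rewrite !smul_sc_r.
    rewrite qmul_0_r, qadd_0_l, qconj_1, qmul_1_r in K. rewrite <- K. non_commutative_ring. }
  apply functional_extensionality; intros n; induction n as [|n IH].
  - rewrite <- Hrow, sX_mul_0. unfold skern; simpl. generalize p; quat_ring.
  - rewrite <- Hrow, sX_mul_S, IH. unfold skern; simpl. rewrite qadd_0_l. symmetry; apply qpow_comm. }
set (s := sqrt (1 - sqnorm p)). assert (Hs : s * s = 1 - sqnorm p) by (apply sqrt_sqrt; lra).
assert (Hnorm : sqnorm (al * qreal s) + sqnorm (be * qreal s) = 1).
{ assert (E := f_equal (fun x => power_series x p) Hk). cbv beta in E.
  rewrite power_series_add, !power_series_mul_sc, power_series_skern_at in E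
    by (trivial; apply ball_series_mul; trivial; apply ball_series_sc).
  unfold al, be in E. rewrite !qmul_conj_r, <- qreal_add in E.
  apply (f_equal re) in E. unfold qreal, re in E; simpl in E.
  rewrite !sqnorm_mul, !sqnorm_real, Hs. unfold al, be. rewrite !sqnorm_conj.
  rewrite <- Rmult_plus_distr_r, E. field; lra. }
destruct (unit_completion _ _ Hnorm) as (ga & de & U1 & U2 & U3).
set (u := (v * sc ga + w * sc de)%ser).
assert (Evec : (v * sc (al * qreal s)%quat + w * sc (be * qreal s)%quat)%ser = mob_vec p).
{ unfold mob_vec. rewrite <- Hk. fold s. rewrite !sc_mul, !smul_assoc. symmetry. apply smul_add_l. }
assert (Hu : outer_eq (mob p) (sX * u)%ser (sc q0) a u (sc q0)).
{ intros i j. rewrite !outer_zero, !qadd_0_r.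
  assert (K1 := H i j). assert (K2 := defect1_mob p Hp i j).
  assert (K3 := outer_unitary v w _ _ _ _ U1 U2 U3 i j).
  assert (K4 := outer_unitary (sX * v)%ser (sX * w)%ser _ _ _ _ U1 U2 U3 i j).
  rewrite <- !smul_assoc, <- !smul_add_r in K4. rewrite Evec in K3, K4. fold u in K3, K4.
  rewrite smul_zero, !outer_zero, !qadd_0_r in K2.
  apply qsub_eq0.
  set (o1 := outer (sc q1) i j) in *. set (o2 := outer (sX * v)%ser i j) in *.
  set (o3 := outer (sX * w)%ser i j) in *. set (o4 := outer a i j) in *.
  set (o5 := outer v i j) in *. set (o6 := outer w i j) in *.
  set (o7 := outer (mob_vec p) i j) in *. set (o8 := outer u i j) in *.
  set (o9 := outer (sX * mob_vec p)%ser i j) in *. set (o10 := outer (sX * u)%ser i j) in *.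
  set (o11 := outer (mob p) i j) in *.
  clearbody o1 o2 o3 o4 o5 o6 o7 o8 o9 o10 o11. clear - K1 K2 K3 K4.
  transitivity ((o9 + o10) + (o11 + o7 - o9) - ((o7 + o8) + o4))%quat; [non_commutative_ring|].
  rewrite K4, K3, <- K2.
  transitivity ((o1 + o2 + o3) - (o4 + o5 + o6))%quat; [non_commutative_ring|].
  rewrite K1; apply qsub_diag. }
assert (Su : ball_series u)
  by (apply ball_series_add; apply ball_series_mul; trivial; apply ball_series_sc).
assert (Sm := ball_series_mob p Hp).
assert (Hmp : power_series (mob p) p = q0).
{ replace (mob p) with ((sX - sc p) * skern p)%ser.
  - apply power_series_mul_root; trivial; [|now apply ball_series_skern|].
    + apply ball_series_sub; auto using ball_series_sX, ball_series_sc.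
    + rewrite power_series_sub, power_series_sc by auto using ball_series_sX, ball_series_sc.
      rewrite <- (has_expansion_eq _ _ p has_expansion_id) by trivial. apply qsub_diag.
  - rewrite <- mob_alt, <- smul_assoc, skern_left. apply sc_1_r. }
assert (Hup : power_series u p = q0).
{ assert (K := outer_eq_apply _ _ _ _ _ _ _ _ _ _ (right_linear_power_series p Hp)
    (right_linear_power_series p Hp) Sm (ball_series_mul _ _ ball_series_sX Su) (ball_series_sc q0)
    Sa Su (ball_series_sc q0) Sm (ball_series_mul _ _ ball_series_sX Su) (ball_series_sc q0)
    Sa Su (ball_series_sc q0) Hu). cbv beta in K.
  rewrite Hmp, Hroot, !power_series_sc, power_series_sX_mul, !qmul_0_l, qadd_0_l, !qadd_0_r, qadd_0_l in K
    by trivial.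
  apply (sqnorm_nz_root p); trivial. rewrite !qmul_conj_r, sqnorm_mul in K.
  exact (f_equal re K). }
set (v' := ((sc q1 - sX * sc (qconj p)) * squotient u p)%ser).
assert (Euv : u = (mob p * v')%ser).
{ unfold v'. rewrite smul_assoc, mob_alt. rewrite (squotient_spec u p Su Hp) at 1.
  rewrite Hup. non_commutative_ring. }
exists v'. apply (outer_eq_smul_cancel (mob p)); [apply mob_nz|].
rewrite sc_1_r, !smul_zero, <- Eag, <- Euv.
replace (mob p * (sX * v'))%ser with (sX * u)%ser; trivial.
rewrite Euv, !smul_assoc, sX_comm. reflexivity.
Qed.

(** The identity with one index zero expresses [v] through [g]; inserted for the other indices, it makes
    the coefficients of [g] from the first one on a geometric sequence. *)
Theorem defect1_mobius_series g v : defect1 g v -> qmod (g O) < 1 ->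
  exists t u, ball1 t /\ qmod u = 1 /\ g = (mob t * sc u)%ser.
Proof.
intros H Hg0.
assert (Hout : forall i j, (outer (sc q1) i j + outer (sX * v)%ser i j = outer g i j + outer v i j)%quat).
{ intros i j. assert (K := H i j). rewrite smul_zero, !outer_zero, !qadd_0_r in K. exact K. }
set (nu := sqnorm (v O)).
assert (H00 : sqnorm (g O) + nu = 1).
{ assert (K := Hout O O). unfold outer in K. rewrite sX_mul_0 in K. simpl in K.
  apply (f_equal re) in K. unfold nu. revert K. generalize (g O), (v O). clear.
  intros [[? ?] [? ?]] [[? ?] [? ?]]; unfold sqnorm, qadd, qmul, qconj, q1, q0, qreal, mkq, re, im_i, im_j, im_k;
  simpl; intros; lra. }
assert (Hnu : 0 < nu).
{ rewrite <- qmod_sqr in H00. pose proof (qmod_pos (g O)). nra. }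
assert (Hi0 : forall i, (g (S i) * qconj (g O) + v (S i) * qconj (v O) = q0)%quat).
{ intros i. assert (K := Hout (S i) O). unfold outer in K. rewrite sX_mul_0 in K.
  change (g (S i) * qconj (g O) + v (S i) * qconj (v O))%quat with
   (g (S i) * qconj (g O) + v (S i) * qconj (v O))%quat in K. rewrite <- K. simpl. clear; quat_ring. }
assert (Hii : forall i j, (v i * qconj (v j) = g (S i) * qconj (g (S j)) + v (S i) * qconj (v (S j)))%quat).
{ intros i j. assert (K := Hout (S i) (S j)). unfold outer in K. rewrite !sX_mul_S in K.
  rewrite <- K. simpl. generalize (v i * qconj (v j))%quat; clear; quat_ring. }
assert (Hv : forall i, (qreal nu * v (S i) = qopp (g (S i) * qconj (g O) * v O))%quat).
{ intros i. assert (K := Hi0 i).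
  assert (K2 := f_equal (fun x => x * v O)%quat K). cbv beta in K2.
  rewrite qmul_add_l, qmul_0_l, <- (qmul_assoc (v (S i))), qmul_conj_l in K2. fold nu in K2.
  rewrite <- qreal_comm in K2. apply qsub_eq0. rewrite <- K2. non_commutative_ring. }
assert (Hrec : forall i, (qreal nu * v i * qconj (v O) = g (S i) * qconj (g 1%nat))%quat).
{ intros i. apply (qmul_cancel_l (qreal nu)).
  { intros E; apply (f_equal re) in E; unfold re in E; simpl in E; lra. }
  assert (Hv1 := f_equal qconj (Hv O)).
  rewrite qconj_mul, qconj_real in Hv1.
  assert (K : (qreal nu * v (S i) * (qconj (v 1%nat) * qreal nu) =
    qreal nu * (qreal (sqnorm (g O)) * (g (S i) * qconj (g 1%nat))))%quat).
  { rewrite Hv, Hv1. unfold nu. generalize (g (S i)), (g 1%nat), (g O), (v O); clear; quat_ring. }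
  transitivity (qreal nu * (qreal nu * (v i * qconj (v O))))%quat; [now rewrite !qmul_assoc|].
  rewrite (Hii i O), !qmul_add_r.
  replace (qreal nu * (qreal nu * (v (S i) * qconj (v 1%nat))))%quat
    with (qreal nu * v (S i) * (qconj (v 1%nat) * qreal nu))%quat
    by (generalize (v (S i)), (qconj (v 1%nat)); clear; quat_ring).
  rewrite K, <- qmul_add_r, <- qmul_add_l, <- qreal_add.
  replace (nu + sqnorm (g O)) with 1 by lra. change (qreal 1) with q1. now rewrite qmul_1_l. }
assert (Hg1 : sqnorm (g 1%nat) = nu * nu).
{ assert (K := Hrec O). rewrite <- qmul_assoc, !qmul_conj_r, <- qreal_mul in K.
  apply (f_equal re) in K. symmetry; exact K. }
set (u := (qreal (/ nu) * g 1%nat)%quat).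
assert (Hu : qmod u = 1).
{ rewrite qmod_sqrt. unfold u; rewrite sqnorm_mul, sqnorm_real, Hg1.
  replace (/ nu * / nu * (nu * nu)) with 1 by (field; lra). apply sqrt_1. }
assert (Eg1 : g 1%nat = (qreal nu * u)%quat).
{ unfold u; rewrite qmul_assoc, <- qreal_mul, Rinv_r by lra. symmetry; apply qmul_1_l. }
assert (Hstep : forall i, g (S (S i)) = qopp (g (S i) * (qconj (g O) * u))%quat).
{ intros i. assert (K := Hrec (S i)). rewrite Hv in K.
  assert (K2 := f_equal (fun x => x * g 1%nat)%quat K). cbv beta in K2.
  rewrite <- (qmul_assoc (g (S (S i)))), qmul_conj_l, Hg1 in K2.
  rewrite Eg1 in K2 at 1.
  apply (qmul_cancel_r (qreal (nu * nu))).
  { intros E; apply (f_equal re) in E; unfold re in E; simpl in E; nra. }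
  rewrite <- K2. unfold nu at 1 2 3. generalize (g (S i)), (v O), (g O), u; clear; quat_ring. }
set (t := qopp (g O * qconj u)).
assert (Ht : qmod t < 1) by (unfold t; rewrite qmod_opp, qmod_mul, qmod_conj, Hu, Rmult_1_r; exact Hg0).
assert (Huu : (qconj u * u = q1)%quat)
  by (rewrite qmul_conj_l, <- qmod_sqr, Hu, Rmult_1_r; reflexivity).
exists t, u; split; [exact Ht|]; split; trivial.
apply functional_extensionality; intros n; rewrite smul_sc_r. unfold mob.
replace (skern t * (sX - sc t))%ser with (sX * skern t - skern t * sc t)%ser
  by (rewrite sX_comm; non_commutative_ring).
unfold ssub; rewrite smul_sc_r. destruct n as [|n].
- rewrite sX_mul_0. unfold skern; simpl. unfold t.
  transitivity (g O * (qconj u * u))%quat; [rewrite Huu; symmetry; apply qmul_1_r|].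
  generalize (g O); intros x; clear; quat_ring.
- rewrite sX_mul_S. unfold skern.
  assert (Htn : sqnorm t = 1 - nu).
  { unfold t. rewrite <- qmod_sqr, qmod_opp, qmod_mul, qmod_conj, Hu, Rmult_1_r, qmod_sqr. lra. }
  assert (Ecoef : ((qconj t ^ n - qconj t ^ S n * t) * u = qconj t ^ n * (qreal nu * u))%quat).
  { change (qconj t ^ S n)%quat with (qconj t * qconj t ^ n)%quat. rewrite qpow_comm.
    rewrite <- (qmul_assoc (qconj t ^ n)), qmul_conj_l, Htn.
    generalize (qconj t ^ n)%quat; clear; quat_ring. }
  rewrite Ecoef, <- Eg1. clear Ecoef.
  induction n as [|n IH]; [simpl; symmetry; apply qmul_1_l|].
  rewrite Hstep, IH, Eg1. simpl. rewrite qpow_comm.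
  unfold t. generalize (qconj (qopp (g O * qconj u)) ^ n)%quat, (g O); clear; quat_ring.
Qed.

(** * Quadratic equations and eigenvectors over the quaternions *)

Lemma quadratic_identity q : (q * q = qreal (2 * re q) * q - qreal (sqnorm q))%quat.
Proof. quat_ring. Qed.

(** Niven's reduction: a root is sought through its trace [t] and norm [n]. *)
Lemma quadratic_root_of_trace_norm b c t n : re b = 0 -> 0 < t * t + sqnorm b ->
  n * n - 2 * n * re c + sqnorm c = n * (t * t + sqnorm b) ->
  t * (t * t + sqnorm b) = 2 * (t * (n - re c) + re (b * c)%quat) ->
  exists q, (q * q + b * q + c = q0)%quat.
Proof.
intros Hb HD E1 E2. set (D := t * t + sqnorm b) in *.
set (y := ((qreal t - b) * (qreal n - c))%quat).
assert (Hy : sqnorm y = D * (n * D)).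
{ unfold y; rewrite sqnorm_mul. rewrite <- E1. f_equal.
  - unfold D. replace (sqnorm (qreal t - b)) with (t * t - 2 * t * re b + sqnorm b)
      by (clear; quat_ring). rewrite Hb; ring.
  - clear; quat_ring. }
assert (Hry : 2 * re y = t * D).
{ rewrite E2. unfold y. transitivity (2 * (t * (n - re c) + re (b * c)%quat - n * re b)).
  - clear; unfold qsub; destruct b as [[? ?] [? ?]], c as [[? ?] [? ?]]; quat_unfold; ring.
  - rewrite Hb; ring. }
assert (Hby : ((qreal t + b) * y = qreal D * (qreal n - c))%quat).
{ unfold y. rewrite qmul_assoc. f_equal. unfold D.
  destruct b as [[b0 ?] [? ?]]. unfold re in Hb; simpl in Hb. subst b0. clear; quat_ring. }
set (q := (qreal (/ D) * y)%quat). exists q.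
assert (Q1 : sqnorm q = n) by (unfold q; rewrite sqnorm_mul, sqnorm_real, Hy; field; lra).
assert (Q2 : 2 * re q = t).
{ transitivity (/ D * (2 * re y)).
  - unfold q. generalize y; clear; intros [[? ?] [? ?]]; quat_unfold; ring.
  - rewrite Hry; field; lra. }
assert (Q3 : ((qreal t + b) * q = qreal n - c)%quat).
{ unfold q. rewrite qmul_assoc, <- qreal_comm, <- qmul_assoc, Hby, qmul_assoc, <- qreal_mul,
    Rinv_l by lra. apply qmul_1_l. }
rewrite quadratic_identity, Q1, Q2.
transitivity ((qreal t + b) * q - qreal n + c)%quat; [non_commutative_ring|].
rewrite Q3. non_commutative_ring.
Qed.

(** Eliminating the norm from the two equations leaves a cubic equation for the square [T] of the
    trace.  Its left-hand side is [- re (b c) ^ 2] at [T = 0] and positive for large [T].  If [re (b c)]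
    vanishes, then [T = 0] is a root, and the solutions are found explicitly. *)
Lemma quadratic_root_imaginary b c : re b = 0 -> exists q, (q * q + b * q + c = q0)%quat.
Proof.
intros Hb. set (B := sqnorm b). set (c0 := re c). set (m := qmod c).
set (d := re (b * c)%quat).
assert (Hm : m * m = sqnorm c) by apply qmod_sqr. assert (Hm0 : 0 <= m) by apply qmod_pos.
assert (HB : 0 <= B) by apply sqnorm_pos.
assert (Hpos : forall T, 0 < T -> T * ((T + B + 2 * c0) * (T + B + 2 * c0)) / 4 - T * (m * m) - d * d = 0 ->
   exists q, (q * q + b * q + c = q0)%quat).
{ intros T HT HF. set (t := sqrt T). assert (Ht : 0 < t) by now apply sqrt_lt_R0.
  assert (Htt : t * t = T) by (apply sqrt_sqrt; lra).
  set (n := (T + B + 2 * c0) / 2 - d / t).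
  assert (Hn : n * n - (T + B + 2 * c0) * n + m * m = 0).
  { apply Rmult_eq_reg_l with T; [|lra].
    transitivity (- (T * ((T + B + 2 * c0) * (T + B + 2 * c0)) / 4 - T * (m * m) - d * d)); [|rewrite HF; ring].
    unfold n. rewrite <- Htt. field; lra. }
  apply (quadratic_root_of_trace_norm b c t n Hb); fold B c0 d; rewrite Htt.
  - lra.
  - rewrite <- Hm. lra.
  - unfold n. field_simplify; lra. }
destruct (Req_dec d 0) as [Hd|Hd].
- destruct (Rlt_le_dec 0 (2 * m - B - 2 * c0)) as [HT|HT].
  + apply (Hpos (2 * m - B - 2 * c0) HT). rewrite Hd. field.
  + destruct (Req_dec B 0) as [HB0|HB0].
    * assert (b = q0) as -> by now apply sqnorm_eq0.
      assert (Hc0 : m <= c0) by lra.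
      exists (qreal (sqrt c0) * mkq 0 1 0 0)%quat.
      assert (Hsq : sqrt c0 * sqrt c0 = c0) by (apply sqrt_sqrt; lra).
      assert (Hc : c = qreal c0).
      { assert (E : sqnorm c <= c0 * c0) by (rewrite <- Hm; nra).
        unfold c0 in *. destruct c as [[x y] [z w]]. unfold sqnorm, re, im_i, im_j, im_k in *; simpl in *.
        assert (y = 0 /\ z = 0 /\ w = 0) as (-> & -> & ->) by (repeat split; nra). reflexivity. }
      rewrite Hc. replace (qreal c0) with (qreal (sqrt c0 * sqrt c0)) by (now rewrite Hsq).
      generalize (sqrt c0); clear; quat_ring.
    * set (S := B + 2 * c0) in *.
      assert (HS : 2 * m <= S) by (unfold S; lra).
      assert (Hdisc : 0 <= S * S - 4 * (m * m)) by nra.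
      set (r := sqrt (S * S - 4 * (m * m))).
      assert (Hr : r * r = S * S - 4 * (m * m)) by now apply sqrt_sqrt.
      apply (quadratic_root_of_trace_norm b c 0 ((S + r) / 2) Hb); fold B c0 d.
      -- lra.
      -- rewrite <- Hm. transitivity ((S + r) / 2 * S - 2 * ((S + r) / 2) * c0); [|unfold S; field].
         enough ((S + r) / 2 * ((S + r) / 2) + m * m = (S + r) / 2 * S) by lra.
         transitivity ((S * S + 2 * S * r + r * r) / 4 + m * m); [field | rewrite Hr; field].
      -- rewrite Hd; ring.
- set (F := fun T => T * ((T + B + 2 * c0) * (T + B + 2 * c0)) / 4 - T * (m * m) - d * d).
  set (T1 := 2 * (m + 1) + 2 * Rabs c0 + d * d + 1).
  pose proof (Rabs_pos c0) as Hc. assert (Hc2 : - Rabs c0 <= c0) by (unfold Rabs; destruct Rcase_abs; lra).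
  assert (HT1 : 0 < T1) by (unfold T1; nra).
  assert (HF0 : F 0 < 0) by (unfold F; assert (0 < d * d) by nra; lra).
  assert (HF1 : 0 < F T1).
  { unfold F. set (G := (T1 + B + 2 * c0) / 2).
    assert (HG : m + 1 <= G) by (unfold G, T1; nra).
    replace (T1 * ((T1 + B + 2 * c0) * (T1 + B + 2 * c0)) / 4) with (T1 * (G * G)) by (unfold G; field).
    assert (1 <= G * G - m * m) by nra.
    assert (T1 * 1 <= T1 * (G * G - m * m)) by (apply Rmult_le_compat_l; lra).
    assert (d * d < T1) by (unfold T1; lra). lra. }
  destruct (IVT F 0 T1) as (T & HT & HFT); trivial.
  + unfold F. intros x. apply derivable_continuous_pt. reg.
  + apply (Hpos T); [|exact HFT]. destruct HT as [[HT|HT] _]; trivial. subst T. lra.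
Qed.

(** Shift the unknown to make [b] imaginary. *)
Lemma quadratic_root b c : exists q, (q * q + b * q + c = q0)%quat.
Proof.
set (be := re b). set (b' := (b - qreal be)%quat).
assert (Hb' : re b' = 0).
{ unfold b', be; destruct b as [[? ?] [? ?]]; quat_unfold; ring. }
destruct (quadratic_root_imaginary b' (c - qreal (be * be / 4) - qreal (be / 2) * b')%quat Hb') as (x & Hx).
exists (x - qreal (be / 2))%quat. rewrite <- Hx.
replace b with (b' + qreal be)%quat by (unfold b'; generalize b, (qreal be); clear; quat_ring).
generalize b', be. clear. intros [[? ?] [? ?]] be.
destruct x as [[? ?] [? ?]], c as [[? ?] [? ?]]; quat_unfold;
  repeat (apply (f_equal2 (@pair _ _))); field.
Qed.

(** Eliminating one coordinate leaves a quadratic equation for the eigenvalue. *)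
Lemma right_eigenvector a11 a12 a21 a22 : exists x1 x2 la,
  sqnorm x1 + sqnorm x2 = 1 /\
  (a11 * x1 + a12 * x2 = x1 * la)%quat /\ (a21 * x1 + a22 * x2 = x2 * la)%quat.
Proof.
assert (H : exists x1 x2 la, 0 < sqnorm x1 + sqnorm x2 /\
  (a11 * x1 + a12 * x2 = x1 * la)%quat /\ (a21 * x1 + a22 * x2 = x2 * la)%quat).
{ destruct (excluded_middle_informative (a21 = q0)) as [E|E].
  - exists q1, q0, a11. subst a21.
    assert (sqnorm q1 = 1) by (clear; quat_ring). assert (sqnorm q0 = 0) by (clear; quat_ring).
    repeat split; [lra | non_commutative_ring | non_commutative_ring].
  - set (d := (a21 * a11 * qinv a21)%quat).
    destruct (quadratic_root (qopp (a22 + d)) (d * a22 - a21 * a12))%quat as (x & Hx).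
    set (y := (qinv a21 * (x - a22))%quat).
    assert (Hy : (a21 * y = x - a22)%quat).
    { unfold y; rewrite qmul_assoc, qmul_inv_r, qmul_1_l; trivial. }
    exists y, q1, x.
    assert (sqnorm q1 = 1) by (clear; quat_ring). pose proof (sqnorm_pos y).
    repeat split; [lra | | rewrite Hy; non_commutative_ring].
    apply (qmul_cancel_l a21); trivial.
    assert (Ha : (a21 * (a11 * y) = d * (x - a22))%quat).
    { rewrite <- Hy. unfold d. rewrite !qmul_assoc, <- (qmul_assoc _ (qinv a21) a21), qmul_inv_l, qmul_1_r; trivial. }
    rewrite qmul_add_r, Ha, !qmul_assoc, Hy. apply qsub_eq0.
    transitivity (qopp (x * x + qopp (a22 + d) * x + (d * a22 - a21 * a12)))%quat;
      [non_commutative_ring|]. rewrite Hx. clear; quat_ring. }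
destruct H as (x1 & x2 & la & Hpos & E1 & E2).
set (r := / sqrt (sqnorm x1 + sqnorm x2)).
assert (Hs : sqrt (sqnorm x1 + sqnorm x2) * sqrt (sqnorm x1 + sqnorm x2) = sqnorm x1 + sqnorm x2)
  by (apply sqrt_sqrt; lra).
assert (Hs0 : 0 < sqrt (sqnorm x1 + sqnorm x2)) by now apply sqrt_lt_R0.
exists (x1 * qreal r)%quat, (x2 * qreal r)%quat, la. repeat split.
- rewrite !sqnorm_mul, sqnorm_real, <- Rmult_plus_distr_r, <- Hs. unfold r. field; lra.
- rewrite !qmul_assoc, <- qmul_add_l, E1, <- !qmul_assoc. now rewrite qreal_comm.
- rewrite !qmul_assoc, <- qmul_add_l, E2, <- !qmul_assoc. now rewrite qreal_comm.
Qed.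

(** * A zero of the Moebius image of a product of two Moebius series *)

Lemma stl_mul_r a b : stl (a * b)%ser = (stl a * sc (b O) + a * stl b)%ser.
Proof.
apply functional_extensionality; intros n; unfold sadd, stl at 1.
now rewrite smul_S_r, smul_sc_r.
Qed.

Lemma stl_skern p : stl (skern p) = (skern p * sc (qconj p))%ser.
Proof. apply functional_extensionality; intros n; rewrite smul_sc_r; apply qpow_comm. Qed.

Lemma stl_mul_sc a c : stl (a * sc c)%ser = (stl a * sc c)%ser.
Proof. apply functional_extensionality; intros n; unfold stl; now rewrite !smul_sc_r. Qed.

Lemma stl_mob p : stl (mob p) = (skern p * sc (qreal (1 - sqnorm p)))%ser.
Proof.
unfold mob. replace (skern p * (sX - sc p))%ser with (sX * skern p - skern p * sc p)%ser
  by (rewrite sX_comm; non_commutative_ring).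
apply functional_extensionality; intros n; unfold stl, ssub.
rewrite sX_mul_S, !smul_sc_r. unfold skern.
change (qconj p ^ S n)%quat with (qconj p * qconj p ^ n)%quat. rewrite qpow_comm.
rewrite <- qmul_assoc, qmul_conj_l. generalize (qconj p ^ n)%quat, (sqnorm p); clear; quat_ring.
Qed.

Lemma mob_0 p : mob p O = qopp p.
Proof. unfold mob. rewrite smul_0. unfold ssub, skern; simpl. clear; quat_ring. Qed.

(** Each Moebius factor is realised by a rotation of the pair of state and input. *)
Lemma colligation_isometry p s x y : s * s = 1 - sqnorm p ->
  sqnorm (qconj p * x + qreal s * y) + sqnorm (qreal s * x - p * y) = sqnorm x + sqnorm y.
Proof.
intros Hs. transitivity ((sqnorm p + s * s) * (sqnorm x + sqnorm y)); [|rewrite Hs; ring].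
clear; quat_ring.
Qed.

Lemma sqnorm_pair_le a b x y : sqnorm (a * x + b * y) <= (sqnorm a + sqnorm b) * (sqnorm x + sqnorm y).
Proof.
assert (H := qmod_triangle (a * x) (b * y)). rewrite !qmod_mul in H.
pose proof (qmod_pos a); pose proof (qmod_pos b); pose proof (qmod_pos x); pose proof (qmod_pos y).
pose proof (qmod_pos (a * x + b * y)%quat).
rewrite <- !qmod_sqr. set (A := qmod a) in *; set (B := qmod b) in *.
set (X := qmod x) in *; set (Y := qmod y) in *.
apply Rle_trans with ((A * X + B * Y) * (A * X + B * Y)).
- apply Rmult_le_compat; trivial.
- pose proof (Rle_0_sqr (A * Y - B * X)) as Q; unfold Rsqr in Q. lra.
Qed.

Lemma defect1_mul_unit g v u : qmod u = 1 -> defect1 g v -> defect1 (g * sc u)%ser v.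
Proof.
intros Hu H i j. rewrite (H i j). do 2 f_equal. unfold outer; rewrite !smul_sc_r.
rewrite qconj_mul, qmul_assoc, <- (qmul_assoc (g i)), qmul_conj_r, <- qmod_sqr, Hu.
replace (qreal (1 * 1)) with q1 by (clear; quat_ring). now rewrite qmul_1_r.
Qed.

Lemma colligation_row1 P S T t u g p x1 x2 :
  (P * x1 + S * (T * x2 - t * (u * (g * (S * x1 - p * (T * x2))))) =
   (P - S * (t * u) * g * S) * x1 + (S * T + S * (t * u) * g * (p * T)) * x2)%quat.
Proof. quat_expand. Qed.

Lemma colligation_row2 Q S T u g p x1 x2 :
  (Q * x2 + T * (u * (g * (S * x1 - p * (T * x2)))) =
   T * u * g * S * x1 + (Q - T * u * g * (p * T)) * x2)%quat.
Proof. quat_expand. Qed.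

(** The defect vectors [v1], [v2] of the product [phi] span, after multiplication by [b], a
    two-dimensional right space that is invariant under the backward shift.  A right eigenvector of
    the shift on it is a geometric series, that is the kernel at a point [z] times a constant; the
    colligation isometries show that the eigenvalue has modulus less than one.  The normalised kernel at
    [z] thus is a unit vector of the defect space of [a], and the diagonal of the defect identity at
    [z] leaves [|a(z)|^2 <= 0]. *)
Theorem mobius_image_of_product_has_zero p t u c b a :
  ball1 p -> ball1 t -> ball1 c -> qmod u = 1 ->
  (b * (sc q1 - mob p * (mob t * sc u) * sc (qconj c)) = sc q1)%ser ->
  a = (b * (mob p * (mob t * sc u) - sc c))%ser -> ball_series a ->
  exists z, ball1 z /\ power_series a z = q0.
Proof.
intros Hp Ht Hc Hu Hb Ea Sa.
set (phi := (mob p * (mob t * sc u))%ser) in *.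
assert (Hp1 := proj1 (ball1_sqnorm p) Hp). assert (Ht1 := proj1 (ball1_sqnorm t) Ht).
assert (Hc1 := proj1 (ball1_sqnorm c) Hc).
set (sp := sqrt (1 - sqnorm p)). set (st := sqrt (1 - sqnorm t)). set (sg := sqrt (1 - sqnorm c)).
assert (Hsp : sp * sp = 1 - sqnorm p) by (apply sqrt_sqrt; lra).
assert (Hst : st * st = 1 - sqnorm t) by (apply sqrt_sqrt; lra).
assert (Hsg : sg * sg = 1 - sqnorm c) by (apply sqrt_sqrt; lra).
assert (Hsp0 : 0 < sp) by (apply sqrt_lt_R0; lra).
assert (Hst0 : 0 < st) by (apply sqrt_lt_R0; lra).
set (v1 := mob_vec p). set (v2 := (mob p * mob_vec t)%ser).
assert (Hdef : defect2 phi v1 v2).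
{ apply defect2_mob_mul; trivial. apply defect1_mul_unit; trivial. now apply defect1_mob. }
(* the backward shift on the state space *)
assert (E1 : stl v1 = (v1 * sc (qconj p))%ser).
{ unfold v1, mob_vec. fold sp. rewrite stl_mul_sc, stl_skern, <- !smul_assoc.
  now rewrite sc_real_comm. }
assert (Esk : (skern p * sc (qreal (1 - sqnorm p)) = v1 * sc (qreal sp))%ser).
{ unfold v1, mob_vec. fold sp. rewrite <- smul_assoc, <- sc_mul, <- qreal_mul, Hsp. reflexivity. }
assert (Evt : stl (mob_vec t) = (mob_vec t * sc (qconj t))%ser).
{ unfold mob_vec. fold st. rewrite stl_mul_sc, stl_skern, <- !smul_assoc.
  now rewrite sc_real_comm. }
assert (E2 : stl v2 = (v1 * sc (qreal sp * qreal st)%quat + v2 * sc (qconj t))%ser).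
{ unfold v2. rewrite stl_mul_r, stl_mob, Evt, Esk.
  replace (mob_vec t O) with (qreal st)
    by (unfold mob_vec; rewrite smul_sc_r; fold st; unfold skern; simpl; symmetry; apply qmul_1_l).
  rewrite sc_mul. non_commutative_ring. }
assert (Et : stl (mob t * sc u)%ser = (mob_vec t * sc (qreal st * u)%quat)%ser).
{ rewrite stl_mul_sc, stl_mob. unfold mob_vec. fold st.
  rewrite <- Hst, qreal_mul, !sc_mul. non_commutative_ring. }
assert (Ephi : stl phi = (v1 * sc (qopp (qreal sp * (t * u)))%quat + v2 * sc (qreal st * u)%quat)%ser).
{ unfold phi. rewrite stl_mul_r, stl_mob, Esk, Et.
  replace ((mob t * sc u)%ser O) with (qopp (t * u))
    by (rewrite smul_sc_r, mob_0; clear; quat_ring).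
  replace (sc (qopp (qreal sp * (t * u))))%quat with (sc (qreal sp) * sc (qopp (t * u)))%ser
    by (rewrite <- sc_mul; f_equal; generalize (qreal sp), (t * u)%quat; clear; quat_ring).
  unfold v2. non_commutative_ring. }
set (e := b O).
assert (Hphi0 : phi O = (p * t * u)%quat).
{ unfold phi; rewrite smul_0, smul_sc_r, !mob_0. clear; quat_ring. }
assert (He : (e * (q1 - phi O * qconj c) = q1)%quat).
{ assert (K := f_equal (fun s => s O) Hb). cbv beta in K. rewrite smul_0 in K.
  unfold ssub in K. rewrite smul_sc_r in K. exact K. }
assert (He' : ((q1 - phi O * qconj c) * e = q1)%quat).
{ set (f := (q1 - phi O * qconj c)%quat) in *.
  assert (He0 : e <> q0).
  { intros Z; rewrite Z, qmul_0_l in He. apply (f_equal re) in He. unfold re in He; simpl in He; lra. }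
  apply (qmul_cancel_l e); trivial. rewrite qmul_assoc, He. non_commutative_ring. }
assert (Eb : stl b = (b * stl phi * sc (qconj c * e)%quat)%ser).
{ assert (Eb1 : b = (sc q1 + b * (phi * sc (qconj c)))%ser) by (rewrite <- Hb; non_commutative_ring).
  assert (Eb2 := f_equal stl Eb1).
  assert (Eb3 : stl (sc q1 + b * (phi * sc (qconj c)))%ser =
     (stl b * sc (phi O * qconj c)%quat + b * stl phi * sc (qconj c))%ser).
  { transitivity (stl (b * (phi * sc (qconj c))))%ser.
    - apply functional_extensionality; intros n; unfold stl, sadd; simpl.
      generalize ((b * (phi * sc (qconj c)))%ser (S n)); clear; quat_ring.
    - rewrite stl_mul_r, smul_sc_r, stl_mul_sc. non_commutative_ring. }
  rewrite Eb3 in Eb2. clear Eb3.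
  assert (Eb4 : (stl b * sc (q1 - phi O * qconj c)%quat = b * stl phi * sc (qconj c))%ser).
  { replace (sc (q1 - phi O * qconj c)%quat) with (sc q1 - sc (phi O * qconj c)%quat)%ser.
    - transitivity (stl b - stl b * sc (phi O * qconj c)%quat)%ser; [non_commutative_ring|].
      rewrite Eb2 at 1. non_commutative_ring.
    - apply functional_extensionality; intros [|n]; unfold ssub; simpl; trivial. clear; quat_ring. }
  rewrite sc_mul, smul_assoc, <- Eb4, <- smul_assoc, <- sc_mul, He'. symmetry; apply sc_1_r. }
(* the matrix of the shift on the span of [b v1] and [b v2] *)
destruct (right_eigenvector
  (qconj p - qreal sp * (t * u) * (qconj c * e) * qreal sp)
  (qreal sp * qreal st + qreal sp * (t * u) * (qconj c * e) * (p * qreal st))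
  (qreal st * u * (qconj c * e) * qreal sp)
  (qconj t - qreal st * u * (qconj c * e) * (p * qreal st)))%quat
  as (x1 & x2 & la & Hx & X1 & X2).
set (ka := (qreal sp * x1 - p * (qreal st * x2))%quat).
set (eta := (qconj c * e * ka)%quat).
assert (X1' : (qconj p * x1 + qreal sp * (qreal st * x2 - t * (u * eta)) = x1 * la)%quat).
{ rewrite <- X1. apply colligation_row1. }
assert (X2' : (qconj t * x2 + qreal st * (u * eta) = x2 * la)%quat).
{ rewrite <- X2. apply colligation_row2. }
set (V := (v1 * sc x1 + v2 * sc x2)%ser).
assert (HV0 : V O = ka).
{ unfold V, sadd, v2, v1, mob_vec, ka. rewrite !smul_sc_r, smul_0, mob_0, smul_sc_r. fold sp st.
  unfold skern; simpl. clear; quat_ring. }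
set (h := (b * V)%ser).
assert (Hh0 : h O = (e * ka)%quat) by (unfold h; now rewrite smul_0, HV0).
assert (Hshift : stl h = (h * sc la)%ser).
{ unfold h. rewrite stl_mul_r, HV0, Eb, Ephi.
  assert (EV : stl V = (v1 * sc (qconj p * x1 + qreal sp * (qreal st * x2))%quat + v2 * sc (qconj t * x2)%quat)%ser).
  { unfold V. replace (stl (v1 * sc x1 + v2 * sc x2)%ser) with (stl v1 * sc x1 + stl v2 * sc x2)%ser.
    - rewrite E1, E2. apply functional_extensionality; intros n; unfold sadd; rewrite !smul_sc_r.
      unfold sadd; rewrite ?smul_sc_r. quat_expand.
    - rewrite <- !stl_mul_sc. reflexivity. }
  rewrite EV.
  transitivity (b * (v1 * sc (x1 * la)%quat + v2 * sc (x2 * la)%quat))%ser.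
  - rewrite <- X1', <- X2'.
    rewrite <- !smul_assoc, <- sc_mul, <- smul_add_r. f_equal.
    replace (qconj c * e * ka)%quat with eta by reflexivity.
    apply functional_extensionality; intros n; unfold sadd; rewrite !smul_sc_r.
    unfold sadd; rewrite ?smul_sc_r. quat_expand.
  - rewrite <- smul_assoc. f_equal. unfold V.
    apply functional_extensionality; intros n; unfold sadd; rewrite !smul_sc_r.
    unfold sadd; rewrite ?smul_sc_r. quat_expand. }
(* both rotations preserve norms; the output [e ka] of one is fed back, scaled by [conj c] *)
assert (Hnorm : sqnorm la + (1 - sqnorm c) * sqnorm (e * ka) = 1).
{ assert (I1 := colligation_isometry p sp x1 (qreal st * x2 - t * (u * eta))%quat Hsp).
  assert (I2 := colligation_isometry t st x2 (u * eta)%quat Hst).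
  rewrite X1' in I1. rewrite X2' in I2. rewrite !sqnorm_mul in I1, I2.
  assert (Hout : (qreal sp * x1 - p * (qreal st * x2 - t * (u * eta)) = e * ka)%quat).
  { transitivity (ka + p * t * u * eta)%quat; [unfold ka; quat_expand|].
    rewrite <- Hphi0. unfold eta.
    transitivity (ka + (e - (q1 - phi O * qconj c) * e) * ka)%quat;
      [rewrite !qmul_sub_l, !qmul_1_l; quat_expand|].
    rewrite He'. non_commutative_ring. }
  rewrite Hout in I1. rewrite sqnorm_mul in I1.
  assert (Heta : sqnorm eta = sqnorm c * (sqnorm e * sqnorm ka))
    by (unfold eta; rewrite !sqnorm_mul, sqnorm_conj; ring).
  assert (Hu1 : sqnorm u = 1) by (rewrite <- qmod_sqr, Hu; ring).
  rewrite (sqnorm_mul u), Heta, Hu1 in I2. rewrite sqnorm_mul.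
  replace (sqnorm la) with ((sqnorm x1 + sqnorm x2) * sqnorm la) by (rewrite Hx; ring). lra. }
assert (Hgeo : forall n, h n = (h O * la ^ n)%quat).
{ induction n as [|n IH]; [simpl; symmetry; apply qmul_1_r|].
  change (h (S n)) with (stl h n). rewrite Hshift, smul_sc_r, IH.
  simpl. now rewrite qpow_comm, qmul_assoc. }
(* otherwise [V] would vanish; evaluate at [p] to obtain [x1 = 0], and then [x2 = 0] *)
assert (Hh0nz : h O <> q0).
{ intros Z.
  assert (Hz : V = sc q0).
  { apply (smul_cancel_l b).
    - intros K; rewrite K, zero_smul in Hb. apply (f_equal (fun s => re (s O))) in Hb.
      unfold re in Hb; simpl in Hb; lra.
    - rewrite smul_zero. apply functional_extensionality; intros n; rewrite sc_q0.
      fold h. rewrite Hgeo, Z. apply qmul_0_l. }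
  assert (Hmul : (sc (qreal sp * x1)%quat + (sX - sc p) * (mob_vec t * sc x2) = sc q0)%ser).
  { transitivity ((sc q1 - sX * sc (qconj p)) * V)%ser; [|rewrite Hz; apply smul_zero].
    unfold V, v1, v2, mob_vec at 2, mob. fold sp.
    transitivity (((sc q1 - sX * sc (qconj p)) * skern p) * sc (qreal sp) * sc x1
      + ((sc q1 - sX * sc (qconj p)) * skern p) * (sX - sc p) * (mob_vec t * sc x2))%ser;
      [rewrite skern_left, sc_mul; non_commutative_ring | non_commutative_ring]. }
  assert (Sy : ball_series (mob_vec t * sc x2)%ser)
    by (apply (ball_series_mul (mob_vec t)); [now apply ball_series_mob_vec | apply ball_series_sc]).
  assert (Sxp : ball_series (sX - sc p)%ser)
    by (apply ball_series_sub; auto using ball_series_sX, ball_series_sc).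
  assert (Zp : power_series (sX - sc p)%ser p = q0).
  { rewrite power_series_sub, power_series_sc by auto using ball_series_sX, ball_series_sc.
    rewrite <- (has_expansion_eq _ _ p has_expansion_id) by trivial. apply qsub_diag. }
  assert (Zx1 : x1 = q0).
  { assert (K := f_equal (fun s => power_series s p) Hmul). cbv beta in K.
    rewrite power_series_add, !power_series_sc, power_series_mul_root, qadd_0_r in K;
      auto using ball_series_sc, ball_series_mul.
    apply qmul_integral in K; destruct K as [K|K]; trivial.
    exfalso; apply (f_equal re) in K; unfold re in K; simpl in K; lra. }
  rewrite Zx1, qmul_0_r in Hmul.
  assert (K : ((sX - sc p) * (mob_vec t * sc x2) = sc q0)%ser) by (rewrite <- Hmul; non_commutative_ring).
  apply smul_integral in K; destruct K as [K|K]; [now apply (sX_sub_nz p)|].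
  apply (f_equal (fun s => s O)) in K. unfold mob_vec in K. rewrite !smul_sc_r in K. fold st in K.
  unfold skern in K; simpl in K. rewrite qmul_1_l in K.
  apply qmul_integral in K; destruct K as [K|K].
  - apply (f_equal re) in K; unfold re in K; simpl in K; lra.
  - rewrite Zx1, K in Hx. revert Hx. assert (sqnorm q0 = 0) by (clear; quat_ring). lra. }
set (z := qconj (h O * la * qinv (h O))%quat).
assert (Hzh : (qconj z * h O = h O * la)%quat).
{ unfold z; rewrite qconj_conj, <- qmul_assoc, qmul_inv_l, qmul_1_r; trivial. }
assert (Hzn : sqnorm z = sqnorm la).
{ unfold z. rewrite sqnorm_conj, !sqnorm_mul.
  assert (sqnorm (h O) * sqnorm (qinv (h O)) = 1).
  { rewrite <- sqnorm_mul, qmul_inv_r by trivial. clear; quat_ring. }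
  transitivity (sqnorm la * (sqnorm (h O) * sqnorm (qinv (h O)))); [ring | rewrite H; ring]. }
rewrite <- Hh0 in Hnorm.
assert (Hpos := sqnorm_gt0 _ Hh0nz).
assert (Hzb : ball1 z).
{ apply ball1_sqnorm. rewrite Hzn.
  assert (0 < (1 - sqnorm c) * sqnorm (h O)) by (apply Rmult_lt_0_compat; lra). lra. }
assert (Hz1 := proj1 (ball1_sqnorm z) Hzb). assert (Hz0 := sqnorm_pos z).
exists z; split; trivial.
assert (Hker : h = (skern z * sc (h O))%ser).
{ apply functional_extensionality; intros n. rewrite Hgeo, smul_sc_r. unfold skern.
  symmetry; now apply qpow_conj_by. }
assert (Hda := defect2_mobius phi v1 v2 c b Hc Hdef Hb). cbv zeta in Hda. fold sg in Hda.
rewrite <- Ea in Hda.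
set (w1 := (b * v1 * sc (qreal sg))%ser) in *. set (w2 := (b * v2 * sc (qreal sg))%ser) in *.
destruct (defect2_ball_series _ _ _ Hda) as [Sw1 Sw2].
assert (Ehw : (w1 * sc x1 + w2 * sc x2 = skern z * sc (h O * qreal sg)%quat)%ser).
{ rewrite sc_mul, smul_assoc, <- Hker. unfold h, V, w1, w2.
  rewrite <- !smul_assoc, !(sc_real_comm sg). rewrite !smul_assoc, <- smul_add_l.
  rewrite <- !smul_assoc, <- smul_add_r. now rewrite !smul_assoc. }
set (W1 := power_series w1 z). set (W2 := power_series w2 z).
assert (EW : (W1 * x1 + W2 * x2 = qreal (/ (1 - sqnorm z)) * (h O * qreal sg))%quat).
{ assert (K := f_equal (fun s => power_series s z) Ehw). cbv beta in K.
  rewrite power_series_add, !power_series_mul_sc, power_series_skern_at in K;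
    auto using ball_series_skern, ball_series_mul, ball_series_sc. }
assert (Hzz := outer_eq_apply _ _ _ _ _ _ _ _ _ _ (right_linear_power_series z Hzb)
  (right_linear_power_series z Hzb)
  (ball_series_sc q1) (ball_series_mul _ _ ball_series_sX Sw1) (ball_series_mul _ _ ball_series_sX Sw2)
  Sa Sw1 Sw2
  (ball_series_sc q1) (ball_series_mul _ _ ball_series_sX Sw1) (ball_series_mul _ _ ball_series_sX Sw2)
  Sa Sw1 Sw2 Hda).
cbv beta in Hzz. rewrite power_series_sc, !power_series_sX_mul, !qmul_conj_r, !sqnorm_mul in Hzz by trivial.
fold W1 W2 in Hzz.
rewrite <- !qreal_add in Hzz. apply (f_equal re) in Hzz. unfold re, qreal, mkq in Hzz; simpl in Hzz.
assert (CS := sqnorm_pair_le W1 W2 x1 x2). rewrite Hx, EW, !sqnorm_mul, !sqnorm_real, Hsg in CS.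
set (k := 1 - sqnorm z) in *.
assert (Hk : 0 < k) by (unfold k; lra).
assert (Hsgh : sqnorm (h O) * (1 - sqnorm c) = k) by (unfold k; rewrite Hzn; lra).
(* Cauchy-Schwarz for [EW]; the defect identity at [z] then gives
   [|a(z)|^2 = 1 - k (|W1|^2 + |W2|^2) <= 0] *)
assert (HW : 1 <= k * (sqnorm W1 + sqnorm W2)).
{ apply Rmult_le_compat_l with (r := k) in CS; [|lra].
  rewrite Hsgh in CS.
  replace (k * (/ k * / k * k)) with 1 in CS by (field; lra). lra. }
assert (sqnorm q1 = 1) by (clear; quat_ring).
apply sqnorm_eq0, Rle_antisym; [|apply sqnorm_pos].
unfold k in *. lra.
Qed.

(** * Moebius images of contractive series *)

(** [phi] is the series of [M_c . a], written without denominators. *)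
Definition mobius_image (c : quat) (a phi : ser) : Prop :=
  ((sc q1 - a * sc (qconj c)) * phi = a - sc c)%ser.

Lemma mobius_image_left c a phi b : (b * (sc q1 - a * sc (qconj c)) = sc q1)%ser ->
  mobius_image c a phi -> phi = (b * (a - sc c))%ser.
Proof. intros Hb H. rewrite <- H, smul_assoc, Hb. symmetry; apply sc_1_l. Qed.

Lemma mobius_image_right c a phi : contractive a -> ball1 c -> mobius_image c a phi ->
  exists b, ball_series b /\ ((sc q1 - sc (qconj c) * a) * b = sc q1)%ser /\
    (b * (sc q1 - sc (qconj c) * a) = sc q1)%ser /\ phi = ((a - sc c) * b)%ser.
Proof.
intros Ha Hc H. destruct (mobius_denominators a c Ha Hc) as (b & b' & _ & Sb' & _ & B2 & B3 & B4 & B5).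
exists b'; repeat split; trivial. rewrite <- B5. now apply mobius_image_left.
Qed.

Lemma mobius_image_exists c a : contractive a -> ball1 c -> exists phi, mobius_image c a phi.
Proof.
intros Ha Hc. destruct (mobius_denominators a c Ha Hc) as (b & _ & _ & _ & B1 & _).
exists (b * (a - sc c))%ser. unfold mobius_image. rewrite smul_assoc, B1. apply sc_1_l.
Qed.

Lemma contractive_mobius_image c a phi : contractive a -> ball1 c -> mobius_image c a phi ->
  contractive phi.
Proof.
intros Ha Hc H. destruct (mobius_image_right c a phi Ha Hc H) as (b & _ & B & _ & ->).
now apply contractive_mobius.
Qed.

Lemma ball1_opp c : ball1 c -> ball1 (qopp c).
Proof. unfold ball1; now rewrite qmod_opp. Qed.

(** The left and right denominators give the same transform, which is why [M_{-c}] undoes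
    [M_c]. *)
Lemma mobius_image_inverse c a phi : contractive a -> ball1 c -> mobius_image c a phi ->
  mobius_image (qopp c) phi a.
Proof.
intros Ha Hc H. destruct (mobius_image_right c a phi Ha Hc H) as (b & _ & _ & B & E).
assert (K : (phi * (sc q1 - sc (qconj c) * a) = a - sc c)%ser).
{ rewrite E, <- smul_assoc, B. apply sc_1_r. }
unfold mobius_image.
assert (E1 : sc (qopp c) = sopp (sc c)).
{ apply functional_extensionality; intros [|n]; unfold sopp; simpl; trivial. clear; quat_ring. }
assert (E2 : sc (qconj (qopp c)) = sopp (sc (qconj c))).
{ apply functional_extensionality; intros [|n]; unfold sopp; simpl; clear; quat_ring. }
rewrite E1, E2.
transitivity (a + phi - phi * (sc q1 - sc (qconj c) * a))%ser; [|rewrite K]; non_commutative_ring.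
Qed.

Lemma mobius_image_root c a phi q : contractive a -> ball1 c -> ball1 q ->
  mobius_image c a phi -> power_series a q = c -> power_series phi q = q0.
Proof.
intros Ha Hc Hq H E. destruct (mobius_image_right c a phi Ha Hc H) as (b & Sb & _ & _ & ->).
assert (Sa := contractive_ball_series a Ha).
apply power_series_mul_root; trivial.
- apply ball_series_sub; trivial; apply ball_series_sc.
- rewrite power_series_sub, power_series_sc, E by auto using ball_series_sc. apply qsub_diag.
Qed.

Lemma has_expansion_mobius_act c g a phi : has_expansion g a -> contractive a -> ball1 c ->
  mobius_image c a phi -> has_expansion (mobius_act c g) phi.
Proof.
intros Hg Ha Hc H. destruct (mobius_denominators a c Ha Hc) as (b & _ & Sb & _ & B1 & B2 & _).
rewrite (mobius_image_left c a phi b B2 H). unfold mobius_act.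
apply has_expansion_star; [|now apply has_expansion_sub_const].
apply (has_expansion_star_inv _ (sc q1 - a * sc (qconj c))%ser); trivial.
apply (has_expansion_sub (fun _ => q1) (fun q => g q * qconj c)%quat).
- apply has_expansion_const.
- now apply has_expansion_mul_const.
Qed.

Lemma defect2_mobius_image c a phi v w : contractive a -> ball1 c -> mobius_image c a phi ->
  defect2 a v w -> exists v' w', defect2 phi v' w'.
Proof.
intros Ha Hc H D. destruct (mobius_denominators a c Ha Hc) as (b & _ & _ & _ & _ & B2 & _).
rewrite (mobius_image_left c a phi b B2 H). eexists _, _. now apply defect2_mobius.
Qed.

Lemma defect1_mobius_image c a phi v : contractive a -> ball1 c -> mobius_image c a phi ->
  defect1 a v -> exists v', defect1 phi v'.
Proof.
intros Ha Hc H D. destruct (mobius_denominators a c Ha Hc) as (b & _ & _ & _ & _ & B2 & _).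
rewrite (mobius_image_left c a phi b B2 H). now apply (defect1_mobius a v).
Qed.

(** * Series of degree zero, one and two *)

Definition unimodular (a : ser) : Prop := exists u, qmod u = 1 /\ a = sc u.

Definition mobius_series (a : ser) : Prop :=
  exists z u, ball1 z /\ qmod u = 1 /\ a = (mob z * sc u)%ser.

Lemma strict_or_unimodular a : contractive a ->
  unimodular a \/ forall q, ball1 q -> ball1 (power_series a q).
Proof.
intros Ha. destruct (excluded_middle_informative (unimodular a)) as [H|H]; [now left|right].
intros q Hq. assert (B := contractive_bound a q Ha Hq).
destruct (Rle_lt_or_eq_dec _ _ B) as [L|E]; trivial.
exfalso; apply H. exists (power_series a q); split; trivial. now apply contractive_maximum.
Qed.

Lemma ball1_0 : ball1 q0.
Proof. unfold ball1; rewrite qmod_0; lra. Qed.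

Lemma power_series_0 a : ball_series a -> power_series a q0 = a O.
Proof. intros Sa. rewrite power_series_head by auto using ball1_0. now rewrite qmul_0_l, qadd_0_r. Qed.

Lemma defect1_mobius_mul p g : ball1 p -> unimodular g -> exists v, defect1 (mob p * g)%ser v.
Proof.
intros Hp (u & Hu & ->). exists (mob_vec p). apply defect1_mul_unit; trivial. now apply defect1_mob.
Qed.

Lemma defect1_cases a v : contractive a -> defect1 a v -> unimodular a \/ mobius_series a.
Proof.
intros Ha D. destruct (strict_or_unimodular a Ha) as [U|U]; [now left|right].
apply (defect1_mobius_series a v D).
rewrite <- power_series_0 by now apply contractive_ball_series. apply U, ball1_0.
Qed.

Lemma unimodular_not_strict a : unimodular a -> ~ forall q, ball1 q -> ball1 (power_series a q).
Proof.
intros (u & Hu & ->) H. specialize (H q0 ball1_0). rewrite power_series_sc in H by apply ball1_0.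
unfold ball1 in H; lra.
Qed.

Lemma mob_root t q : ball1 t -> ball1 q -> power_series (mob t) q = q0 -> q = t.
Proof.
intros Ht Hq H.
assert (K := f_equal (fun s => power_series s q) (mob_alt t)). cbv beta in K.
rewrite power_series_mul_root in K; trivial.
- rewrite power_series_sub, power_series_sc in K by auto using ball_series_sX, ball_series_sc.
  rewrite <- (has_expansion_eq _ _ q has_expansion_id) in K by trivial.
  symmetry in K. now apply qsub_eq0.
- now apply ball_series_mob.
- apply ball_series_sub; [apply ball_series_sc|].
  apply (ball_series_mul sX); [apply ball_series_sX | apply ball_series_sc].
Qed.

(** The Moebius action preserves the rank of the defect, and rank at most one characterises the
    Moebius series and the unimodular constants. *)
Lemma mobius_series_of_unimodular_quotient a c p g : contractive a ->
  (forall q, ball1 q -> ball1 (power_series a q)) -> ball1 c -> ball1 p ->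
  mobius_image c a (mob p * g)%ser -> unimodular g -> mobius_series a.
Proof.
intros Ha Hs Hc Hp H U. destruct (defect1_mobius_mul p g Hp U) as (v & D).
assert (Cphi := contractive_mobius_image _ _ _ Ha Hc H).
destruct (defect1_mobius_image _ _ _ v Cphi (ball1_opp c Hc) (mobius_image_inverse _ _ _ Ha Hc H) D)
  as (v' & D').
destruct (defect1_cases a v' Ha D') as [K|K]; trivial. now destruct (unimodular_not_strict a K).
Qed.

(** A defect of rank one for [g] becomes one of rank two for [a].  Dividing by the Moebius factor of a
    zero of [a] lowers it to one again, and the quotient is the second factor. *)
Lemma degree_two_of_quotient a c p g v : contractive a ->
  (forall q, ball1 q -> ball1 (power_series a q)) -> ~ mobius_series a -> ball1 c -> ball1 p ->
  mobius_image c a (mob p * g)%ser -> contractive g -> defect1 g v ->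
  exists z w u, ball1 z /\ ball1 w /\ qmod u = 1 /\ a = (mob z * (mob w * sc u))%ser.
Proof.
intros Ha Hs Hn Hc Hp H Cg D.
assert (Cphi := contractive_mobius_image _ _ _ Ha Hc H).
assert (Hinv := mobius_image_inverse _ _ _ Ha Hc H). assert (Hc' := ball1_opp c Hc).
assert (Sa := contractive_ball_series a Ha).
destruct (defect1_cases g v Cg D) as [U|(t & u & Ht & Hu & Eg)].
{ exfalso; apply Hn. now apply (mobius_series_of_unimodular_quotient a c p g). }
destruct (mobius_denominators _ _ Cphi Hc') as (b & _ & _ & _ & _ & B2 & _).
assert (Ea := mobius_image_left _ _ _ b B2 Hinv).
destruct (mobius_image_of_product_has_zero p t u (qopp c) b a) as (z & Hz & Zz); trivial.
{ rewrite <- Eg; exact B2. } { rewrite <- Eg; exact Ea. }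
destruct (defect2_mobius_image _ _ _ _ _ Cphi Hc' Hinv (defect2_mob_mul p g v Hp D)) as (v' & w' & D2).
destruct (schur_division a z Ha Hz Zz) as [Ez Ch]. cbv zeta in Ez, Ch.
set (h := ((sc q1 - sX * sc (qconj z)) * squotient a z)%ser) in *.
destruct (defect2_division z a h v' w' Hz Sa Ez Zz D2) as (v'' & D1).
destruct (defect1_cases h v'' Ch D1) as [(u' & Hu' & E')|(w & u' & Hw & Hu' & E')].
- exfalso; apply Hn. exists z, u'. now rewrite <- E'.
- exists z, w, u'. now rewrite <- E'.
Qed.

(** The Moebius image of [a] keeps the rank two of [a], and the division by [mob p] lowers it to one. *)
Lemma defect1_quotient_of_degree_two a c p g z w u : contractive a -> ball1 c -> ball1 p ->
  mobius_image c a (mob p * g)%ser -> power_series a p = c ->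
  ball1 z -> ball1 w -> qmod u = 1 -> a = (mob z * (mob w * sc u))%ser ->
  exists v, defect1 g v.
Proof.
intros Ha Hc Hp H Epc Hz Hw Hu Ea.
assert (D : defect2 a (mob_vec z) (mob z * mob_vec w)%ser).
{ rewrite Ea. apply defect2_mob_mul; trivial. apply defect1_mul_unit; trivial. now apply defect1_mob. }
destruct (defect2_mobius_image _ _ _ _ _ Ha Hc H D) as (v1 & w1 & D1).
assert (Cphi := contractive_mobius_image _ _ _ Ha Hc H).
apply (defect2_division p (mob p * g)%ser g v1 w1); trivial.
- now apply contractive_ball_series.
- now apply (mobius_image_root c a).
Qed.

(** The product [mob s * h] has a defect of rank at most one together with [g].  As it vanishes at
    [s], it must then be the Moebius series of [s] times a constant. *)
Lemma defect1_iff_unimodular_quotient g d s h : contractive g -> ball1 d -> ball1 s ->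
  mobius_image d g (mob s * h)%ser -> power_series g s = d ->
  (exists v, defect1 g v) <-> unimodular h.
Proof.
intros Cg Hd Hs H Ed.
assert (Cpsi := contractive_mobius_image _ _ _ Cg Hd H).
split; [intros (v & D) | intros U].
- destruct (defect1_mobius_image _ _ _ v Cg Hd H D) as (v' & D').
  assert (Z := mobius_image_root _ _ _ s Cg Hd Hs H Ed).
  destruct (defect1_cases _ v' Cpsi D') as [(u & Hu & E)|(t & u & Ht & Hu & E)].
  + rewrite E, power_series_sc in Z by trivial. rewrite Z, qmod_0 in Hu. lra.
  + exists u; split; trivial. rewrite E, power_series_mul_sc in Z by (trivial; now apply ball_series_mob).
    apply qmul_integral in Z. destruct Z as [Z|Z].
    * apply (mob_root t s Ht Hs) in Z. subst t. apply (smul_cancel_l (mob s)); trivial. apply mob_nz.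
    * rewrite Z, qmod_0 in Hu. lra.
- destruct (defect1_mobius_mul s h Hs U) as (v & D).
  exact (defect1_mobius_image _ _ _ v Cpsi (ball1_opp d Hd) (mobius_image_inverse _ _ _ Cg Hd H) D).
Qed.

(** * Moebius transformations are bijective *)

Lemma mob_equation z q : ball1 z -> ball1 q -> let m := power_series (mob z) q in
  (m - q * m * qconj z = q - z)%quat.
Proof.
intros Hz Hq m. assert (Sm := ball_series_mob z Hz).
assert (K := f_equal (fun s => power_series s q) (mob_alt z)). cbv beta in K.
replace (mob z * (sc q1 - sX * sc (qconj z)))%ser
  with (mob z - sX * (mob z * sc (qconj z)))%ser in K
  by (rewrite smul_assoc, sX_comm; non_commutative_ring).
assert (Smz : ball_series (mob z * sc (qconj z))%ser)
  by (apply (ball_series_mul (mob z)); trivial; apply ball_series_sc).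
rewrite !power_series_sub, power_series_sX_mul, power_series_mul_sc, power_series_sc in K;
  auto using ball_series_sX, ball_series_sc.
- rewrite <- (has_expansion_eq _ _ q has_expansion_id) in K by trivial.
  now rewrite qmul_assoc in K.
- apply (ball_series_mul sX); trivial. apply ball_series_sX.
Qed.

Lemma mobius_inverse_identity z m :
  sqnorm (q1 + m * qconj z) - sqnorm (m + z) = (1 - sqnorm z) * (1 - sqnorm m).
Proof. quat_ring. Qed.

(** By [mob_equation] the value [m] at [q] satisfies [q (1 + m conj(z)) = m + z], from which [q] can be
    computed; the identity for [1 + m conj(z)] and [m + z] shows that it lies in the ball. *)
Lemma bijective_of_mobius_series f a : (forall q, ball1 q -> ball1 (f q)) ->
  has_expansion f a -> mobius_series a -> bijective_on_ball1 f.
Proof.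
intros Hf He (z & u & Hz & Hu & Ea).
assert (Ef : forall q, ball1 q -> f q = (power_series (mob z) q * u)%quat).
{ intros q Hq. rewrite (has_expansion_eq f a q He Hq), Ea. apply power_series_mul_sc; trivial.
  now apply ball_series_mob. }
assert (Hu0 : u <> q0) by (intros E; rewrite E, qmod_0 in Hu; lra).
assert (Hz1 : qmod z < 1) by exact Hz. pose proof (qmod_pos z) as Hz0.
assert (Hden : forall m, qmod m < 1 -> (q1 + m * qconj z)%quat <> q0).
{ intros m Hm E. assert (K := mobius_inverse_identity z m). rewrite E in K.
  replace (sqnorm q0) with 0 in K by (clear; quat_ring).
  pose proof (sqnorm_pos (m + z)). pose proof (proj1 (ball1_sqnorm m) Hm).
  pose proof (proj1 (ball1_sqnorm z) Hz).
  assert (0 < (1 - sqnorm z) * (1 - sqnorm m)) by (apply Rmult_lt_0_compat; lra). lra. }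
assert (Hsol : forall q m, (m - q * m * qconj z = q - z)%quat <-> (q * (q1 + m * qconj z) = m + z)%quat).
{ intros q m; split; intros E; apply qsub_eq0.
  - transitivity ((q - z) - (m - q * m * qconj z))%quat; [non_commutative_ring | rewrite E; apply qsub_diag].
  - transitivity ((m + z) - q * (q1 + m * qconj z))%quat; [non_commutative_ring | rewrite E; apply qsub_diag]. }
split; [exact Hf | split].
- intros q r Hq Hr E. rewrite (Ef q Hq), (Ef r Hr) in E. apply qmul_cancel_r in E; trivial.
  assert (Eq := mob_equation z q Hz Hq). assert (Er := mob_equation z r Hz Hr). cbv zeta in Eq, Er.
  rewrite <- E in Er. apply Hsol in Eq. apply Hsol in Er.
  apply (qmul_cancel_r (q1 + power_series (mob z) q * qconj z)%quat); [|now rewrite Eq, Er].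
  apply Hden. assert (K := Hf q Hq). unfold ball1 in K. rewrite (Ef q Hq), qmod_mul, Hu in K. lra.
- intros w Hw. set (m := (w * qinv u)%quat).
  assert (Hm : qmod m < 1).
  { unfold m. rewrite qmod_mul, qmod_inv, Hu by trivial. unfold ball1 in Hw. lra. }
  set (D := (q1 + m * qconj z)%quat). assert (HD := Hden m Hm : D <> q0).
  set (q := ((m + z) * qinv D)%quat).
  assert (EqD : (q * D = m + z)%quat).
  { unfold q. rewrite <- qmul_assoc, qmul_inv_l; trivial. apply qmul_1_r. }
  assert (Hq : ball1 q).
  { apply ball1_sqnorm. assert (K := mobius_inverse_identity z m). fold D in K.
    rewrite <- EqD, sqnorm_mul in K. assert (0 < sqnorm D) by now apply sqnorm_gt0.
    assert (0 < (1 - sqnorm z) * (1 - sqnorm m)).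
    { apply Rmult_lt_0_compat; [apply ball1_sqnorm in Hz | apply ball1_sqnorm in Hm]; lra. }
    pose proof (sqnorm_pos q). nra. }
  exists q; split; trivial. rewrite (Ef q Hq).
  (* the equation determines the value at q, as m -> q m conj(z) is a contraction *)
  set (m' := power_series (mob z) q).
  assert (Eq := mob_equation z q Hz Hq : (m' - q * m' * qconj z = q - z)%quat).
  apply (proj2 (Hsol q m)) in EqD.
  assert (Ed : ((m' - m) = q * (m' - m) * qconj z)%quat).
  { apply qsub_eq0. transitivity ((m' - q * m' * qconj z) - (m - q * m * qconj z))%quat;
      [non_commutative_ring | rewrite Eq, EqD; apply qsub_diag]. }
  assert (En := f_equal qmod Ed). rewrite !qmod_mul, qmod_conj in En.
  assert (E0 : m' = m).
  { apply qsub_eq0, qmod_eq0. pose proof (qmod_pos (m' - m)). pose proof (qmod_pos q).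
    unfold ball1 in Hq. assert (qmod q * qmod z < 1) by nra.
    set (x := qmod (m' - m)) in *. assert (x = (qmod q * qmod z) * x) by lra. nra. }
  rewrite E0. unfold m. rewrite <- qmul_assoc, qmul_inv_l; trivial. apply qmul_1_r.
Qed.

(** * The hyperbolic difference quotient *)

Lemma has_expansion_ext f g a : (forall q, ball1 q -> f q = g q) -> has_expansion f a -> has_expansion g a.
Proof. intros E H q Hq. rewrite <- E by trivial. now apply H. Qed.

Lemma has_expansion_diff_quotient f a p : has_expansion f a -> ball1 p ->
  has_expansion (diff_quotient f p) (squotient a p).
Proof.
intros Hf Hp. assert (Sa := has_expansion_ball_series f a Hf).
assert (SR := ball_series_squotient a p Sa Hp). assert (Efp := has_expansion_eq f a p Hf Hp).
assert (Spec := squotient_spec a p Sa Hp). rewrite <- Efp in Spec.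
assert (Hid : has_expansion (fun z => z - p)%quat (sX - sc p)%ser)
  by (apply has_expansion_sub_const, has_expansion_id).
assert (HR := has_expansion_power_series _ SR).
assert (Hex : is_diff_quotient f p (power_series (squotient a p))).
{ split; [now apply (slice_regular_of_expansion _ (squotient a p))|].
  intros q Hq. rewrite (star_power_series _ _ _ _ Hid HR), (has_expansion_eq f a q Hf Hq).
  rewrite Spec at 1. rewrite power_series_add, power_series_sc; auto using ball_series_sc.
  apply (ball_series_mul (sX - sc p)%ser); trivial.
  apply ball_series_sub; auto using ball_series_sX, ball_series_sc. }
assert (H : is_diff_quotient f p (diff_quotient f p))
  by exact (epsilon_spec (inhabits (cst q0)) (is_diff_quotient f p) (ex_intro _ _ Hex)).
destruct H as [H1 H2]. destruct (slice_regular_has_expansion _ H1) as (r & Hr).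
replace (squotient a p) with r; trivial.
apply (smul_cancel_l (sX - sc p)%ser); [apply sX_sub_nz|].
transitivity (a - sc (f p))%ser; [|rewrite Spec at 1; non_commutative_ring].
apply (has_expansion_unique (fun q => f q - f p)%quat).
- apply (has_expansion_ext (star (fun z => z - p)%quat (diff_quotient f p))).
  + intros q Hq. rewrite (H2 q Hq). generalize (star (fun z => z - p)%quat (diff_quotient f p) q), (f p).
    clear; quat_ring.
  + now apply has_expansion_star.
- now apply has_expansion_sub_const.
Qed.

(** The quotient is what remains of [M_{f(p)} . f] after dividing by the Moebius factor at [p]. *)
Lemma has_expansion_hyp_diff_quotient f a p : has_expansion f a -> contractive a -> ball1 p ->
  ball1 (f p) -> exists g, has_expansion (hyp_diff_quotient f p) g /\ contractive g /\
    mobius_image (f p) a (mob p * g)%ser.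
Proof.
intros Hf Ha Hp Hc. set (c := f p) in *.
assert (Efp : power_series a p = c) by (symmetry; now apply has_expansion_eq).
assert (Sa := contractive_ball_series a Ha).
destruct (mobius_image_exists c a Ha Hc) as (phi & H).
destruct (mobius_image_right c a phi Ha Hc H) as (b & Sb & B1 & B2 & Ephi).
assert (Cphi := contractive_mobius_image c a phi Ha Hc H).
assert (Z := mobius_image_root c a phi p Ha Hc Hp H Efp).
destruct (schur_division phi p Cphi Hp Z) as [E C]. cbv zeta in E, C.
assert (ER : squotient phi p = (squotient a p * b)%ser).
{ apply (smul_cancel_l (sX - sc p)%ser); [apply sX_sub_nz|].
  transitivity phi.
  - assert (K := squotient_spec phi p (contractive_ball_series _ Cphi) Hp). rewrite Z in K.
    rewrite K at 2. non_commutative_ring.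
  - rewrite Ephi. assert (K := squotient_spec a p Sa Hp). rewrite Efp in K.
    rewrite K at 1. non_commutative_ring. }
rewrite ER in E, C. rewrite E in H.
exists ((sc q1 - sX * sc (qconj p)) * (squotient a p * b))%ser; repeat split; trivial.
rewrite smul_assoc. unfold hyp_diff_quotient. apply has_expansion_star.
- apply has_expansion_star; [apply has_expansion_one_sub_mul_const|].
  now apply has_expansion_diff_quotient.
- apply (has_expansion_star_inv _ (sc q1 - sc (qconj c) * a)%ser); trivial.
  apply (has_expansion_sub (fun _ => q1)); [apply has_expansion_const|].
  apply has_expansion_star; trivial. apply has_expansion_const.
Qed.

Lemma blaschke_of_degree_two f a : has_expansion f a ->
  (blaschke_of_degree 2 f <->
   exists z w u, ball1 z /\ ball1 w /\ qmod u = 1 /\ a = (mob z * (mob w * sc u))%ser).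
Proof.
intros Hf.
assert (Hprod : forall z w u, ball1 z -> ball1 w ->
  has_expansion (fun q => mobius_star_prod z (w :: nil) q * u)%quat (mob z * (mob w * sc u))%ser).
{ intros z w u Hz Hw. rewrite smul_assoc. apply has_expansion_mul_const.
  unfold mobius_star_prod. cbn [fold_left map].
  apply has_expansion_star; now apply has_expansion_mobius. }
split.
- intros (z & l & u & Hl & HB & Hu & E).
  destruct l as [|w [|? ?]]; try discriminate Hl.
  inversion HB as [|? ? Hz HB']; subst. inversion HB' as [|? ? Hw _]; subst.
  exists z, w, u; repeat split; trivial.
  apply (has_expansion_unique f); trivial.
  apply (has_expansion_ext (fun q => mobius_star_prod z (w :: nil) q * u)%quat); [|now apply Hprod].
  intros q Hq; symmetry; now apply E.
- intros (z & w & u & Hz & Hw & Hu & E). exists z, (w :: nil), u; repeat split; trivial.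
  + repeat constructor; trivial.
  + intros q Hq. rewrite (has_expansion_eq _ _ q Hf Hq), E. symmetry.
    apply (has_expansion_eq (fun q => mobius_star_prod z (w :: nil) q * u)%quat); trivial. now apply Hprod.
Qed.

Lemma ball1_point_away s : exists q, ball1 q /\ q <> s.
Proof.
destruct (excluded_middle_informative (s = q0)) as [E|E].
- exists (qreal (1 / 2)); split.
  + unfold ball1. rewrite qmod_real, Rabs_pos_eq; lra.
  + intros K. rewrite E in K. apply (f_equal re) in K. unfold re in K; simpl in K; lra.
- exists q0; split; [apply ball1_0 | congruence].
Qed.

Theorem theorem0p3 :
  forall f : quat -> quat,
  slice_regular f ->
  (forall q : quat, ball1 q -> ball1 (f q)) ->
  ~ bijective_on_ball1 f ->
  forall p s : quat, ball1 p -> ball1 s ->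
  let fstar := hyp_diff_quotient f p in
  let lhs := fun q : quat => qmod (mobius_act (fstar s) fstar q) in
  let rhs := fun q : quat => qmod (mobius s q) in
  (forall q : quat, ball1 q -> (lhs q <= rhs q)%R) /\
  ((exists q : quat, ball1 q /\ q <> s /\ lhs q = rhs q) <->
   blaschke_of_degree 2 f) /\
  ((exists q : quat, ball1 q /\ q <> s /\ lhs q = rhs q) ->
   forall q : quat, ball1 q -> lhs q = rhs q).
Proof.
intros f Rf Bf Nf p s Hp Hs fstar lhs rhs.
destruct (slice_regular_has_expansion f Rf) as (a & Hf).
assert (Sa := has_expansion_ball_series f a Hf).
assert (Ba : forall q, ball1 q -> ball1 (power_series a q)).
{ intros q Hq. rewrite <- (has_expansion_eq f a q Hf Hq). now apply Bf. }
assert (Ca : contractive a).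
{ apply contractive_of_bounded; trivial. intros q Hq; apply Rlt_le. now apply Ba. }
assert (Na : ~ mobius_series a) by (intros K; apply Nf; now apply (bijective_of_mobius_series f a)).
assert (Hc := Bf p Hp).
destruct (has_expansion_hyp_diff_quotient f a p Hf Ca Hp Hc) as (g & Hg & Cg & Hphi).
fold fstar in Hg.
(* a unimodular constant [g] would make [f] a Moebius transformation *)
assert (Bg : forall q, ball1 q -> ball1 (power_series g q)).
{ destruct (strict_or_unimodular g Cg) as [U|U]; trivial. exfalso; apply Na.
  now apply (mobius_series_of_unimodular_quotient a (f p) p g). }
assert (Ed : power_series g s = fstar s) by (symmetry; now apply has_expansion_eq).
assert (Hd : ball1 (fstar s)) by (rewrite <- Ed; now apply Bg).
destruct (mobius_image_exists (fstar s) g Cg Hd) as (psi & Hpsi).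
assert (Cpsi := contractive_mobius_image _ _ _ Cg Hd Hpsi).
assert (Z := mobius_image_root _ _ _ s Cg Hd Hs Hpsi Ed).
destruct (schur_division psi s Cpsi Hs Z) as [Epsi Ch]. cbv zeta in Epsi, Ch.
set (h := ((sc q1 - sX * sc (qconj s)) * squotient psi s)%ser) in *. clearbody h.
assert (Hact := has_expansion_mobius_act _ _ _ _ Hg Cg Hd Hpsi).
assert (Hval : forall q, ball1 q -> exists r, ball1 r /\ lhs q = rhs q * qmod (power_series h r)).
{ intros q Hq.
  destruct (power_series_mul_conjugate (mob s) h q) as (r & Hr & _ & E);
    auto using ball_series_mob, contractive_ball_series.
  exists r; split; [unfold ball1; now rewrite Hr|].
  unfold lhs, rhs. rewrite (has_expansion_eq _ _ q Hact Hq), Epsi, E, qmod_mul.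
  now rewrite (has_expansion_eq _ _ q (has_expansion_mobius s Hs) Hq). }
assert (Hall : unimodular h -> forall q, ball1 q -> lhs q = rhs q).
{ intros (u & Hu & Eh) q Hq. destruct (Hval q Hq) as (r & Hr & E).
  rewrite E, Eh, power_series_sc, Hu by trivial. apply Rmult_1_r. }
assert (Hone : (exists q, ball1 q /\ q <> s /\ lhs q = rhs q) -> unimodular h).
{ intros (q & Hq & Hqs & Eq). destruct (Hval q Hq) as (r & Hr & E). rewrite Eq in E.
  exists (power_series h r).
  assert (U : qmod (power_series h r) = 1).
  { apply Rmult_eq_reg_l with (rhs q); [lra|]. intros K. apply Hqs.
    apply (mob_root s q Hs Hq).
    rewrite <- (has_expansion_eq _ _ q (has_expansion_mobius s Hs) Hq). now apply qmod_eq0. }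
  split; trivial. now apply contractive_maximum. }
rewrite Epsi in Hpsi.
assert (Hdeg := defect1_iff_unimodular_quotient g (fstar s) s h Cg Hd Hs Hpsi Ed).
split; [|split].
- intros q Hq. destruct (Hval q Hq) as (r & Hr & E). rewrite E.
  pose proof (contractive_bound h r Ch Hr). pose proof (qmod_pos (mobius s q)).
  fold (rhs q) in *. rewrite <- (Rmult_1_r (rhs q)) at 2. now apply Rmult_le_compat_l.
- rewrite (blaschke_of_degree_two f a Hf). split.
  + intros E. apply Hone in E. apply Hdeg in E. destruct E as (v & D).
    now apply (degree_two_of_quotient a (f p) p g v).
  + intros (z & w & u & Hz & Hw & Hu & E).
    assert (D : exists v, defect1 g v).
    { apply (defect1_quotient_of_degree_two a (f p) p g z w u); trivial.
      symmetry; now apply has_expansion_eq. }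
    apply Hdeg in D. destruct (ball1_point_away s) as (q & Hq & Hqs).
    exists q; repeat split; trivial. now apply Hall.
- intros E. apply Hone in E. now apply Hall.
Qed.
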